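(* (Transfer principle for asymptotically linear statistics.) Let $\mathcal{Q}$ be a class of joint distributions for $(X,Y)$, let $T:\mathcal{Q}\to\mathbb{R}^m$ be a functional, and let $T_n=t_n(X_1,Y_1,\ldots,X_n,Y_n)$ be an $\mathbb{R}^m$-valued statistic that is asymptotically linear for $T$ on $\mathcal{Q}$ with influence functions $\psi_Q$, $Q\in\mathcal{Q}$. Let $(X_1,\delta_1Y_1,\delta_1),\ldots,(X_n,\delta_nY_n,\delta_n)$ be independent copies of $(X,\delta Y,\delta)$, where $\delta$ is an indicator variable with $E[\delta]=P(\delta=1)>0$ and $(X,Y)$ has distribution $Q\in\mathcal{Q}$. Let $\tilde Q$ be the conditional distribution of $(X,Y)$ given $\delta=1$, and let $T_c$ be the complete case statistic corresponding to $T_n$. If $\tilde Q\in\mathcal{Q}$ and $T(\tilde Q)=T(Q)$, then $$T_c = T(Q)+\frac1n\sum_{j=1}^n \frac{\delta_j}{E[\delta]}\,\psi_{\tilde Q}(X_j,Y_j)+o_P(n^{-1/2}),$$ i.e. $T_c$ is asymptotically linear in the model with missing data with influence function $\tilde\psi(X,\delta Y,\delta)=\frac{\delta}{E[\delta]}\psi_{\tilde Q}(X,Y)$. Consequently $n^{1/2}(T_c-T(Q))$ is asymptotically normal with mean the zero vector and dispersion matrix $(1/E[\delta])\,\Sigma(\tilde Q)$.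
   Context: The statistic $T_n$ is asymptotically linear for $T$ on $\mathcal{Q}$ with influence functions $\psi_Q$ if for every $Q\in\mathcal{Q}$ there is a measurable $\psi_Q$ with values in $\mathbb{R}^m$ such that, when $(X,Y)$ has distribution $Q$, $E[\psi_Q(X,Y)]=0$, $E[\|\psi_Q(X,Y)\|^2]<\infty$, and for independent copies $(X_j,Y_j)$ of $(X,Y)$, $$t_n(X_1,Y_1,\ldots,X_n,Y_n)=T(Q)+\frac1n\sum_{j=1}^n\psi_Q(X_j,Y_j)+o_P(n^{-1/2}).$$ For $Q\in\mathcal{Q}$, $\Sigma(Q)=E[\psi_Q(X,Y)\psi_Q^{\top}(X,Y)]$ with $(X,Y)$ distributed according to $Q$. Here $t_1,t_2,\ldots$ are measurable functions, $t_k$ having $k$ pairs as arguments. Complete case statistic: let $N=\sum_{j=1}^n\delta_j$ and let $i_1<\cdots<i_N$ be the indices $i\in\{1,\ldots,n\}$ with $\delta_i=1$. Then $T_c=t_N(X_{i_1},Y_{i_1},\ldots,X_{i_N},Y_{i_N})$; on the event $N=0$, $T_c$ is a fixed constant. *)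

(* Defs.v *)
From HB Require Import structures.
Set Warnings "-notation-overridden,-notation-incompatible-prefix,-ambiguous-paths".
From mathcomp Require Import all_boot all_order all_algebra finmap.
From mathcomp Require Import all_classical all_reals all_analysis.
Set Implicit Arguments.
Unset Strict Implicit.
Unset Printing Implicit Defensive.
Import Order.TTheory GRing.Theory Num.Theory.
Import numFieldNormedType.Exports.
Local Open Scope classical_set_scope.
Local Open Scope ring_scope.

(* Euclidean norm; the library norm on matrices is the sup norm. *)
Definition enorm (R : realType) (m : nat) (v : 'cV[R]_m) : R :=
  Num.sqrt (\sum_(i < m) v i 0 ^+ 2).

(* Borel measurability of an R^m-valued map, coordinate by coordinate: the
   library puts no sigma-algebra on matrices. *)
Definition vmeasurable d (D : measurableType d) (R : realType) (m : nat)
    (f : D -> 'cV[R]_m) : Prop :=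
  forall i, measurable_fun [set: D] (fun x => f x i 0).

Section laws.
Context d (Om : measurableType d) (R : realType) (P : probability Om R).
Context d' (D : measurableType d').

(* Restricted to measurable sets because a measure takes arbitrary values
   elsewhere. *)
Definition has_law (Z : Om -> D) (mu : set D -> \bar R) : Prop :=
  forall A, measurable A -> P (Z @^-1` A) = mu A.

Definition independent_seq (Z : nat -> Om -> D) : Prop :=
  forall (J : {fset nat}) (A : nat -> set D),
    (forall j, measurable (A j)) ->
    P (\bigcap_(j in [set` J]) (Z j @^-1` A j)) =
      (\prod_(j <- J) P (Z j @^-1` A j))%E.

Definition iid (Z : nat -> Om -> D) (mu : set D -> \bar R) : Prop :=
  independent_seq Z /\ forall j, has_law (Z j) mu.

Definition is_cond_law (Z : Om -> D) (delta : Om -> bool)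
    (mu : set D -> \bar R) : Prop :=
  forall A, measurable A ->
    mu A = (P (Z @^-1` A `&` [set w | delta w]) / P [set w | delta w])%E.

End laws.

Section asymptotics.
Context d (Om : measurableType d) (R : realType) (P : probability Om R).
Context (m : nat).

Definition oP (S : nat -> Om -> 'cV[R]_m) (r : nat -> R) : Prop :=
  forall eps : R, 0 < eps ->
    P [set w | eps * r n < enorm (S n w)] @[n --> \oo] --> 0%E.

Definition centered_square_integrable (f : Om -> 'cV[R]_m) : Prop :=
  [/\ vmeasurable f,
      forall i, ('E_P[(fun w => f w i 0)%R] = 0)%E &
      ('E_P[(fun w => enorm (f w) ^+ 2)%R] < +oo)%E].

Definition linear_expansion (S : nat -> Om -> 'cV[R]_m) (theta : 'cV[R]_m)
    (phi : nat -> Om -> 'cV[R]_m) : Prop :=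
  oP (fun n w => S n w - (theta + n%:R^-1 *: \sum_(j < n) phi j w))
     (fun n => (Num.sqrt n%:R)^-1).

End asymptotics.

Section asymptotic_linearity.
Context (R : realType) d (D : measurableType d) (m : nat).

(* Quantified over every probability space carrying independent copies, since
   only the law Q of the data matters. *)
Definition asymptotically_linear (t : forall k, k.-tuple D -> 'cV[R]_m)
    (T : probability D R -> 'cV[R]_m) (QQ : set (probability D R))
    (psi : probability D R -> D -> 'cV[R]_m) : Prop :=
  forall Q : probability D R, QQ Q ->
    centered_square_integrable Q (psi Q) /\
    forall d' (Om : measurableType d') (P : probability Om R)
        (Z : nat -> {RV P >-> D}),
      iid P (fun j => Z j : Om -> D) Q ->
      linear_expansion P (fun n w => t n [tuple Z j w | j < n]) (T Q)
        (fun j w => psi Q (Z j w)).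

Definition dispersion (Q : probability D R) (psi : D -> 'cV[R]_m) : 'M[R]_m :=
  \matrix_(i, j) fine 'E_Q[(fun z => (psi z *m (psi z)^T) i j)%R]%E.

End asymptotic_linearity.

Section complete_cases.
Context (R : realType) (U V : Type) (Om : Type) (m : nat).
Variables (X : nat -> Om -> U) (Y : nat -> Om -> V) (delta : nat -> Om -> bool).

(* Observations are numbered from 0. *)
Definition complete_cases (n : nat) (w : Om) : seq (U * V) :=
  [seq (X j w, Y j w) | j <- iota 0 n & delta j w].

(* c is the constant used when there is no complete case, so t 0 is unused. *)
Definition complete_case_stat (t : forall k, k.-tuple (U * V) -> 'cV[R]_m)
    (c : 'cV[R]_m) (n : nat) (w : Om) : 'cV[R]_m :=
  let s := complete_cases n w in
  if size s == 0%N then c else t (size s) (in_tuple s).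

End complete_cases.

Section normality.
Context (R : realType).

(* N(mu, s2) for a variance s2 >= 0; normal_prob takes a standard deviation and
   is the uniform law on [0, 1], not a point mass, when it is 0. *)
Definition normal_law (mu s2 : R) : set R -> \bar R :=
  if s2 == 0 then dirac mu else normal_prob mu (Num.sqrt s2).

(* N(mu, V), possibly singular: every linear combination a^T G is
   N(a^T mu, a^T V a). *)
Definition gaussian_vector d (Om : measurableType d) (P : probability Om R)
    m (G : Om -> 'cV[R]_m) (mu : 'cV[R]_m) (V : 'M[R]_m) : Prop :=
  vmeasurable G /\
  forall a : 'cV[R]_m,
    has_law P (fun w => (a^T *m G w) 0 0)
      (normal_law ((a^T *m mu) 0 0) ((a^T *m V *m a) 0 0)).

Definition cvg_in_law d (Om : measurableType d) (P : probability Om R)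
    d' (Om' : measurableType d') (P' : probability Om' R)
    m (Z : nat -> Om -> 'cV[R]_m) (G : Om' -> 'cV[R]_m) : Prop :=
  forall f : 'cV[R]_m -> R, continuous f ->
    (exists M, forall x, `|f x| <= M) ->
    ('E_P[fun w => f (Z n w)] @[n --> \oo] --> 'E_P'[fun w => f (G w)])%E.

Definition asymptotically_normal d (Om : measurableType d)
    (P : probability Om R) m (Z : nat -> Om -> 'cV[R]_m)
    (mu : 'cV[R]_m) (V : 'M[R]_m) : Prop :=
  exists d' (Om' : measurableType d') (P' : probability Om' R)
      (G : Om' -> 'cV[R]_m),
    gaussian_vector P' G mu V /\ cvg_in_law P P' Z G.

End normality.

(* (x, u, b) is a value of (X, delta Y, delta) and p stands for E[delta]. *)
Definition psi_tilde (R : realType) (U : Type) m (p : R)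
    (psi : U * R -> 'cV[R]_m) (z : U * R * bool) : 'cV[R]_m :=
  (z.2%:R / p) *: psi z.1.

(* Main.v *)
Require Import Defs.
From HB Require Import structures.
Set Warnings "-notation-overridden,-notation-incompatible-prefix,-ambiguous-paths".
From mathcomp Require Import all_boot all_order all_algebra finmap ring lra.
From mathcomp Require Import all_classical all_reals all_analysis.
From mathcomp Require Import measurable_realfun.
Set Implicit Arguments.
Unset Strict Implicit.
Unset Printing Implicit Defensive.
Import Order.TTheory GRing.Theory Num.Theory.
Import numFieldNormedType.Exports.
Local Open Scope classical_set_scope.
Local Open Scope ring_scope.

(* The complete cases, in order of appearance, form an iid sequence Z with law
   Qt, and the tuple of the first k of them is independent of the event N = k.
   Hence the o_P remainder of the statistic along Z stays negligible at the
   random index N, which tends to infinity in probability. The two linear terms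
   differ by (p / N - 1 / n) times the sum of the weighted influences, where
   p / N - 1 / n = o_P(1 / n) by Chebyshev and the sum is O_P(sqrt n).

   Normality needs a multivariate central limit theorem. Characteristic functions
   of linear combinations converge by a second order expansion of cos and sin;
   trigonometric polynomials approximate bounded continuous functions on boxes
   without increasing their sup norm (Bernstein polynomials in (1 + sin (c x)) / 2),
   and tightness does the rest. The Gaussian limit is built from independent
   normal variables through a Cholesky factorization of the dispersion matrix. *)

(** * Measures on tuples and independence *)

Definition tuple_rect (D : Type) n (A : nat -> set D) : set (n.-tuple D) :=
  [set t | forall i : 'I_n, A i (tnth t i)].

Arguments tuple_rect {D} n A.

Lemma measurable_tuple_rect d (D : measurableType d) n (A : nat -> set D) :
  (forall i, measurable (A i)) -> measurable (tuple_rect n A).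
Proof.
move=> mA; rewrite (_ : tuple_rect n A =
  \bigcap_(i in [set: 'I_n]) ((fun t => tnth t i) @^-1` A i)); last first.
  by apply/seteqP; split=> [t At i _|t At i]; [exact: At|exact: (At i)].
apply: fin_bigcap_measurable => // i _.
by rewrite -[X in measurable X]setTI; exact: measurable_tnth.
Qed.

Lemma tuple_measure_unique d (D : measurableType d) (R : realType) n
    (m1 m2 : {measure set (n.-tuple D) -> \bar R}) :
  (m1 setT < +oo)%E ->
  (forall A, (forall i, measurable (A i)) ->
     m1 (tuple_rect n A) = m2 (tuple_rect n A)) ->
  forall X, measurable X -> m1 X = m2 X.
Proof.
move=> m1oo m12 X mX.
pose C : set (set (n.-tuple D)) :=
  [set B | exists2 A, forall i, measurable (A i) & B = tuple_rect n A].
apply: (measure_unique C (fun=> setT)) => //.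
- apply/seteqP; split.
  + apply: smallest_sub; first exact: smallest_sigma_algebra.
    move=> B; rewrite -bigcup_seq/= => -[i _ [A mA <-]].
    apply: sub_sigma_algebra.
    exists (fun j => if j == i :> nat then A else setT).
      by move=> j; case: ifP.
    rewrite setTI; apply/seteqP; split=> t /=.
      move=> At j; case: ifPn => // /eqP ji.
      by rewrite (_ : j = i) //; apply: val_inj.
    by move=> /(_ i); rewrite eqxx.
  + apply: smallest_sub; first exact: sigma_algebra_measurable.
    by move=> _ [A mA ->]; exact: measurable_tuple_rect.
- move=> _ _ [A mA ->] [B mB ->]; exists (fun i => A i `&` B i).
    by move=> i; exact: measurableI.
  apply/seteqP; split=> t /=.
    by move=> [At Bt] i; split; [exact: At|exact: Bt].
  by move=> ABt; split=> i; have [] := ABt i.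
- by move=> _; exists (fun=> setT) => //; apply/seteqP; split.
- by rewrite bigcup_const//.
- by move=> _ [A mA ->]; exact: m12.
Qed.

Definition mfun_of d d' (T1 : measurableType d) (T2 : measurableType d')
    (f : T1 -> T2) (mf : measurable_fun setT f) : {mfun T1 >-> T2} :=
  HB.pack f (isMeasurableFun.Build _ _ _ _ f mf).

Definition image_measure d d' (T1 : measurableType d) (T2 : measurableType d')
    (R : realType) (m : {measure set T1 -> \bar R}) (f : T1 -> T2)
    (mf : measurable_fun setT f) : {measure set T2 -> \bar R}.
Proof. by refine (pushforward m f); exact: mf. Defined.

Arguments image_measure {d d' T1 T2 R} m [f] mf.

Lemma measurable_tuple_of d d' (Om : measurableType d) (D : measurableType d') n
    (Z : nat -> Om -> D) :
  (forall j, measurable_fun setT (Z j)) ->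
  measurable_fun setT (fun w => [tuple Z j w | j < n]).
Proof.
move=> mZ; apply/measurable_fun_tnthP => i.
rewrite (_ : _ \o _ = Z i); first exact: mZ.
by apply/funext => w /=; rewrite tnth_mktuple.
Qed.

Lemma measurable_preimageT d d' (T1 : measurableType d) (T2 : measurableType d')
    (f : T1 -> T2) A :
  measurable_fun setT f -> measurable A -> measurable (f @^-1` A).
Proof. by move=> mf mA; rewrite -[X in measurable X]setTI; exact: mf. Qed.

Section independent_block.
Context d (Om : measurableType d) (R : realType) (P : probability Om R).
Context d' (D : measurableType d') (Z : nat -> Om -> D).
Hypothesis mZ : forall j, measurable_fun setT (Z j).
Hypothesis indepZ : independent_seq P Z.

Let V n (w : Om) : n.-tuple D := [tuple Z j w | j < n].

Let mV n : measurable_fun setT (V n).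
Proof. exact: measurable_tuple_of. Qed.

Lemma independent_next n (A : set (n.-tuple D)) (B : set D) :
  measurable A -> measurable B ->
  P ((fun w => [tuple Z j w | j < n]) @^-1` A `&` Z n @^-1` B) =
  (P ((fun w => [tuple Z j w | j < n]) @^-1` A) * P (Z n @^-1` B))%E.
Proof.
move=> mA mB; rewrite -[fun w => _]/(V n).
have mE : measurable (Z n @^-1` B) by exact: measurable_preimageT.
pose m1 : {measure set (n.-tuple D) -> \bar R} :=
  image_measure (mrestr P mE) (@mV n).
pose c : {nonneg R} := NngNum (fine_ge0 (measure_ge0 P (Z n @^-1` B))).
pose m2 : {measure set (n.-tuple D) -> \bar R} :=
  mscale c (image_measure P (@mV n)).
have m1E X : m1 X = P (V n @^-1` X `&` Z n @^-1` B) by [].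
have m2E X : m2 X = (P (V n @^-1` X) * P (Z n @^-1` B))%E.
  by rewrite /m2 /= /mscale/= fineK ?fin_num_measure// muleC.
rewrite -m1E -m2E; apply: tuple_measure_unique => //.
  rewrite m1E (le_lt_trans (probability_le1 _ _)) ?ltry//.
  by apply: measurableI => //; apply: measurable_preimageT => //; exact: mV.
move=> C mC; rewrite m1E m2E.
pose C' j := if (j < n)%N then C j else B.
have mC' j : measurable (C' j) by rewrite /C'; case: ifP.
pose J := [fset j in iota 0 n]%fset.
have JE j : (j \in J) = (j < n)%N by rewrite !inE mem_iota.
have nJ : n \notin J by rewrite JE ltnn.
have VE : V n @^-1` tuple_rect n C = \bigcap_(j in [set` J]) (Z j @^-1` C' j).
  apply/seteqP; split=> w /=.
    move=> Vw j /=; rewrite JE => jn; rewrite /C' jn.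
    by have := Vw (Ordinal jn); rewrite tnth_mktuple.
  move=> h i; rewrite tnth_mktuple.
  by have := h i; rewrite /= JE ltn_ord /C' ltn_ord => /(_ isT).
have VBE : V n @^-1` tuple_rect n C `&` Z n @^-1` B =
    \bigcap_(j in [set` (n |` J)%fset]) (Z j @^-1` C' j).
  rewrite VE; apply/seteqP; split=> w /=.
    move=> [h Bw] j /=; rewrite !inE => /orP[/eqP -> |]; first by rewrite /C' ltnn.
    by rewrite mem_iota /= => jn; apply: h; rewrite /= JE.
  move=> h; split.
    by move=> j /= jJ; apply: h; rewrite /= in_fset1U jJ orbT.
  by have := h n; rewrite /= in_fset1U eqxx /C' ltnn; exact.
rewrite VBE VE !indepZ// big_fsetU1//= muleC; congr (_ * _)%E.
by rewrite /C' ltnn.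
Qed.

End independent_block.

Section expectation_product.
Local Open Scope ereal_scope.
Context d (Om : measurableType d) (R : realType) (P : probability Om R).

(* Joint law = product law, then Fubini. *)
Lemma expectation_indep_mul (X Y : Om -> R) :
  (forall A B, measurable A -> measurable B ->
     P (X @^-1` A `&` Y @^-1` B) = P (X @^-1` A) * P (Y @^-1` B)) ->
  P.-integrable setT (EFin \o X) -> P.-integrable setT (EFin \o Y) ->
  P.-integrable setT (EFin \o (X \* Y)%R) /\
  \int[P]_w (X w * Y w)%:E = (\int[P]_w (X w)%:E) * (\int[P]_w (Y w)%:E).
Proof.
move=> indep iX iY.
have mX : measurable_fun setT X by apply/measurable_EFinP; exact: measurable_int iX.
have mY : measurable_fun setT Y by apply/measurable_EFinP; exact: measurable_int iY.
pose fX : {RV P >-> R} := mfun_of mX.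
pose fY : {RV P >-> R} := mfun_of mY.
pose mu := distribution P fX; pose nu := distribution P fY.
have mXY : measurable_fun setT (fun w => (X w, Y w)) by exact/measurable_fun_pair.
pose XY : {RV P >-> (R * R)%type} := mfun_of mXY.
have lawE : forall C, measurable C -> (mu \x nu) C = distribution P XY C.
  by apply: product_measure_unique => A B mA mB /=; exact: indep.
have imu : mu.-integrable setT (EFin : R -> \bar R).
  apply/integrableP; split; first exact/measurable_EFinP.
  rewrite ge0_integral_distribution//=; last exact: measurableT_comp.
  by have /integrableP[] := iX.
have inu : nu.-integrable setT (EFin : R -> \bar R).
  apply/integrableP; split; first exact/measurable_EFinP.
  rewrite ge0_integral_distribution//=; last exact: measurableT_comp.
  by have /integrableP[] := iY.
have mM : measurable_fun setT (fun z : R * R => (z.1 * z.2)%:E).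
  by apply/measurable_EFinP; exact: measurable_funM.
have iM : (mu \x nu).-integrable setT (fun z : R * R => (z.1 * z.2)%:E).
  apply/integrable12ltyP => //=.
  have nufin : \int[nu]_y `|y|%:E \is a fin_num.
    rewrite ge0_fin_numE ?integral_ge0//.
    by have /integrableP[] := inu.
  have inner x : \int[nu]_y `|(x * y)%:E| = `|x|%:E * (fine (\int[nu]_y `|y|%:E))%:E.
    rewrite fineK// -ge0_integralZl//; last by apply/measurable_EFinP; exact: normr_measurable.
    by apply: eq_integral => y _; rewrite /= normrM EFinM.
  under eq_integral do rewrite inner.
  rewrite ge0_integralZr//=; last 2 first.
  - by apply/measurable_EFinP; exact: normr_measurable.
  - by rewrite lee_fin fine_ge0// integral_ge0.
  rewrite lte_mul_pinfty// ?integral_ge0//= ?ltry//.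
  by rewrite ge0_fin_numE ?integral_ge0//; have /integrableP[] := imu.
have lawint (f : R * R -> \bar R) : \int[mu \x nu]_z f z = \int[distribution P XY]_z f z.
  by apply: eq_measure_integral => C mC _; exact: lawE.
have iMP : P.-integrable setT (EFin \o (X \* Y)%R).
  apply/integrableP; split; first by apply/measurable_EFinP; exact: measurable_funM.
  have /integrableP[_] := iM.
  rewrite lawint ge0_integral_distribution//=.
  by apply/measurable_EFinP; apply: measurableT_comp => //; exact: measurable_funM.
split => //.
rewrite -(integral_distribution (X := XY) (f := fun z => (z.1 * z.2)%:E))//.
rewrite -lawint -integral12_prod_meas1//.
under eq_integral => x _.
  rewrite /fubini_F/=.
  under eq_integral => y _ do rewrite EFinM.
  rewrite integralZl//; over.
rewrite -(fineK (integrable_fin_num _ inu))//= integralZr//=.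
rewrite fineK ?(integrable_fin_num _ inu)//=.
by rewrite -(integral_distribution (X := fX))// -(integral_distribution (X := fY)).
Qed.

End expectation_product.

(** * Real central limit theorem *)

Section trig_bounds.
Variable R : realType.
Implicit Types x y : R.

Let MVTR (f df : R -> R) (a b : R) : a <= b ->
  (forall x, is_derive x 1 f (df x)) ->
  exists2 c, c \in `[a, b]%R & f b - f a = df c * (b - a).
Proof.
move=> ab dfx; apply: MVT_segment => // x.
by apply: continuous_subspaceT => y; apply/differentiable_continuous/derivable1_diffP;
  apply: ex_derive.
Qed.

Lemma lipschitz_cos x y : `|cos x - cos y| <= `|x - y|.
Proof.
wlog xy : x y / y <= x.
  move=> h; have [/h//|/ltW/h] := leP y x.
  by rewrite distrC (distrC y).
have [c _ ->] := MVTR xy (fun x => is_derive_cos x).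
by rewrite normrM normrN ler_piMl// sin_max.
Qed.

Lemma lipschitz_sin x y : `|sin x - sin y| <= `|x - y|.
Proof.
wlog xy : x y / y <= x.
  move=> h; have [/h//|/ltW/h] := leP y x.
  by rewrite distrC (distrC y).
have [c _ ->] := MVTR xy (fun x => is_derive_sin x).
by rewrite normrM ler_piMl// cos_max.
Qed.

Lemma cos_half x : 1 - cos x = 2 * sin (x / 2) ^+ 2.
Proof.
have xE : x = (x / 2) *+ 2 by rewrite -mulr_natr divfK.
by rewrite [in LHS]xE cos_mulr2n cos2sin2; ring.
Qed.

Lemma one_sub_cos_le x : 0 <= 1 - cos x <= x ^+ 2 / 2.
Proof.
rewrite subr_ge0 cos_le1 cos_half /=.
have := lipschitz_sin (x / 2) 0; rewrite sin0 !subr0 => h.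
have : `|sin (x / 2)| ^+ 2 <= `|x / 2| ^+ 2 by rewrite lerXn2r ?nnegrE.
by rewrite !real_normK ?num_real// => {}h; lra.
Qed.

Lemma sin_sub_id_le3 x : `|sin x - x| <= `|x| ^+ 3 / 2.
Proof.
wlog x0 : x / 0 <= x.
  move=> h; have [/h//|/ltW x0] := leP 0 x.
  by have := h (- x); rewrite oppr_ge0 sinN opprK => /(_ x0); rewrite -normrN opprD opprK normrN.
have dg (t : R) : is_derive t (1 : R) (fun t : R => t - sin t) (1 - cos t).
  exact: is_deriveB.
have [c] := MVTR x0 dg.
rewrite sin0 !subr0 in_itv/= => /andP[c0 cx] h.
rewrite distrC h (ger0_norm x0).
have /andP[c1 c2] := one_sub_cos_le c.
rewrite ger0_norm ?mulr_ge0//.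
apply: le_trans (_ : x ^+ 2 / 2 * x <= _); last first.
  by rewrite [leLHS](_ : _ = x ^+ 3 / 2)//; field.
rewrite ler_wpM2r// (le_trans c2)// ler_pM2r//.
by rewrite lerXn2r ?nnegrE.
Qed.

Lemma sin_sub_id_le2 x : `|sin x - x| <= x ^+ 2.
Proof.
rewrite -[x ^+ 2]real_normK ?num_real//.
have [x2|x2] := leP `|x| 2.
  apply: le_trans (sin_sub_id_le3 x) _.
  by rewrite exprS; have := sqr_ge0 `|x|; nra.
apply: le_trans (ler_normB _ _) _.
have : `|sin x| <= `|x| by have := lipschitz_sin x 0; rewrite sin0 !subr0.
by nra.
Qed.

Lemma cos_taylor2 x : `|1 - cos x - x ^+ 2 / 2| <= `|x| ^+ 4.
Proof.
rewrite cos_half.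
have -> : 2 * sin (x / 2) ^+ 2 - x ^+ 2 / 2 =
  2 * ((sin (x / 2) - x / 2) * (sin (x / 2) + x / 2)) by field.
rewrite !normrM (@ger0_norm _ (2 : R))//.
have h1 := sin_sub_id_le3 (x / 2).
have h2 : `|sin (x / 2) + x / 2| <= `|x|.
  apply: le_trans (ler_normD _ _) _.
  have : `|sin (x / 2)| <= `|x / 2| by have := lipschitz_sin (x / 2) 0; rewrite sin0 !subr0.
  by rewrite normrM (@ger0_norm _ (2^-1 : R))// => ?; lra.
rewrite normrM (@ger0_norm _ (2^-1 : R))// in h1.
apply: le_trans (_ : 2 * ((`|x| / 2) ^+ 3 / 2 * `|x|) <= _).
  by rewrite ler_pM2l// ler_pM.
have -> : 2 * ((`|x| / 2) ^+ 3 / 2 * `|x|) = `|x| ^+ 4 / 8 by field.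
have : 0 <= `|x| ^+ 4 by rewrite exprn_ge0.
by lra.
Qed.

End trig_bounds.

Section equal_laws.
Context d d' d'' (Om : measurableType d) (Om' : measurableType d')
  (T : measurableType d'') (R : realType).
Variables (P : {measure set Om -> \bar R}) (P' : {measure set Om' -> \bar R}).
Variables (X : Om -> T) (X' : Om' -> T).
Hypotheses (mX : measurable_fun setT X) (mX' : measurable_fun setT X').
Hypothesis eq_law : forall A, measurable A -> P (X @^-1` A) = P' (X' @^-1` A).

Let ge0_integral_eq_law (g : T -> \bar R) : measurable_fun setT g ->
  (forall x, 0 <= g x)%E ->
  (\int[P]_w g (X w) = \int[P']_w g (X' w))%E.
Proof.
move=> mg g0.
have h := @ge0_integral_pushforward _ _ _ _ _ _ mX P setT g measurableT.
have h' := @ge0_integral_pushforward _ _ _ _ _ _ mX' P' setT g measurableT.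
rewrite preimage_setT in h h'.
rewrite -(h mg (fun x _ => g0 x)) -(h' mg (fun x _ => g0 x)).
by apply: eq_measure_integral => A mA _; exact: eq_law.
Qed.

Lemma integral_eq_law (g : T -> \bar R) : measurable_fun setT g ->
  (\int[P]_w g (X w) = \int[P']_w g (X' w))%E.
Proof.
move=> mg; rewrite integralE [RHS]integralE.
have hp := ge0_integral_eq_law (measurable_funepos mg) (funepos_ge0 g).
have hn := ge0_integral_eq_law (measurable_funeneg mg) (funeneg_ge0 g).
congr (_ - _)%E.
  rewrite -[LHS](_ : \int[P]_x g^\+ (X x) = _)%E; last first.
    by apply: eq_integral => x _; rewrite !funeposE.
  by rewrite hp; apply: eq_integral => x _; rewrite !funeposE.
rewrite -[LHS](_ : \int[P]_x g^\- (X x) = _)%E; last first.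
  by apply: eq_integral => x _; rewrite !funenegE.
by rewrite hn; apply: eq_integral => x _; rewrite !funenegE.
Qed.

Lemma integrable_eq_law (g : T -> \bar R) : measurable_fun setT g ->
  P.-integrable setT (g \o X) -> P'.-integrable setT (g \o X').
Proof.
move=> mg /integrableP[_ h]; apply/integrableP; split.
  exact: measurableT_comp.
rewrite /= -(ge0_integral_eq_law (g := abse \o g))//.
  exact: measurableT_comp.
by move=> x; exact: abse_ge0.
Qed.

Lemma Rintegral_eq_law (g : T -> R) : measurable_fun setT g ->
  \int[P]_w g (X w) = \int[P']_w g (X' w).
Proof.
move=> mg; congr fine.
by rewrite (integral_eq_law (g := EFin \o g))//; exact/measurable_EFinP.
Qed.

End equal_laws.

Arguments integral_eq_law {d d' d'' Om Om' T R P P' X X'} mX mX' eq_law g mg.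
Arguments integrable_eq_law {d d' d'' Om Om' T R P P' X X'} mX mX' eq_law g mg _.
Arguments Rintegral_eq_law {d d' d'' Om Om' T R P P' X X'} mX mX' eq_law g mg.

Section bounded_integrands.
Context d (T : measurableType d) (R : realType) (P : probability T R).

Lemma integrable_bounded (f : T -> R) M : measurable_fun setT f ->
  (forall x, `|f x| <= M) -> P.-integrable setT (EFin \o f).
Proof.
move=> mf fM; have P1 : (P setT < +oo)%E by rewrite probability_setT ltry.
apply: measurable_bounded_integrable => //.
by exists M; split; [exact: num_real|move=> N MN x _; exact: le_trans (ltW MN)].
Qed.

Lemma Rintegral_bound (f : T -> R) M : measurable_fun setT f ->
  (forall x, `|f x| <= M) -> `|\int[P]_x f x| <= M.
Proof.
move=> mf fM; have iF := integrable_bounded mf fM.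
apply: le_trans (le_normr_Rintegral _ iF) _ => //.
have -> : M = \int[P]_x (fun=> M) x.
  by rewrite /Rintegral integral_cst//= probability_setT mule1.
apply: le_Rintegral => //; first exact: integrable_norm iF.
exact: (@integrable_bounded (fun=> M) `|M|).
Qed.

Lemma Rdominated_cvg (f_ : nat -> T -> R) (f g : T -> R) :
  (forall n, measurable_fun setT (f_ n)) -> measurable_fun setT f ->
  (forall x, f_ n x @[n --> \oo] --> f x) ->
  P.-integrable setT (EFin \o g) -> (forall n x, `|f_ n x| <= g x) ->
  \int[P]_x f_ n x @[n --> \oo] --> \int[P]_x f x.
Proof.
move=> mf_ mf cf ig fg.
have cf' x : setT x -> EFin (f_ n x) @[n --> \oo] --> EFin (f x).
  by move=> _; apply: cvg_EFin; [exact: nearW|exact: cf].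
have mf_' n : measurable_fun setT (EFin \o f_ n) by exact/measurable_EFinP.
have mf' : measurable_fun setT (EFin \o f) by exact/measurable_EFinP.
have [if_ _ h] := @dominated_convergence _ _ _ P setT measurableT
  (fun n => EFin \o f_ n) (EFin \o f) (EFin \o g) mf_' mf' (aeW P cf') ig
  (aeW P (fun x n _ => fg n x)).
apply: fine_cvg; rewrite fineK//.
exact: integrable_fin_num.
Qed.

Lemma Rintegral_indep_mul (X Y : T -> R) :
  (forall A B, measurable A -> measurable B ->
     P (X @^-1` A `&` Y @^-1` B) = (P (X @^-1` A) * P (Y @^-1` B))%E) ->
  P.-integrable setT (EFin \o X) -> P.-integrable setT (EFin \o Y) ->
  \int[P]_w (X w * Y w) = (\int[P]_w X w) * (\int[P]_w Y w).
Proof.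
move=> ind iX iY; have [_ h] := expectation_indep_mul ind iX iY.
by rewrite /Rintegral h fineM//; exact: integrable_fin_num.
Qed.

End bounded_integrands.

Section scaling.
Variable R : realType.
Implicit Types (a : R) (n : nat).

Lemma cvg_invn : n%:R^-1 @[n --> \oo] --> (0 : R).
Proof. by rewrite -(cvg_shiftS (fun n : nat => n%:R^-1 : R)); exact: cvg_harmonic. Qed.

Lemma sqr_inv_sqrtn n : (Num.sqrt n%:R)^-1 ^+ 2 = n%:R^-1 :> R.
Proof. by rewrite exprVn sqr_sqrtr. Qed.

Lemma cos_scaled_le a n :
  `|n%:R * (1 - cos ((Num.sqrt n%:R)^-1 * a))| <= a ^+ 2.
Proof.
have [->|n0] := posnP n; first by rewrite mul0r normr0 sqr_ge0.
have /andP[c0 c1] := one_sub_cos_le ((Num.sqrt n%:R)^-1 * a).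
rewrite ger0_norm ?mulr_ge0//.
apply: le_trans (_ : n%:R * (((Num.sqrt n%:R)^-1 * a) ^+ 2 / 2) <= _).
  by rewrite ler_wpM2l.
rewrite exprMn sqr_inv_sqrtn !mulrA divff ?pnatr_eq0 -?lt0n// mul1r.
by have := sqr_ge0 a; lra.
Qed.

Lemma sin_scaled_le a n :
  `|n%:R * (sin ((Num.sqrt n%:R)^-1 * a) - (Num.sqrt n%:R)^-1 * a)| <= a ^+ 2.
Proof.
have [->|n0] := posnP n; first by rewrite mul0r normr0 sqr_ge0.
rewrite normrM ger0_norm//.
apply: le_trans (_ : n%:R * (((Num.sqrt n%:R)^-1 * a) ^+ 2) <= _).
  by rewrite ler_wpM2l// sin_sub_id_le2.
by rewrite exprMn sqr_inv_sqrtn !mulrA divff ?pnatr_eq0 -?lt0n// mul1r.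
Qed.

Lemma cvg_inv_sqrtn : (Num.sqrt n%:R)^-1 @[n --> \oo] --> (0 : R).
Proof.
have h : Num.sqrt (n%:R^-1) @[n --> \oo] --> (Num.sqrt 0 : R).
  by apply: continuous_cvg; [exact: sqrt_continuous|exact: cvg_invn].
rewrite sqrtr0 in h; apply: cvg_trans h; apply: near_eq_cvg.
by apply: nearW => n; rewrite sqrtrV.
Qed.

Lemma cos_scaled_cvg a :
  n%:R * (1 - cos ((Num.sqrt n%:R)^-1 * a)) @[n --> \oo] --> a ^+ 2 / 2.
Proof.
apply/subr_cvg0/norm_cvg0P.
have h : `|a| ^+ 4 * n%:R^-1 @[n --> \oo] --> (0 : R).
  by rewrite -(mulr0 (`|a| ^+ 4)); apply: cvgM; [exact: cvg_cst|exact: cvg_invn].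
apply: (squeeze_cvgr _ (cvg_cst 0) h).
exists 1%N => // n /= n0; rewrite normr_ge0/=.
have nn0 : n%:R != 0 :> R by rewrite pnatr_eq0 -lt0n.
have -> : n%:R * (1 - cos ((Num.sqrt n%:R)^-1 * a)) - a ^+ 2 / 2 =
  n%:R * (1 - cos ((Num.sqrt n%:R)^-1 * a) - ((Num.sqrt n%:R)^-1 * a) ^+ 2 / 2).
  by rewrite exprMn sqr_inv_sqrtn; field.
rewrite normrM ger0_norm//.
apply: le_trans (_ : n%:R * `|(Num.sqrt n%:R)^-1 * a| ^+ 4 <= _).
  by rewrite ler_wpM2l// cos_taylor2.
rewrite normrM (ger0_norm (_ : 0 <= (Num.sqrt n%:R)^-1)) ?invr_ge0 ?sqrtr_ge0//.
have -> : ((Num.sqrt n%:R)^-1 * `|a|) ^+ 4 = ((Num.sqrt n%:R)^-1 ^+ 2) ^+ 2 * `|a| ^+ 4.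
  by rewrite exprMn -exprM.
by rewrite sqr_inv_sqrtn le_eqVlt; apply/orP; left; apply/eqP; field.
Qed.

Lemma sin_scaled_cvg a :
  n%:R * (sin ((Num.sqrt n%:R)^-1 * a) - (Num.sqrt n%:R)^-1 * a)
    @[n --> \oo] --> 0.
Proof.
apply/norm_cvg0P.
have h : `|a| ^+ 3 * (Num.sqrt n%:R)^-1 @[n --> \oo] --> (0 : R).
  by rewrite -(mulr0 (`|a| ^+ 3)); apply: cvgM; [exact: cvg_cst|exact: cvg_inv_sqrtn].
apply: (squeeze_cvgr _ (cvg_cst 0) h).
exists 1%N => // n /= n0; rewrite normr_ge0/=.
have nn0 : n%:R != 0 :> R by rewrite pnatr_eq0 -lt0n.
rewrite normrM ger0_norm//.
apply: le_trans (_ : n%:R * (`|(Num.sqrt n%:R)^-1 * a| ^+ 3 / 2) <= _).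
  by rewrite ler_wpM2l// sin_sub_id_le3.
have s0 : 0 <= (Num.sqrt n%:R)^-1 :> R by rewrite invr_ge0 sqrtr_ge0.
rewrite normrM (ger0_norm s0) exprMn exprSr sqr_inv_sqrtn.
set c := (Num.sqrt _)^-1 in s0 *; have A0 : 0 <= `|a| ^+ 3 by rewrite exprn_ge0.
have -> : n%:R * (n%:R^-1 * c * `|a| ^+ 3 / 2) = `|a| ^+ 3 * c / 2 by field.
by have := mulr_ge0 A0 s0; lra.
Qed.

Context d (T : measurableType d) (P : probability T R).
Variable y : T -> R.
Hypotheses (my : measurable_fun setT y)
  (iy2 : P.-integrable setT (EFin \o (fun x => y x ^+ 2))).

Let mcy c : measurable_fun setT (fun x => c * y x).
Proof. exact: measurable_funM. Qed.

Lemma measurable_cosM c : measurable_fun setT (fun x => cos (c * y x)).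
Proof.
apply: measurableT_comp => //; apply: continuous_measurable_fun.
exact: continuous_cos.
Qed.

Lemma measurable_sinM c : measurable_fun setT (fun x => sin (c * y x)).
Proof.
apply: measurableT_comp => //; apply: continuous_measurable_fun.
exact: continuous_sin.
Qed.

Lemma integrable_cosM c : P.-integrable setT (EFin \o (fun x => cos (c * y x))).
Proof.
by apply: (@integrable_bounded _ _ _ _ _ 1) => [|x]; [exact: measurable_cosM|exact: cos_max].
Qed.

Lemma integrable_sinM c : P.-integrable setT (EFin \o (fun x => sin (c * y x))).
Proof.
by apply: (@integrable_bounded _ _ _ _ _ 1) => [|x]; [exact: measurable_sinM|exact: sin_max].
Qed.

Lemma square_integrable_integrable : P.-integrable setT (EFin \o y).
Proof.
have i1 : P.-integrable setT (EFin \o (fun x => 1 + y x ^+ 2)).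
  have i0 : P.-integrable setT (EFin \o (fun=> 1 : R)).
    by apply: (@integrable_bounded _ _ _ _ _ 1) => // x; rewrite /= normr1.
  exact: (integrableD measurableT i0 iy2).
apply: le_integrable i1 => //; first exact/measurable_EFinP.
move=> x _; rewrite lee_fin [leRHS]ger0_norm ?addr_ge0 ?sqr_ge0//.
rewrite -[y x ^+ 2]real_normK ?num_real//.
by have := sqr_ge0 (`|y x| - 1); nra.
Qed.

Let iy := square_integrable_integrable.

Lemma scaled_expectation_cos :
  n%:R * (1 - \int[P]_x cos ((Num.sqrt n%:R)^-1 * y x)) @[n --> \oo] -->
  (\int[P]_x (y x ^+ 2)) / 2.
Proof.
have -> : (\int[P]_x (y x ^+ 2)) / 2 = \int[P]_x (y x ^+ 2 / 2).
  by rewrite RintegralZr.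
have -> : (fun n => n%:R * (1 - \int[P]_x cos ((Num.sqrt n%:R)^-1 * y x))) =
    (fun n => \int[P]_x (n%:R * (1 - cos ((Num.sqrt n%:R)^-1 * y x)))).
  apply/funext => n.
  have i1 : P.-integrable setT (EFin \o (fun x => 1 : R)).
    by apply: (@integrable_bounded _ _ _ _ _ 1) => // x; rewrite /= normr1.
  rewrite RintegralZl//; last exact: (integrableB measurableT i1 (integrable_cosM _)).
  rewrite RintegralB//; last exact: integrable_cosM.
  by rewrite {2}/Rintegral integral_cst//= probability_setT mule1.
apply: (Rdominated_cvg (g := fun x => y x ^+ 2)) => //.
- move=> n; apply: measurable_funM => //; apply: measurable_funB => //.
  exact: measurable_cosM.
- by apply: measurable_funM => //; exact: measurable_funX.
- by move=> x; exact: cos_scaled_cvg.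
- by move=> n x; exact: cos_scaled_le.
Qed.

Lemma scaled_expectation_sin : \int[P]_x y x = 0 ->
  n%:R * (\int[P]_x sin ((Num.sqrt n%:R)^-1 * y x)) @[n --> \oo] --> 0.
Proof.
move=> y0.
have -> : 0 = \int[P]_x (0 : R) by rewrite /Rintegral integral0.
have -> : (fun n => n%:R * (\int[P]_x sin ((Num.sqrt n%:R)^-1 * y x))) =
    (fun n => \int[P]_x (n%:R * (sin ((Num.sqrt n%:R)^-1 * y x) - (Num.sqrt n%:R)^-1 * y x))).
  apply/funext => n.
  have icy : P.-integrable setT (EFin \o (fun x => (Num.sqrt n%:R)^-1 * y x)).
    exact: (integrableZl measurableT _ iy).
  rewrite RintegralZl//; last exact: (integrableB measurableT (integrable_sinM _) icy).
  rewrite RintegralB//; last exact: integrable_sinM.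
  by rewrite [X in _ - X]RintegralZl// y0 mulr0 subr0.
apply: (Rdominated_cvg (g := fun x => y x ^+ 2)) => //.
- move=> n; apply: measurable_funM => //; apply: measurable_funB => //.
  exact: measurable_sinM.
- by move=> x; exact: sin_scaled_cvg.
- by move=> n x; exact: sin_scaled_le.
Qed.

End scaling.

Section iid_sums.
Context d (Om : measurableType d) (R : realType) (P : probability Om R).
Variable y : nat -> Om -> R.

Definition partial_sum n w := \sum_(j < n) y j w.
Local Notation S := partial_sum.

Hypothesis my : forall j, measurable_fun setT (y j).
Hypothesis indep : forall n A B, measurable A -> measurable B ->
  P (S n @^-1` A `&` y n @^-1` B) = (P (S n @^-1` A) * P (y n @^-1` B))%E.
Hypothesis same_law : forall j A, measurable A -> P (y j @^-1` A) = P (y 0%N @^-1` A).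
Hypothesis iy2 : P.-integrable setT (EFin \o (fun w => y 0%N w ^+ 2)).
Hypothesis Ey0 : \int[P]_w y 0%N w = 0.

Lemma partial_sumS n w : S n.+1 w = S n w + y n w.
Proof. by rewrite /partial_sum big_ord_recr. Qed.

Lemma measurable_partial_sum n : measurable_fun setT (S n).
Proof. by apply: measurable_sum => j; exact: my. Qed.

Let mS := measurable_partial_sum.

Let indep_comp n (f g : R -> R) : measurable_fun setT f -> measurable_fun setT g ->
  forall A B, measurable A -> measurable B ->
  P ((f \o S n) @^-1` A `&` (g \o y n) @^-1` B) =
  (P ((f \o S n) @^-1` A) * P ((g \o y n) @^-1` B))%E.
Proof.
move=> mf mg A B mA mB.
exact: (indep n (measurable_preimageT mf mA) (measurable_preimageT mg mB)).
Qed.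

Let same_law0 j A : measurable A -> P (y 0%N @^-1` A) = P (y j @^-1` A).
Proof. by move=> mA; rewrite same_law. Qed.

Let integrable_y2 j : P.-integrable setT (EFin \o (fun w => y j w ^+ 2)).
Proof.
apply: (integrable_eq_law (my 0) (my j) (same_law0 j)
  (fun t => (t ^+ 2)%:E) _ iy2).
by apply/measurable_EFinP; exact: measurable_funX.
Qed.

Let Ey j : \int[P]_w y j w = 0.
Proof.
by rewrite -Ey0; apply: (Rintegral_eq_law (my j) (my 0) (same_law j) id).
Qed.

Let Ey2 j : \int[P]_w (y j w ^+ 2) = \int[P]_w (y 0%N w ^+ 2).
Proof.
by apply: (Rintegral_eq_law (my j) (my 0) (same_law j) (fun t => t ^+ 2)).
Qed.

Lemma partial_sum_second_moment n :
  [/\ P.-integrable setT (EFin \o (fun w => S n w ^+ 2)),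
      \int[P]_w S n w = 0 &
      \int[P]_w (S n w ^+ 2) = n%:R * \int[P]_w (y 0%N w ^+ 2)].
Proof.
elim: n => [|n [iS ES ES2]].
  have S0 w : S 0 w = 0 by rewrite /partial_sum big_ord0.
  split.
  - apply: (@integrable_bounded _ _ _ _ _ 0) => [|w]; first exact: measurable_funX.
    by rewrite S0 expr0n normr0.
  - by under eq_Rintegral do rewrite S0; rewrite /Rintegral integral0.
  - under eq_Rintegral do rewrite S0 expr0n/=.
    by rewrite mul0r /Rintegral integral0.
have iS1 := square_integrable_integrable (mS n) iS.
have iy1 := square_integrable_integrable (my n) (integrable_y2 n).
have [iSy _] := expectation_indep_mul (indep n) iS1 iy1.
have ESy := Rintegral_indep_mul (indep n) iS1 iy1.
have iSy2 : P.-integrable setT (EFin \o (fun w => S n w * y n w *+ 2)).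
  have -> : EFin \o (fun w => S n w * y n w *+ 2) =
      (EFin \o (S n \* y n)) \+ (EFin \o (S n \* y n)).
    by apply/funext => w /=; rewrite mulr2n EFinD.
  exact: integrableD.
have iA : P.-integrable setT (EFin \o (fun w => S n w ^+ 2 + S n w * y n w *+ 2)).
  exact: (integrableD measurableT iS iSy2).
have iB : P.-integrable setT (EFin \o (fun w => S n w ^+ 2 + S n w * y n w *+ 2 + y n w ^+ 2)).
  exact: (integrableD measurableT iA (integrable_y2 n)).
have eS w : S n.+1 w ^+ 2 = S n w ^+ 2 + S n w * y n w *+ 2 + y n w ^+ 2.
  by rewrite partial_sumS sqrrD.
split.
- have -> : (fun w => S n.+1 w ^+ 2) =
      (fun w => S n w ^+ 2 + S n w * y n w *+ 2 + y n w ^+ 2).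
    by apply/funext => w; exact: eS.
  exact: iB.
- under eq_Rintegral do rewrite partial_sumS.
  by rewrite RintegralD// ES Ey addr0.
- under eq_Rintegral do rewrite eS.
  rewrite (RintegralD measurableT iA (integrable_y2 n)).
  rewrite RintegralD// ES2 Ey2.
  under [X in _ + X + _]eq_Rintegral do rewrite mulr2n.
  rewrite RintegralD// ESy ES mul0r !addr0.
  by rewrite -natr1 mulrDl mul1r.
Qed.

Let C c := \int[P]_w cos (c * y 0%N w).
Let D c := \int[P]_w sin (c * y 0%N w).
Let EC c k := \int[P]_w cos (c * S k w).
Let ES c k := \int[P]_w sin (c * S k w).

Let mcos c : measurable_fun setT (fun t : R => cos (c * t)).
Proof. exact: (@measurable_cosM _ _ R id). Qed.

Let msin c : measurable_fun setT (fun t : R => sin (c * t)).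
Proof. exact: (@measurable_sinM _ _ R id). Qed.

Let Cj c j : \int[P]_w cos (c * y j w) = C c.
Proof.
by apply: (Rintegral_eq_law (my j) (my 0) (same_law j) (fun t => cos (c * t))).
Qed.

Let Dj c j : \int[P]_w sin (c * y j w) = D c.
Proof.
by apply: (Rintegral_eq_law (my j) (my 0) (same_law j) (fun t => sin (c * t))).
Qed.

Let trig_step (f g : R -> R) k :
  measurable_fun setT f -> measurable_fun setT g ->
  (forall t, `|f t| <= 1) -> (forall t, `|g t| <= 1) ->
  P.-integrable setT (EFin \o (fun w => f (S k w) * g (y k w))) /\
  \int[P]_w (f (S k w) * g (y k w)) =
  (\int[P]_w f (S k w)) * (\int[P]_w g (y k w)).
Proof.
move=> mf mg f1 g1.
have if_ : P.-integrable setT (EFin \o (f \o S k)).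
  by apply: (@integrable_bounded _ _ _ _ _ 1) => [|w]; [exact: measurableT_comp|exact: f1].
have ig_ : P.-integrable setT (EFin \o (g \o y k)).
  by apply: (@integrable_bounded _ _ _ _ _ 1) => [|w]; [exact: measurableT_comp|exact: g1].
have [iM _] := expectation_indep_mul (indep_comp k mf mg) if_ ig_.
by split => //; exact: (Rintegral_indep_mul (indep_comp k mf mg) if_ ig_).
Qed.

Let ECS c k : EC c k.+1 = EC c k * C c - ES c k * D c.
Proof.
have [i1 e1] := trig_step k (mcos c) (mcos c) (fun t => cos_max (c * t)) (fun t => cos_max (c * t)).
have [i2 e2] := trig_step k (msin c) (msin c) (fun t => sin_max (c * t)) (fun t => sin_max (c * t)).
rewrite /EC /ES -(Cj c k) -(Dj c k) -e1 -e2 -RintegralB//.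
by apply: eq_Rintegral => w _; rewrite partial_sumS mulrDr cosD.
Qed.

Let ESS c k : ES c k.+1 = ES c k * C c + EC c k * D c.
Proof.
have [i1 e1] := trig_step k (msin c) (mcos c) (fun t => sin_max (c * t)) (fun t => cos_max (c * t)).
have [i2 e2] := trig_step k (mcos c) (msin c) (fun t => cos_max (c * t)) (fun t => sin_max (c * t)).
rewrite /EC /ES -(Cj c k) -(Dj c k) -e1 -e2 -RintegralD//.
by apply: eq_Rintegral => w _; rewrite partial_sumS mulrDr sinD.
Qed.

Let EC1 c k : `|EC c k| <= 1.
Proof.
by apply: Rintegral_bound => [|w]; [exact: measurable_cosM|exact: cos_max].
Qed.

Let ES1 c k : `|ES c k| <= 1.
Proof.
by apply: Rintegral_bound => [|w]; [exact: measurable_sinM|exact: sin_max].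
Qed.

Let C1 c : `|C c| <= 1.
Proof.
by apply: Rintegral_bound => [|w]; [exact: measurable_cosM|exact: cos_max].
Qed.

Let ES_le c k : `|ES c k| <= k%:R * `|D c|.
Proof.
elim: k => [|k IH].
  rewrite /ES; under eq_Rintegral do rewrite /partial_sum big_ord0 mulr0 sin0.
  by rewrite /Rintegral integral0 normr0 mul0r.
rewrite ESS -natr1 mulrDl mul1r (le_trans (ler_normD _ _))//.
rewrite !normrM lerD// ?ler_piMl//.
by rewrite (le_trans _ IH)// ler_piMr.
Qed.

Let EC_le c g k : `|g| <= 1 ->
  `|EC c k - g ^+ k| <= k%:R * (`|C c - g| + `|D c|).
Proof.
move=> g1; elim: k => [|k IH].
  rewrite /EC; under eq_Rintegral do rewrite /partial_sum big_ord0 mulr0 cos0.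
  by rewrite /Rintegral integral_cst//= probability_setT mule1 subrr normr0 mul0r.
rewrite ECS exprSr.
have -> : EC c k * C c - ES c k * D c - g ^+ k * g =
  (EC c k - g ^+ k) * g + (EC c k * (C c - g) - ES c k * D c) by ring.
rewrite -natr1 [leRHS]mulrDl mul1r (le_trans (ler_normD _ _))// lerD//.
  by rewrite normrM (le_trans _ IH)// ler_piMr.
rewrite (le_trans (ler_normB _ _))// !normrM lerD// ler_piMl//.
Qed.

(* Telescoping [|z^n - g^n| <= n |z - g|] for complex numbers of modulus at
   most 1, with the characteristic function split into its real and imaginary
   parts. *)
Lemma char_function_cvg (g : nat -> R) (G : R) :
  (forall n, `|g n| <= 1) -> (forall n, (0 < n)%N -> g n ^+ n = G) ->
  n%:R * (1 - g n) @[n --> \oo] --> (\int[P]_w (y 0%N w ^+ 2)) / 2 ->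
  \int[P]_w cos ((Num.sqrt n%:R)^-1 * S n w) @[n --> \oo] --> G /\
  \int[P]_w sin ((Num.sqrt n%:R)^-1 * S n w) @[n --> \oo] --> 0.
Proof.
move=> g1 gG cg.
have cC := scaled_expectation_cos (my 0) iy2.
have cD := scaled_expectation_sin (my 0) iy2 Ey0.
have cD0 : n%:R * `|D (Num.sqrt n%:R)^-1| @[n --> \oo] --> 0.
  have /(_ eventually_filter) := cvg_norm cD; rewrite normr0.
  under eq_fun do rewrite normrM ger0_norm//.
  by [].
have cCg : n%:R * `|C (Num.sqrt n%:R)^-1 - g n| @[n --> \oo] --> 0.
  have /(_ eventually_filter) := cvg_norm (cvgB cg cC); rewrite subrr normr0 => h.
  have -> : (fun n => n%:R * `|C (Num.sqrt n%:R)^-1 - g n|) =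
      (fun n => `|n%:R * (1 - g n) - n%:R * (1 - C (Num.sqrt n%:R)^-1)|).
    apply/funext => n; rewrite -mulrBr normrM (@ger0_norm _ n%:R)//.
    by rewrite (_ : 1 - g n - (1 - C (Num.sqrt n%:R)^-1) = C (Num.sqrt n%:R)^-1 - g n)//; ring.
  exact: h.
split.
  apply/subr_cvg0/norm_cvg0P.
  have h : n%:R * (`|C (Num.sqrt n%:R)^-1 - g n| + `|D (Num.sqrt n%:R)^-1|)
      @[n --> \oo] --> (0 : R).
    rewrite -[X in _ --> X](addr0 0); under eq_fun do rewrite mulrDr.
    exact: cvgD.
  apply: (squeeze_cvgr _ (cvg_cst 0) h).
  exists 1%N => // n /= n0; rewrite normr_ge0/= -(gG n n0).
  exact: EC_le.
apply/norm_cvg0P; apply: (squeeze_cvgr _ (cvg_cst 0) cD0).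
by apply: nearW => n; rewrite normr_ge0/=; exact: ES_le.
Qed.

End iid_sums.

(** * Normal laws *)

Section normal_facts.
Variable R : realType.
Implicit Types (m s t x z : R) (A : set R).
Local Notation mu := (@lebesgue_measure R).

Lemma ge0_integral_normal_prob m s (f : R -> \bar R) :
  (forall x, 0 <= f x)%E -> measurable_fun setT f ->
  (\int[normal_prob m s]_x f x = \int[mu]_x (f x * (normal_pdf m s x)%:E))%E.
Proof.
move=> f0 mf.
have dom := normal_prob_dominates m s.
rewrite -(Radon_Nikodym_SigmaFinite.change_of_variables dom)//.
apply: ae_eq_integral => //.
- apply: emeasurable_funM => //; apply: (measurable_int mu).
  exact: Radon_Nikodym_SigmaFinite.f_integrable.
- apply: emeasurable_funM => //; apply/measurable_EFinP.
  exact: measurable_normal_pdf.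
- apply: ae_eqe_mul2l => /=.
  apply: integral_ae_eq => //.
  + exact: Radon_Nikodym_SigmaFinite.f_integrable.
  + by apply/measurable_EFinP; exact: measurable_normal_pdf.
  + by move=> E _ mE; rewrite -Radon_Nikodym_SigmaFinite.f_integral.
Qed.

Lemma measurable_affine m s : measurable_fun setT (fun x => m + s * x).
Proof. by apply: measurable_funD => //; exact: measurable_funM. Qed.

Lemma lebesgue_measure_affine m s A : s != 0 -> measurable A ->
  mu A = (`|s|%:E * mu ((fun x => (m + s * x)%R) @^-1` A))%E.
Proof.
move=> s0 mA.
pose c : {nonneg R} := NngNum (normr_ge0 s).
have maf : measurable_fun [set: measurableTypeR R]
      (fun x : R => m + s * x : measurableTypeR R).
  exact: measurable_affine.
pose nu : {measure set (measurableTypeR R) -> \bar R} :=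
  mscale c (image_measure mu maf).
suff h : forall A, measurable A -> mu A = nu A by exact: h.
apply: lebesgue_measure_unique => _ [[a b]] _ <-.
rewrite /nu /= /mscale/= /pushforward/=.
case: (ltgtP s 0) s0 => // s0 _.
- have -> : (fun x : R => m + s * x : measurableTypeR R) @^-1` `]a, b]%classic =
      `[(b - m) / s, (a - m) / s[%classic.
    apply/seteqP; split=> x /=; rewrite !in_itv/= => /andP[h1 h2]; apply/andP; split.
    + by rewrite ler_ndivrMr//; lra.
    + by rewrite ltr_ndivlMr//; lra.
    + by rewrite ltr_ndivlMr// in h2; lra.
    + by rewrite ler_ndivrMr// in h1; lra.
  rewrite !lebesgue_measure_itv/= !lte_fin ltr_nM2r ?invr_lt0// ltrD2r.
  case: ifPn => _; last by rewrite mule0.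
  rewrite -!EFinB -EFinM ltr0_norm//; congr EFin.
  by field; rewrite lt_eqF.
- have -> : (fun x : R => m + s * x : measurableTypeR R) @^-1` `]a, b]%classic =
      `](a - m) / s, (b - m) / s]%classic.
    apply/seteqP; split=> x /=; rewrite !in_itv/= => /andP[h1 h2]; apply/andP; split.
    + by rewrite ltr_pdivrMr//; lra.
    + by rewrite ler_pdivlMr//; lra.
    + by rewrite ltr_pdivrMr// in h1; lra.
    + by rewrite ler_pdivlMr// in h2; lra.
  rewrite !lebesgue_measure_itv/= !lte_fin ltr_pM2r ?invr_gt0// ltrD2r.
  case: ifPn => _; last by rewrite mule0.
  rewrite -!EFinB -EFinM gtr0_norm//; congr EFin.
  by field; rewrite gt_eqF.
Qed.

Lemma normal_pdf_affine m s x : s != 0 ->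
  `|s| * normal_pdf m s (m + s * x) = normal_pdf 0 1 x.
Proof.
move=> s0; rewrite /normal_pdf (negbTE s0) oner_eq0 /normal_peak /normal_fun.
rewrite expr1n mul1r subr0 -mulrnAr sqrtrM ?sqr_ge0// sqrtr_sqr invfM !mulrA.
rewrite divff ?normr_eq0// mul1r; congr (_ * expR _).
by field.
Qed.

Lemma normal_prob_affine m s A : s != 0 -> measurable A ->
  normal_prob m s A = normal_prob 0 1 ((fun x => (m + s * x)%R) @^-1` A).
Proof.
move=> s0 mA.
have maf : measurable_fun [set: measurableTypeR R]
      (fun x : R => m + s * x : measurableTypeR R).
  exact: measurable_affine.
pose c : {nonneg R} := NngNum (normr_ge0 s).
pose nu : {measure set (measurableTypeR R) -> \bar R} :=
  mscale c (image_measure mu maf).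
have mpdf : measurable_fun A (fun x => (normal_pdf m s x)%:E).
  by apply/measurable_EFinP/measurable_funTS; exact: measurable_normal_pdf.
have pdf0 x : (0 <= (normal_pdf m s x)%:E)%E by rewrite lee_fin normal_pdf_ge0.
rewrite {1}/normal_prob (eq_measure_integral nu); last first.
  by move=> B mB _; exact: (lebesgue_measure_affine m s0 mB).
rewrite /nu (ge0_integral_mscale (image_measure mu maf) mA c mpdf (fun x _ => pdf0 x)).
rewrite -ge0_integralZl//.
transitivity (\int[image_measure mu maf]_(x in A) (`|s|%:E * (normal_pdf m s x)%:E))%E => //.
have -> := @ge0_integral_pushforward _ _ _ _ R _ maf mu A
  (fun x => (`|s|%:E * (normal_pdf m s x)%:E)%E) mA.
- by apply: eq_integral => x _; rewrite /= -EFinM normal_pdf_affine.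
- exact: measurable_funeM.
- by move=> x _; rewrite mule_ge0.
Qed.

Lemma normal_prob_scale s A : s != 0 -> measurable A ->
  normal_prob 0 s A = normal_prob 0 1 ((fun x => s * x) @^-1` A).
Proof.
move=> s0 mA; rewrite [LHS]normal_prob_affine//.
by have -> : (fun x => 0 + s * x) = (fun x => s * x) by apply/funext => x; rewrite add0r.
Qed.

Lemma normal_prob_abs m s A : normal_prob m `|s| A = normal_prob m s A.
Proof.
apply: eq_integral => x _; rewrite /normal_pdf normr_eq0 /normal_peak /normal_fun.
by rewrite real_normK ?num_real.
Qed.

Lemma normal_pdf_mul s t x z : s != 0 -> t != 0 ->
  let r := Num.sqrt (s ^+ 2 + t ^+ 2) in
  normal_pdf 0 s x * normal_pdf x t z =
  normal_pdf 0 r z * normal_pdf (z * s ^+ 2 / r ^+ 2) (s * t / r) x.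
Proof.
move=> s0 t0 r.
have s2 : 0 < s ^+ 2 by rewrite exprn_even_gt0.
have t2 : 0 < t ^+ 2 by rewrite exprn_even_gt0.
have r2 : r ^+ 2 = s ^+ 2 + t ^+ 2 by rewrite sqr_sqrtr// addr_ge0// ltW.
have r0 : r != 0 by rewrite gt_eqF// sqrtr_gt0 addr_gt0.
have st0 : s * t / r != 0 by rewrite !mulf_neq0// invr_eq0.
rewrite !normal_pdfE// /normal_peak /normal_fun.
rewrite mulrACA [RHS]mulrACA -!expRD -!invfM -!sqrtrM; last 2 first.
- by rewrite pmulrn_lge0// mulr_ge0 ?sqr_ge0 ?pi_ge0.
- by rewrite pmulrn_lge0// mulr_ge0 ?sqr_ge0 ?pi_ge0.
congr ((Num.sqrt _)^-1 * expR _).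
  by field.
rewrite !exprMn exprVn r2.
field; rewrite ?s0 ?t0/=.
by rewrite gt_eqF// addr_gt0.
Qed.

End normal_facts.

Section normal_laws.
Variable R : realType.
Implicit Types (m s t c x z : R) (A : set R).
Local Notation mu := (@lebesgue_measure R).
Local Notation N01 := (@normal_prob R 0 1).

Lemma normal_law_scale c A : measurable A ->
  N01 ((fun x => c * x) @^-1` A) = normal_law 0 (c ^+ 2) A.
Proof.
move=> mA; rewrite /normal_law sqrf_eq0; case: ifPn => [/eqP ->|c0].
  rewrite (_ : _ @^-1` A = if 0 \in A then setT else set0); last first.
    apply/seteqP; split=> x /=; rewrite mul0r.
      by move=> A0; rewrite mem_set.
    by case: ifPn => //; rewrite inE.
  by rewrite diracE; case: ifPn => _; [exact: probability_setT|rewrite measure0].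
by rewrite sqrtr_sqr [RHS]normal_prob_abs [RHS]normal_prob_scale.
Qed.

Lemma normal_law_sqrt s A : 0 <= s -> measurable A ->
  N01 ((fun x => Num.sqrt s * x) @^-1` A) = normal_law 0 s A.
Proof. by move=> s0 mA; have := normal_law_scale (Num.sqrt s) mA; rewrite (sqr_sqrtr s0). Qed.

Let conv_pos a c A : a != 0 -> c != 0 -> measurable A ->
  (\int[N01]_u normal_prob (a * u) c A)%E =
  normal_prob 0 (Num.sqrt (a ^+ 2 + c ^+ 2)) A.
Proof.
move=> a0 c0 mA; set r := Num.sqrt _.
pose f x z := (normal_pdf 0 a x * normal_pdf x c z)%:E.
have f0 x z : (0 <= f x z)%E by rewrite lee_fin mulr_ge0 ?normal_pdf_ge0.
have mpdf : measurable_fun setT (fun w : R * R => normal_pdf w.1 c w.2).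
  rewrite /normal_pdf (negbTE c0) /normal_fun.
  apply: measurable_funM => //; apply: measurableT_comp => //.
  apply: measurable_funM => //; apply: measurableT_comp => //.
  by apply: measurable_funX; exact: measurable_funB.
have mf : measurable_fun setT (fun w : R * R => f w.1 w.2).
  apply/measurable_EFinP; apply: measurable_funM => //.
  by apply: measurableT_comp => //; exact: measurable_normal_pdf.
have mf1 x : measurable_fun setT (f x).
  by have := measurableT_comp mf (pair1_measurable x).
have mh : measurable_fun setT (fun x => normal_prob x c A).
  rewrite (_ : (fun x => _) = (fun x => \int[mu]_z ((normal_pdf x c z)%:E * (\1_A z)%:E))%E).
    apply: (measurable_fun_fubini_tonelli_F (m2 := mu)
      (fun w : R * R => ((normal_pdf w.1 c w.2)%:E * (\1_A w.2)%:E)%E)).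
      apply: emeasurable_funM; first exact/measurable_EFinP.
      by apply/measurable_EFinP/measurableT_comp.
    by move=> w; rewrite mule_ge0// lee_fin normal_pdf_ge0.
  apply/funext => x; rewrite /normal_prob integral_mkcond.
  apply: eq_integral => z _; rewrite patchE indicE.
  by case: ifPn => _; rewrite ?mule1 ?mule0.
have law a' : a' != 0 -> (\int[N01]_u normal_prob (a' * u) c A)%E =
    (\int[normal_prob 0 a']_x normal_prob x c A)%E.
  move=> a'0.
  have ma' : measurable_fun [set: measurableTypeR R] (fun x : R => a' * x) by exact: measurable_funM.
  have HH B : measurable B ->
      N01 ((fun x => a' * x) @^-1` B) = normal_prob 0 a' (id @^-1` B).
    by move=> mB; rewrite preimage_id; exact/esym/normal_prob_scale.
  have mid : measurable_fun [set: measurableTypeR R] (id : R -> R) by exact: measurable_id.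
  exact: (integral_eq_law (P := N01) (P' := normal_prob 0 a') ma' mid HH _ mh).
rewrite law// ge0_integral_normal_prob//.
transitivity (\int[mu]_x \int[mu]_z (f x z * (\1_A z)%:E))%E.
  apply: eq_integral => x _; rewrite /normal_prob muleC.
  rewrite -ge0_integralZl//; last 3 first.
  - by apply/measurable_EFinP/measurable_funTS; exact: measurable_normal_pdf.
  - by move=> z _; rewrite lee_fin normal_pdf_ge0.
  - by rewrite lee_fin normal_pdf_ge0.
  rewrite integral_mkcond; apply: eq_integral => z _; rewrite patchE indicE.
  by case: ifPn => _; rewrite ?mule1 ?mule0.
rewrite (fubini_tonelli (m1 := mu) (m2 := mu)
  (fun w : R * R => (f w.1 w.2 * (\1_A w.2)%:E)%E))/=; last 2 first.
- by apply: emeasurable_funM => //; apply/measurable_EFinP/measurableT_comp.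
- by move=> w; rewrite mule_ge0.
rewrite /normal_prob [RHS]integral_mkcond; apply: eq_integral => z _.
rewrite patchE indicE; case: ifPn => _; last first.
  by under eq_integral do rewrite mule0; rewrite integral0.
under eq_integral => x _ do rewrite mule1 /f (normal_pdf_mul x z a0 c0) EFinM.
rewrite ge0_integralZl//; last 3 first.
- by apply/measurable_EFinP; exact: measurable_normal_pdf.
- by move=> x _; rewrite lee_fin normal_pdf_ge0.
- by rewrite lee_fin normal_pdf_ge0.
by rewrite integral_normal_pdf mule1.
Qed.

Lemma normal_law_add d (Om : measurableType d) (P : probability Om R)
    (X : Om -> R) s c : 0 <= s -> measurable_fun setT X ->
  has_law P X (normal_law 0 s) ->
  has_law (P \x N01)%E (fun w => X w.1 + c * w.2) (normal_law 0 (s + c ^+ 2)).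
Proof.
move=> s0 mX lawX A mA.
pose h x := N01 ((fun y => (x + c * y)%R) @^-1` A).
have mh : measurable_fun setT h.
  have mB : measurable ((fun w : R * R => w.1 + c * w.2) @^-1` A).
    apply: measurable_preimageT => //.
    by apply: measurable_funD => //; exact: measurable_funM.
  have := measurable_fun_xsection N01 mB; apply: eq_measurable_fun => x _.
  rewrite /h/= (_ : xsection _ x = (fun y => x + c * y) @^-1` A)//.
  by apply/seteqP; split=> y; rewrite /xsection/= inE.
have ms : measurable_fun setT (fun x : R => Num.sqrt s * x) by exact: measurable_funM.
transitivity (\int[P]_w h (X w))%E.
  apply: eq_integral => w _; rewrite /h/=.
  rewrite (_ : xsection _ w = (fun y => X w + c * y) @^-1` A)//.
  by apply/seteqP; split=> y; rewrite /xsection/= inE.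
rewrite (integral_eq_law (P' := N01) mX ms _ _ mh); last first.
  by move=> B mB; exact: etrans (lawX B mB) (esym (normal_law_sqrt s0 mB)).
have [c0|c0] := eqVneq c 0.
  rewrite c0 expr0n addr0 -(normal_law_sqrt s0 mA).
  transitivity (\int[N01]_x (\1_((fun x => Num.sqrt s * x) @^-1` A) x)%:E)%E; last first.
    by rewrite integral_indic ?setIT//; exact: measurable_preimageT.
  apply: eq_integral => x _; rewrite /h indicE.
  rewrite (_ : _ @^-1` A = if Num.sqrt s * x \in A then setT else set0).
    case: ifPn => xA; first by rewrite mem_set ?probability_setT//=; move: xA; rewrite inE.
    by rewrite memNset ?measure0//= => /mem_set; rewrite (negbTE xA).
  apply/seteqP; split=> y /=; rewrite c0 mul0r addr0.
    by move=> xA; rewrite mem_set.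
  by case: ifPn => //; rewrite inE.
have hE x : h x = normal_prob x c A by rewrite /h -(normal_prob_affine x c0 mA).
under eq_integral do rewrite hE.
have [->|s1] := eqVneq s 0.
  rewrite add0r sqrtr0.
  under eq_integral do rewrite mul0r -normal_prob_abs -sqrtr_sqr.
  rewrite /normal_law sqrf_eq0 (negbTE c0).
  by rewrite integral_cst//= probability_setT mule1.
have a0 : Num.sqrt s != 0 by rewrite sqrtr_eq0 -ltNge lt_neqAle eq_sym s1.
rewrite conv_pos// sqr_sqrtr// /normal_law gt_eqF// ltr_pwDl//.
  by rewrite lt_neqAle eq_sym s1.
exact: sqr_ge0.
Qed.

End normal_laws.

Section normal_characteristic_function.
Variable R : realType.
Implicit Types (s t c x : R).
Local Notation N01 := (@normal_prob R 0 1).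

Let measurable_scale c : measurable_fun [set: measurableTypeR R] (fun x : R => c * x).
Proof. exact: measurable_funM. Qed.

Let measurable_gauss c :
  measurable_fun [set: measurableTypeR R] (fun x : R => expR (- (c * x ^+ 2))).
Proof.
apply: measurableT_comp => //; apply: measurableT_comp => //.
by apply: measurable_funM => //; exact: measurable_funX.
Qed.

Lemma std_normal_expR (q : R) : 0 < q ->
  (\int[N01]_x (expR (- ((q^-1 ^+ 2 - 1) / 2 * x ^+ 2)))%:E)%E = q%:E.
Proof.
move=> q0; have qn0 : q != 0 by rewrite gt_eqF.
rewrite ge0_integral_normal_prob; last 2 first.
- by move=> x; rewrite lee_fin expR_ge0.
- by apply/measurable_EFinP; exact: measurable_gauss.
transitivity (\int[lebesgue_measure]_x (q%:E * (normal_pdf 0 q x)%:E))%E.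
  apply: eq_integral => x _; rewrite -!EFinM; congr EFin.
  rewrite !normal_pdfE ?oner_eq0// /normal_peak /normal_fun expr1n mul1r.
  rewrite -mulrnAr sqrtrM ?sqr_ge0// sqrtr_sqr (gtr0_norm q0) invfM !mulrA.
  rewrite divff// mul1r mulrAC mulrC; congr (_ * _).
  by rewrite -expRD; congr expR; field.
rewrite ge0_integralZl//; last 3 first.
- by apply/measurable_EFinP; exact: measurable_normal_pdf.
- by move=> x _; rewrite lee_fin normal_pdf_ge0.
- by rewrite lee_fin ltW.
by rewrite integral_normal_pdf mule1.
Qed.

Lemma std_normal_square_integrable :
  N01.-integrable setT (EFin \o (fun x : R => x ^+ 2)).
Proof.
pose q : R := Num.sqrt 2.
have q0 : 0 < q by rewrite sqrtr_gt0.
have iE : N01.-integrable setT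
    (EFin \o (fun x : R => 4 * expR (- ((q^-1 ^+ 2 - 1) / 2 * x ^+ 2)))).
  apply/integrableP; split.
    by apply/measurable_EFinP; apply: measurable_funM => //; exact: measurable_gauss.
  under eq_integral => x _ do rewrite /= ger0_norm ?mulr_ge0 ?expR_ge0// EFinM.
  rewrite ge0_integralZl//; last by apply/measurable_EFinP; exact: measurable_gauss.
  by rewrite std_normal_expR// -EFinM ltry.
apply: le_integrable iE => //.
  by apply/measurable_EFinP; exact: measurable_funX.
move=> x _; rewrite lee_fin /= ger0_norm ?sqr_ge0// ger0_norm ?mulr_ge0 ?expR_ge0//.
rewrite exprVn sqr_sqrtr//.
have := expR_ge1Dx (- ((2^-1 - 1) / 2 * x ^+ 2)).
by lra.
Qed.

Let gauss_scaled_bounds (u : R) n : 0 <= u -> (0 < n)%N ->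
  u / (1 + n%:R^-1 * u) <= n%:R * (1 - expR (- (n%:R^-1 * u))) <= u.
Proof.
move=> u0 n0.
have nn0 : n%:R != 0 :> R by rewrite pnatr_eq0 -lt0n.
have npos : 0 < n%:R :> R by rewrite ltr0n.
have ni : 0 <= n%:R^-1 :> R by rewrite invr_ge0.
set v := n%:R^-1 * u; have v0 : 0 <= v by rewrite mulr_ge0.
have uE : u = n%:R * v by rewrite mulrA divff// mul1r.
rewrite {1 2}uE; apply/andP; split; last first.
  by rewrite ler_pM2l//; have := expR_ge1Dx (- v); lra.
rewrite -mulrA ler_pM2l// expRN.
have h : 1 + v <= expR v := expR_ge1Dx v.
have v1 : 0 < 1 + v by lra.
have : (expR v)^-1 <= (1 + v)^-1 by rewrite lef_pV2// posrE ?expR_gt0.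
have : v / (1 + v) = 1 - (1 + v)^-1 by field; rewrite gt_eqF.
by lra.
Qed.

Lemma std_normal_second_moment : \int[N01]_x (x ^+ 2) = 1 :> R.
Proof.
pose f n (x : R) := n%:R * (1 - expR (- (n%:R^-1 * (x ^+ 2 / 2)))).
have mx2 : measurable_fun [set: measurableTypeR R] (fun x : R => x ^+ 2 / 2).
  by apply: measurable_funM => //; exact: measurable_funX.
have ix2 : N01.-integrable setT (EFin \o (fun x : R => x ^+ 2 / 2)).
  have := integrableZr measurableT (2^-1) std_normal_square_integrable.
  by apply: eq_integrable => // x _; rewrite /= EFinM.
have lim1 : \int[N01]_x f n x @[n --> \oo] --> \int[N01]_x (x ^+ 2 / 2).
  apply: (@Rdominated_cvg _ _ _ N01 f (fun x => x ^+ 2 / 2) (fun x => x ^+ 2 / 2)) => //.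
  - move=> n; apply: measurable_funM => //; apply: measurable_funB => //.
    apply: measurableT_comp => //; apply: measurableT_comp => //.
    exact: measurable_funM.
  - move=> x; have u0 : 0 <= x ^+ 2 / 2 by have := sqr_ge0 x; lra.
    have h : x ^+ 2 / 2 / (1 + n%:R^-1 * (x ^+ 2 / 2)) @[n --> \oo] --> x ^+ 2 / 2.
      rewrite -[X in _ --> X]divr1; apply: cvgM; first exact: cvg_cst.
      apply: cvgV; first exact: oner_neq0.
      rewrite -[X in _ --> X]addr0; apply: cvgD; first exact: cvg_cst.
      rewrite -[X in _ --> X](mul0r (x ^+ 2 / 2)); apply: cvgM; last exact: cvg_cst.
      exact: cvg_invn.
    apply: (squeeze_cvgr _ h (cvg_cst (x ^+ 2 / 2))).
    by exists 1%N => // n /= n0; exact: gauss_scaled_bounds.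
  - move=> n x; have u0 : 0 <= x ^+ 2 / 2 by have := sqr_ge0 x; lra.
    have [->|n0] := posnP n; first by rewrite /f mul0r normr0.
    have /andP[h1 h2] := gauss_scaled_bounds u0 n0.
    rewrite ger0_norm//; apply: le_trans h1.
    rewrite divr_ge0// addr_ge0// mulr_ge0// invr_ge0//.
pose q n : R := (Num.sqrt (1 + n%:R^-1))^-1.
have q0 n : 0 < q n by rewrite invr_gt0 sqrtr_gt0 ltr_pwDl// invr_ge0.
have q2 n : (q n)^-1 ^+ 2 = 1 + n%:R^-1.
  by rewrite /q invrK sqr_sqrtr// addr_ge0// invr_ge0.
have fE n : (0 < n)%N -> \int[N01]_x f n x = (q n) ^+ 2 / (1 + q n).
  move=> n0; have nn0 : n%:R != 0 :> R by rewrite pnatr_eq0 -lt0n.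
  have eE : (fun x : R => expR (- (n%:R^-1 * (x ^+ 2 / 2)))) =
      (fun x => expR (- (((q n)^-1 ^+ 2 - 1) / 2 * x ^+ 2))).
    by apply/funext => x; rewrite q2; congr expR; field.
  have me : measurable_fun [set: measurableTypeR R]
      (fun x : R => expR (- (n%:R^-1 * (x ^+ 2 / 2)))).
    by rewrite eE; exact: measurable_gauss.
  have ie : N01.-integrable setT
      (EFin \o (fun x : R => expR (- (n%:R^-1 * (x ^+ 2 / 2))))).
    apply: (@integrable_bounded _ _ _ _ _ 1) => // x.
    rewrite ger0_norm ?expR_ge0// -expR0 ler_expR oppr_le0 mulr_ge0 ?invr_ge0//.
    by rewrite divr_ge0 ?sqr_ge0.
  have i1 : N01.-integrable setT (EFin \o (fun=> 1 : R)).
    by apply: (@integrable_bounded _ _ _ _ _ 1) => // x; rewrite normr1.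
  rewrite /f RintegralZl//; last exact: (integrableB measurableT i1 ie).
  rewrite RintegralB//.
  rewrite {1}/Rintegral integral_cst//= probability_setT mule1/=.
  rewrite [X in _ - X](_ : _ = q n); last first.
    rewrite -[RHS]/(fine (q n)%:E) -(std_normal_expR (q0 n)).
    by congr fine; apply: eq_integral => x _; congr EFin; exact: (congr1 (fun h => h x) eE).
  have qn := q0 n.
  have nE : n%:R * (1 - q n ^+ 2) = q n ^+ 2.
    have h : q n ^+ 2 * (1 + n%:R^-1) = 1.
      by rewrite -q2 exprVn divff// expf_neq0// gt_eqF.
    have : q n ^+ 2 * (1 + n%:R^-1) * n%:R = n%:R by rewrite h mul1r.
    by rewrite mulrDr mulr1 mulrDl -mulrA mulVf// => h2; lra.
  rewrite -[in RHS]nE; field.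
  by rewrite gt_eqF//; lra.
have q1 : q n @[n --> \oo] --> (1 : R).
  rewrite -[X in _ --> X]invr1; apply: cvgV; first exact: oner_neq0.
  rewrite -[X in _ --> X]sqrtr1; apply: continuous_cvg; first exact: sqrt_continuous.
  rewrite -[X in _ --> X]addr0; apply: cvgD; first exact: cvg_cst.
  exact: cvg_invn.
have lim2 : q n ^+ 2 / (1 + q n) @[n --> \oo] --> (1 ^+ 2 / (1 + 1) : R).
  apply: cvgM; first by rewrite expr2; under eq_fun do rewrite expr2; exact: cvgM.
  apply: cvgV => //.
  by apply: cvgD => //; exact: cvg_cst.
have lim3 : \int[N01]_x f n x @[n --> \oo] --> (1 ^+ 2 / (1 + 1) : R).
  apply: cvg_trans lim2; apply: near_eq_cvg; exists 1%N => // n /= n0.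
  by rewrite fE.
have := cvg_unique _ lim1 lim3.
rewrite RintegralZr//; last exact: std_normal_square_integrable.
move=> /(_ (@Rhausdorff R)); rewrite expr1n => h.
by apply: (@mulIf _ (2^-1 : R)); rewrite ?invr_eq0// h !mul1r.
Qed.

Definition normal_char s := \int[N01]_x cos (Num.sqrt s * x).

Lemma normal_char_le1 s : `|normal_char s| <= 1.
Proof.
apply: Rintegral_bound => [|x]; last exact: cos_max.
have mid : measurable_fun [set: measurableTypeR R] (id : R -> R) by exact: measurable_id.
exact: (measurable_cosM mid).
Qed.

Lemma std_normal_sin c : \int[N01]_x sin (c * x) = 0.
Proof.
have mN : measurable_fun [set: measurableTypeR R] (fun x : R => -1 * x).
  exact: measurable_scale.
have mid : measurable_fun [set: measurableTypeR R] (id : R -> R) by exact: measurable_id.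
have law A : measurable A -> N01 ((fun x => -1 * x) @^-1` A) = N01 (id @^-1` A).
  move=> mA; rewrite -normal_prob_scale// ?oppr_eq0 ?oner_eq0//.
  by rewrite -normal_prob_abs normrN normr1.
have ms : measurable_fun [set: R] (fun x : R => sin (c * x)).
  exact: (measurable_sinM (@measurable_id _ R setT)).
have := Rintegral_eq_law (P := N01) (P' := N01) mN mid law _ ms.
under eq_Rintegral do rewrite mulN1r mulrN sinN -mulN1r.
rewrite RintegralZl//; last exact: (integrable_sinM N01 (y := id)).
by rewrite mulN1r => /eqP; rewrite eqNr => /eqP.
Qed.

Lemma has_law_normal_cos d (Om : measurableType d) (P : probability Om R)
    (X : Om -> R) s : 0 <= s -> measurable_fun setT X ->
  has_law P X (normal_law 0 s) -> \int[P]_w cos (X w) = normal_char s.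
Proof.
move=> s0 mX lawX.
apply: (Rintegral_eq_law (P := P) (P' := N01) mX (@measurable_scale (Num.sqrt s))
  _ cos) => [A mA|].
  exact: etrans (lawX A mA) (esym (normal_law_sqrt s0 mA)).
apply: continuous_measurable_fun; exact: continuous_cos.
Qed.

Lemma has_law_normal_sin d (Om : measurableType d) (P : probability Om R)
    (X : Om -> R) s : 0 <= s -> measurable_fun setT X ->
  has_law P X (normal_law 0 s) -> \int[P]_w sin (X w) = 0.
Proof.
move=> s0 mX lawX; rewrite -(std_normal_sin (Num.sqrt s)).
apply: (Rintegral_eq_law (P := P) (P' := N01) mX (@measurable_scale (Num.sqrt s))
  _ sin) => [A mA|].
  exact: etrans (lawX A mA) (esym (normal_law_sqrt s0 mA)).
apply: continuous_measurable_fun; exact: continuous_sin.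
Qed.

Lemma normal_char_add s t : 0 <= s -> 0 <= t ->
  normal_char (s + t) = normal_char s * normal_char t.
Proof.
move=> s0 t0; pose PP : probability (measurableTypeR R * measurableTypeR R)%type R := (N01 \x N01)%E.
have PPE A B : measurable A -> measurable B -> PP (A `*` B) = (N01 A * N01 B)%E.
  by move=> mA mB; exact: product_measure1E.
pose X (w : R * R) := Num.sqrt s * w.1; pose Y (w : R * R) := Num.sqrt t * w.2.
have mX : measurable_fun setT X by exact: measurable_funM.
have mY : measurable_fun setT Y by exact: measurable_funM.
have law : has_law PP (fun w => X w + Y w) (normal_law 0 (s + t)).
  have := @normal_law_add R _ _ N01 (fun x : R => Num.sqrt s * x) s (Num.sqrt t) s0.
  rewrite sqr_sqrtr//; apply; first exact: measurable_scale.
  by move=> A mA; exact: normal_law_sqrt.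
rewrite -(has_law_normal_cos _ _ law)//; last 2 first.
- exact: addr_ge0.
- exact: measurable_funD.
have mar (f g : R -> R) : measurable_fun setT f -> measurable_fun setT g ->
    (forall x, `|f x| <= 1) -> (forall x, `|g x| <= 1) ->
  PP.-integrable setT (EFin \o (fun w => f (X w) * g (Y w))) /\
  \int[PP]_w (f (X w) * g (Y w)) =
    (\int[N01]_x f (Num.sqrt s * x)) * (\int[N01]_x g (Num.sqrt t * x)).
  move=> mf mg f1 g1.
  have margl A : measurable A -> PP (X @^-1` A) = N01 ((fun x => Num.sqrt s * x) @^-1` A).
    move=> mA; rewrite (_ : X @^-1` A = ((fun x => Num.sqrt s * x) @^-1` A) `*` setT).
      rewrite PPE// ?probability_setT ?mule1//.
      by apply: measurable_preimageT => //; exact: measurable_scale.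
    by apply/seteqP; split=> w //= [].
  have margr A : measurable A -> PP (Y @^-1` A) = N01 ((fun x => Num.sqrt t * x) @^-1` A).
    move=> mA; rewrite (_ : Y @^-1` A = setT `*` ((fun x => Num.sqrt t * x) @^-1` A)).
      rewrite PPE// ?probability_setT ?mul1e//.
      by apply: measurable_preimageT => //; exact: measurable_scale.
    by apply/seteqP; split=> w //= [].
  have ind A B : measurable A -> measurable B ->
      PP ((f \o X) @^-1` A `&` (g \o Y) @^-1` B) =
      (PP ((f \o X) @^-1` A) * PP ((g \o Y) @^-1` B))%E.
    move=> mA mB.
    have mfA := measurable_preimageT mf mA; have mgB := measurable_preimageT mg mB.
    have -> : PP ((f \o X) @^-1` A) = N01 ((fun x => Num.sqrt s * x) @^-1` (f @^-1` A)).
      by rewrite -margl.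
    have -> : PP ((g \o Y) @^-1` B) = N01 ((fun x => Num.sqrt t * x) @^-1` (g @^-1` B)).
      by rewrite -margr.
    rewrite -PPE//.
    - exact: (measurable_preimageT (@measurable_scale (Num.sqrt s)) mfA).
    - exact: (measurable_preimageT (@measurable_scale (Num.sqrt t)) mgB).
  have ifX : PP.-integrable setT (EFin \o (f \o X)).
    by apply: (@integrable_bounded _ _ _ _ _ 1) => [|w]; [exact: measurableT_comp|exact: f1].
  have igY : PP.-integrable setT (EFin \o (g \o Y)).
    by apply: (@integrable_bounded _ _ _ _ _ 1) => [|w]; [exact: measurableT_comp|exact: g1].
  have [iM _] := expectation_indep_mul ind ifX igY.
  split; first exact: iM.
  rewrite (Rintegral_indep_mul ind ifX igY); congr (_ * _).
    exact: (Rintegral_eq_law (P := PP) (P' := N01) mX (@measurable_scale (Num.sqrt s)) margl f mf).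
  exact: (Rintegral_eq_law (P := PP) (P' := N01) mY (@measurable_scale (Num.sqrt t)) margr g mg).
have mcos : measurable_fun setT (@cos R).
  by apply: continuous_measurable_fun; exact: continuous_cos.
have msin : measurable_fun setT (@sin R).
  by apply: continuous_measurable_fun; exact: continuous_sin.
have [i1 e1] := mar cos cos mcos mcos (@cos_max R) (@cos_max R).
have [i2 e2] := mar sin sin msin msin (@sin_max R) (@sin_max R).
under eq_Rintegral do rewrite cosD.
by rewrite RintegralB// e1 e2 !std_normal_sin mul0r subr0.
Qed.

Lemma normal_char0 : normal_char 0 = 1.
Proof.
rewrite /normal_char; under eq_Rintegral do rewrite sqrtr0 mul0r cos0.
by rewrite /Rintegral integral_cst//= probability_setT mule1.
Qed.

Lemma normal_charX s n : 0 <= s -> normal_char (n%:R * s) = normal_char s ^+ n.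
Proof.
move=> s0; elim: n => [|n IH]; first by rewrite mul0r normal_char0.
by rewrite -natr1 mulrDl mul1r normal_char_add ?mulr_ge0// IH exprSr.
Qed.

Lemma normal_char_scaled_cvg s : 0 <= s ->
  n%:R * (1 - normal_char (s / n%:R)) @[n --> \oo] --> s / 2.
Proof.
move=> s0.
have my : measurable_fun [set: measurableTypeR R] (fun x : R => Num.sqrt s * x).
  exact: measurable_scale.
have iy2 : N01.-integrable setT (EFin \o (fun x : R => (Num.sqrt s * x) ^+ 2)).
  have := integrableZl measurableT s std_normal_square_integrable.
  by apply: eq_integrable => // x _; rewrite /= exprMn sqr_sqrtr// EFinM.
have := scaled_expectation_cos my iy2.
have -> : \int[N01]_x (Num.sqrt s * x) ^+ 2 = s.
  under eq_Rintegral do rewrite exprMn sqr_sqrtr//.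
  rewrite RintegralZl//; last exact: std_normal_square_integrable.
  by rewrite std_normal_second_moment mulr1.
rewrite (_ : (fun n => n%:R * (1 - normal_char (s / n%:R))) =
  (fun n => n%:R * (1 - \int[N01]_x cos ((Num.sqrt n%:R)^-1 * (Num.sqrt s * x)))))//.
apply/funext => n; congr (_ * (1 - _)); apply: eq_Rintegral => x _.
by rewrite sqrtrM// sqrtrV// mulrCA mulrA.
Qed.

End normal_characteristic_function.

(** * Gaussian vectors *)

Section column_vectors.
Variables (R : realType) (m : nat).
Implicit Types (a b v : 'cV[R]_m) (V : 'M[R]_m).

Lemma dotmxE a b : (a^T *m b) 0 0 = \sum_i a i 0 * b i 0.
Proof. by rewrite mxE; apply: eq_bigr => i _; rewrite mxE. Qed.

Lemma dotmxC a b : (a^T *m b) 0 0 = (b^T *m a) 0 0.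
Proof. by rewrite !dotmxE; apply: eq_bigr => i _; rewrite mulrC. Qed.

Lemma dotmxDr a b c : (a^T *m (b + c)) 0 0 = (a^T *m b) 0 0 + (a^T *m c) 0 0.
Proof. by rewrite mulmxDr mxE. Qed.

Lemma dotmxZr a b k : (a^T *m (k *: b)) 0 0 = k * (a^T *m b) 0 0.
Proof. by rewrite -scalemxAr mxE. Qed.

Lemma quadmx_rank1 a v V :
  (a^T *m (V - v *m v^T) *m a) 0 0 = (a^T *m V *m a) 0 0 - (a^T *m v) 0 0 ^+ 2.
Proof.
rewrite mulmxBr mulmxBl [LHS]mxE [X in _ + X]mxE; congr (_ - _).
by rewrite mulmxA -mulmxA [LHS]mxE big_ord1 (dotmxC v a) expr2.
Qed.

Lemma quadmxD a b t V : V^T = V ->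
  ((a + t *: b)^T *m V *m (a + t *: b)) 0 0 =
  (a^T *m V *m a) 0 0 + 2 * t * (a^T *m V *m b) 0 0 + t ^+ 2 * (b^T *m V *m b) 0 0.
Proof.
move=> Vs; rewrite -!mulmxA mulmxDr -scalemxAr.
rewrite [LHS]dotmxDr dotmxZr (dotmxC (a + _)) (dotmxC (a + _)).
rewrite !dotmxDr !dotmxZr (dotmxC (V *m a)) (dotmxC (V *m b) b).
have -> : ((V *m b)^T *m a) 0 0 = (a^T *m (V *m b)) 0 0 by rewrite dotmxC.
have -> : ((V *m a)^T *m b) 0 0 = (a^T *m (V *m b)) 0 0.
  by rewrite trmx_mul Vs -mulmxA.
by ring.
Qed.

Lemma quadmx_delta i j V :
  ((delta_mx i 0 : 'cV[R]_m)^T *m V *m (delta_mx j 0 : 'cV[R]_m)) 0 0 = V i j.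
Proof. by rewrite trmx_delta -rowE -colE !mxE. Qed.

Lemma measurable_dotmx d (Om : measurableType d) (G : Om -> 'cV[R]_m) a :
  vmeasurable G -> measurable_fun setT (fun w => (a^T *m G w) 0 0).
Proof.
move=> mG; under eq_fun do rewrite dotmxE.
by apply: measurable_sum => i; apply: measurable_funM => //; exact: mG.
Qed.

Definition psd V := V^T = V /\ forall a, 0 <= (a^T *m V *m a) 0 0.

Lemma psd_diag_ge0 V i : psd V -> 0 <= V i i.
Proof.
by move=> [_ /(_ (delta_mx i 0))]; rewrite quadmx_delta.
Qed.

Lemma psd_diag0 V : psd V -> (forall i, V i i = 0) -> V = 0.
Proof.
move=> [Vs Vp] V0; apply/matrixP => i j; rewrite mxE.
have Vji : V j i = V i j by rewrite -[in LHS]Vs mxE.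
have Q (t : R) : 0 <= 2 * t * V i j.
  have := Vp (delta_mx i 0 + t *: delta_mx j 0).
  by rewrite quadmxD// !quadmx_delta !V0 mulr0 addr0 add0r.
have h1 := Q 1; have h2 := Q (- 1).
by apply/eqP; rewrite eq_le; apply/andP; split; lra.
Qed.

Lemma psd_deflate V i : psd V -> V i i != 0 ->
  let v := (Num.sqrt (V i i))^-1 *: col i V in
  [/\ psd (V - v *m v^T), (V - v *m v^T) i i = 0 &
      forall j, V j j = 0 -> (V - v *m v^T) j j = 0].
Proof.
move=> pV Vi v; have [Vs Vp] := pV.
have Vi0 : 0 < V i i by rewrite lt_neqAle eq_sym Vi psd_diag_ge0.
have cc : (Num.sqrt (V i i))^-1 ^+ 2 = (V i i)^-1.
  by rewrite exprVn sqr_sqrtr// ltW.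
have dE j : (V - v *m v^T) j j = V j j - (V j i) ^+ 2 / V i i.
  by rewrite !mxE big_ord1 !mxE -expr2 exprMn cc mulrC.
have pV' : psd (V - v *m v^T).
  split; first by rewrite linearB /= trmx_mul trmxK Vs.
  move=> a; rewrite quadmx_rank1.
  have av : (a^T *m v) 0 0 ^+ 2 = (a^T *m V *m (delta_mx i 0 : 'cV[R]_m)) 0 0 ^+ 2 / V i i.
    by rewrite /v dotmxZr exprMn cc mulrC -mulmxA -colE.
  rewrite av; set s := (_ *m delta_mx i 0) _ _.
  have := Vp (a + (- (s / V i i)) *: delta_mx i 0).
  rewrite quadmxD// quadmx_delta -/s.
  move=> h; apply: le_trans h _; rewrite le_eqVlt; apply/orP; left; apply/eqP.
  by field.
split => //.
  by rewrite dE; field.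
move=> j Vj; apply/eqP; rewrite eq_le psd_diag_ge0// andbT dE Vj sub0r oppr_le0.
by rewrite divr_ge0 ?sqr_ge0// ltW.
Qed.

End column_vectors.

Section gaussian_vectors.
Variables (R : realType) (m : nat).

(* Each step splits off one column of a Cholesky factor of [V] and adds an
   independent real normal variable in its direction. *)
Lemma gaussian_vector_exists (V : 'M[R]_m) : psd V ->
  exists d (Om : measurableType d) (P : probability Om R) (G : Om -> 'cV[R]_m),
    gaussian_vector P G 0 V.
Proof.
have [k] := ubnP #|[pred i | V i i != 0]|.
elim: k V => // k IH V; rewrite ltnS => Vk pV.
have [i Vi|V0] := pickP [pred i | V i i != 0]; last first.
  have -> : V = 0.
    by apply: (psd_diag0 pV) => i; have := V0 i; rewrite /= => /negbFE/eqP.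
  exists _, (measurableTypeR R), (@normal_prob R 0 1), (fun=> 0); split.
    by move=> i; exact: measurable_cst.
  move=> a A mA; rewrite mulmx0 mulmx0 mul0mx !mxE /normal_law eqxx.
  rewrite (_ : _ @^-1` A = if 0 \in A then setT else set0).
    by rewrite diracE; case: ifPn => _; [exact: probability_setT|rewrite measure0].
  apply/seteqP; split=> x /=.
    by move=> A0; rewrite mem_set.
  by case: ifPn => //; rewrite inE.
have [pV' V'i V'0] := psd_deflate pV Vi.
set v := _ *: col i V in pV' V'i V'0.
have [|d [Om [P [G [mG lawG]]]]] := IH (V - v *m v^T) _ pV'.
  apply: leq_trans Vk; apply: proper_card; apply/fintype.properP; split.
    by apply/fintype.subsetP => j; rewrite !inE; apply: contra => /eqP/V'0/eqP.
  by exists i; rewrite !inE// V'i eqxx.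
pose G' (w : Om * measurableTypeR R) : 'cV[R]_m := G w.1 + (w.2 : R) *: v.
exists _, (Om * measurableTypeR R)%type, (P \x @normal_prob R 0 1)%E, G'; split.
  move=> j; rewrite /G'; under eq_fun do rewrite !mxE.
  apply: measurable_funD; last exact: measurable_funM.
  exact: (measurableT_comp (mG j)).
move=> a A mA.
have -> : (fun w => (a^T *m G' w) 0 0) =
    (fun w => (fun u => (a^T *m G u) 0 0) w.1 + (a^T *m v) 0 0 * w.2).
  by apply/funext => w; rewrite /G' dotmxDr dotmxZr mulrC.
have z0 : (0 : 'M[R]_(1, 1)) 0 0 = 0 by rewrite mxE.
have lawX : has_law P (fun u => (a^T *m G u) 0 0)
    (normal_law 0 ((a^T *m (V - v *m v^T) *m a) 0 0)).
  by have := lawG a; rewrite mulmx0 z0.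
have [V's V'p] := pV'.
have -> : (a^T *m V *m a) 0 0 =
    (a^T *m (V - v *m v^T) *m a) 0 0 + (a^T *m v) 0 0 ^+ 2.
  by rewrite quadmx_rank1 subrK.
rewrite mulmx0 z0.
exact: (@normal_law_add R _ _ P _ _ ((a^T *m v) 0 0) (V'p a)
  (measurable_dotmx a mG) lawX A mA).
Qed.

End gaussian_vectors.

(** * Trigonometric approximation *)

Section uniform_continuity.
Variables (R : realType) (m : nat) (f : 'cV[R]_m -> R).
Hypothesis cf : continuous f.

Lemma continuous_cV_entries (x : 'cV[R]_m) (e : R) : 0 < e ->
  exists2 r : R, 0 < r &
    forall y : 'cV[R]_m, (forall i, `|x i 0 - y i 0| < r) -> `|f x - f y| < e.
Proof.
move=> e0; have /cvgrPdist_lt/(_ _ e0)/nbhs_ballP[r /= r0 h] := cf (x := x).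
exists r => // y xy; apply: h; split=> // i j; rewrite (ord1 j); exact: xy.
Qed.

Lemma uniformly_continuous_on_box (L e : R) : 0 < e ->
  exists2 r : R, 0 < r &
    forall x y : 'cV[R]_m, (forall i, `|x i 0| <= L) -> (forall i, `|x i 0 - y i 0| < r) ->
      `|f x - f y| < e.
Proof.
move=> e0.
have e20 : 0 < e / 2 by rewrite divr_gt0.
have := @rV_compact R m (fun=> `[- L, L]%classic) (fun=> @segment_compact R _ _).
move=> /compact_near_coveringP/(_ R (0 : R)^'+
  (fun r v => forall y : 'cV[R]_m, (forall i, `|v 0 i - y i 0| < r) -> `|f v^T - f y| < e)).
case.
  move=> v _; have [r r0 h] := continuous_cV_entries v^T e20.
  exists (ball v (r / 2), [set t | t < r / 2]).
    split => /=; first by apply/nbhs_ballP; exists (r / 2) => //=; rewrite divr_gt0.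
    by near=> t; near: t; apply: nbhs_right_lt; rewrite divr_gt0.
  move=> [u t] /= [uv tr] y uy.
  have hu : `|f v^T - f u^T| < e / 2.
    apply: h => i; rewrite !mxE; have := uv.2 0 i; rewrite /ball/= => h1.
    by apply: lt_trans h1 _; lra.
  have hy : `|f v^T - f y| < e / 2.
    apply: h => i; rewrite mxE; have h1 := uv.2 0 i; rewrite /ball/= in h1.
    rewrite -(subrKA (u 0 i)) (le_lt_trans (ler_normD _ _))//.
    by have := uy i; lra.
  rewrite -(subrKA (f v^T)) (le_lt_trans (ler_normD _ _))// distrC.
  by lra.
move=> r /= r0 /(_ (r / 2)).
rewrite /ball/= sub0r normrN gtr0_norm ?divr_gt0// => h.
exists (r / 2); first by rewrite divr_gt0.
move=> x y xL xy.
have r2 : r / 2 < r by lra.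
have r20 : 0 < r / 2 by rewrite divr_gt0.
have := h r2 isT x^T; rewrite trmxK; apply.
  by move=> i; rewrite mxE /= in_itv/= -ler_norml.
by move=> i; rewrite mxE; exact: xy.
Unshelve. all: end_near. Qed.

End uniform_continuity.

Section trigonometric_polynomials.
Variables (R : realType) (m : nat).
Implicit Types (f g : 'cV[R]_m -> R).

Inductive trigpoly : ('cV[R]_m -> R) -> Prop :=
| trigpoly_cos (a : 'cV[R]_m) (b : R) : trigpoly (fun x => cos ((a^T *m x) 0 0 + b))
| trigpolyD (f g : 'cV[R]_m -> R) : trigpoly f -> trigpoly g -> trigpoly (fun x => f x + g x)
| trigpolyZ (c : R) (f : 'cV[R]_m -> R) : trigpoly f -> trigpoly (fun x => c * f x).

Lemma eq_trigpoly f g : f =1 g -> trigpoly f -> trigpoly g.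
Proof. by move=> /funext ->. Qed.

Lemma trigpoly_cst c : trigpoly (fun=> c).
Proof.
apply: eq_trigpoly (trigpolyZ c (trigpoly_cos 0 0)) => x.
by rewrite trmx0 mul0mx mxE addr0 cos0 mulr1.
Qed.

Lemma trigpoly_sum (I : Type) (r : seq I) (F : I -> 'cV[R]_m -> R) :
  (forall i, trigpoly (F i)) -> trigpoly (fun x => \sum_(i <- r) F i x).
Proof.
move=> tF; elim: r => [|i r IH].
  by apply: eq_trigpoly (trigpoly_cst 0) => x; rewrite big_nil.
by apply: eq_trigpoly (trigpolyD (tF i) IH) => x; rewrite big_cons.
Qed.

Lemma trigpolyM f g : trigpoly f -> trigpoly g -> trigpoly (fun x => f x * g x).
Proof.
move=> tf; elim: tf g => [a b g|f1 f2 _ IH1 _ IH2 g tg|c f1 _ IH g tg].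
- elim=> [a' b'|g1 g2 _ IH1 _ IH2|c g1 _ IH].
  + have t1 := trigpoly_cos (a + a') (b + b').
    have t2 := trigpoly_cos (a - a') (b - b').
    apply: eq_trigpoly (trigpolyZ (2^-1) (trigpolyD t1 t2)) => x.
    set u := (a^T *m x) 0 0; set v := (a'^T *m x) 0 0.
    have -> : ((a + a')^T *m x) 0 0 + (b + b') = (u + b) + (v + b').
      by rewrite linearD mulmxDl mxE -/u -/v; ring.
    have -> : ((a - a')^T *m x) 0 0 + (b - b') = (u + b) + - (v + b').
      by rewrite -scaleN1r dotmxC dotmxDr dotmxZr !(dotmxC x) -/u -/v; ring.
    by move: (u + b) (v + b') => p q; rewrite !cosD cosN sinN; field.
  + by apply: eq_trigpoly (trigpolyD IH1 IH2) => x; rewrite mulrDr.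
  + by apply: eq_trigpoly (trigpolyZ c IH) => x; rewrite mulrCA.
- by apply: eq_trigpoly (trigpolyD (IH1 _ tg) (IH2 _ tg)) => x; rewrite mulrDl.
- by apply: eq_trigpoly (trigpolyZ c (IH _ tg)) => x; rewrite mulrA.
Qed.

Lemma trigpoly_prod (I : Type) (r : seq I) (F : I -> 'cV[R]_m -> R) :
  (forall i, trigpoly (F i)) -> trigpoly (fun x => \prod_(i <- r) F i x).
Proof.
move=> tF; elim: r => [|i r IH].
  by apply: eq_trigpoly (trigpoly_cst 1) => x; rewrite big_nil.
by apply: eq_trigpoly (trigpolyM (tF i) IH) => x; rewrite big_cons.
Qed.

Lemma trigpoly_sin_coord (c : R) (i : 'I_m) : trigpoly (fun x => sin (c * x i 0)).
Proof.
apply: eq_trigpoly (trigpoly_cos (c *: delta_mx i 0) (- (pi / 2))) => x.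
by rewrite linearZ /= -scalemxAl mxE trmx_delta -rowE mxE cosBpihalf.
Qed.

Lemma trigpoly_bounded f : trigpoly f -> exists M, forall x, `|f x| <= M.
Proof.
elim=> [a b|f1 f2 _ [M1 h1] _ [M2 h2]|c f1 _ [M h]].
- by exists 1 => x; exact: cos_max.
- exists (M1 + M2) => x; rewrite (le_trans (ler_normD _ _))//.
  exact: lerD.
- by exists (`|c| * M) => x; rewrite normrM ler_wpM2l.
Qed.

Lemma trigpoly_lipschitz f : trigpoly f -> exists2 K, 0 <= K &
  forall x y, `|f x - f y| <= K * \sum_i `|x i 0 - y i 0|.
Proof.
elim=> [a b|f1 f2 _ [K1 k1 h1] _ [K2 k2 h2]|c f1 _ [K k h]].
- exists (\sum_i `|a i 0|); first exact: sumr_ge0.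
  move=> x y; apply: le_trans (lipschitz_cos _ _) _.
  rewrite [X in `|X|](_ : _ = \sum_i a i 0 * (x i 0 - y i 0)).
    rewrite (le_trans (ler_norm_sum _ _ _))// mulr_suml ler_sum// => i _.
    rewrite normrM ler_wpM2l// (bigD1 i)//= lerDl.
    exact: sumr_ge0.
  rewrite !dotmxE opprD addrACA subrr addr0 -sumrB.
  by apply: eq_bigr => i _; rewrite mulrBr.
- exists (K1 + K2); first exact: addr_ge0.
  move=> x y; rewrite opprD addrACA (le_trans (ler_normD _ _))// mulrDl.
  exact: lerD.
- exists (`|c| * K); first exact: mulr_ge0.
  by move=> x y; rewrite -mulrBr normrM -mulrA ler_wpM2l.
Qed.

Lemma measurable_trigpoly d (Om : measurableType d) f (G : Om -> 'cV[R]_m) :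
  trigpoly f -> vmeasurable G -> measurable_fun setT (f \o G).
Proof.
move=> tf mG; elim: tf => [a b|f1 f2 _ h1 _ h2|c f1 _ h].
- have mc : measurable_fun setT (@cos R).
    by apply: continuous_measurable_fun; exact: continuous_cos.
  apply: (measurableT_comp mc); apply: measurable_funD => //.
  exact: measurable_dotmx.
- exact: measurable_funD.
- exact: measurable_funM.
Qed.

End trigonometric_polynomials.

Section bernstein.
Variable R : realType.
Implicit Types (y : R) (n k : nat).

(* Binomial weights: [bern n y k] is the probability of [k] successes in [n]
   trials of success probability [y]. *)
Fixpoint bern n y k : R :=
  if n is n'.+1 then
    (if k is k'.+1 then y * bern n' y k' else 0) + (1 - y) * bern n' y k
  else (k == 0%N)%:R.

Definition bern_mean n y (g : nat -> R) := \sum_(k < n.+1) bern n y k * g k.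

Lemma bern_gt n y k : (n < k)%N -> bern n y k = 0.
Proof.
elim: n k => [|n IH] [|k]//= nk.
by rewrite !IH ?mulr0 ?addr0// ltnW.
Qed.

Lemma bern_ge0 n y k : 0 <= y <= 1 -> 0 <= bern n y k.
Proof.
move=> /andP[y0 y1]; elim: n k => [|n IH] k //=.
have h : 0 <= (1 - y) * bern n y k by rewrite mulr_ge0// subr_ge0.
by case: k h => [|k] h; rewrite ?add0r// addr_ge0// mulr_ge0.
Qed.

Lemma bern_meanS n y g :
  bern_mean n.+1 y g = y * bern_mean n y (g \o S) + (1 - y) * bern_mean n y g.
Proof.
rewrite /bern_mean !mulr_sumr.
under eq_bigr do rewrite [bern n.+1 _ _]/= mulrDl.
rewrite big_split/=; congr (_ + _).
  rewrite big_ord_recl/= mul0r add0r; apply: eq_bigr => k _.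
  by rewrite mulrA.
rewrite big_ord_recr/= bern_gt// mulr0 mul0r addr0.
by apply: eq_bigr => k _; rewrite mulrA.
Qed.

Lemma bern_meanE n y g g' : g =1 g' -> bern_mean n y g = bern_mean n y g'.
Proof. by move=> gg; apply: eq_bigr => k _; rewrite gg. Qed.

Lemma bern_meanD n y g g' :
  bern_mean n y (fun k => g k + g' k) = bern_mean n y g + bern_mean n y g'.
Proof. by rewrite -big_split; apply: eq_bigr => k _; rewrite mulrDr. Qed.

Lemma bern_meanZ n y c g : bern_mean n y (fun k => c * g k) = c * bern_mean n y g.
Proof. by rewrite mulr_sumr; apply: eq_bigr => k _; rewrite mulrCA. Qed.

Lemma bern_mean_cst n y c : bern_mean n y (fun=> c) = c.
Proof.
elim: n => [|n IH]; first by rewrite /bern_mean big_ord1 /= mul1r.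
by rewrite bern_meanS IH; ring.
Qed.

Lemma bern_variance n y :
  bern_mean n y (fun k => (k%:R - n%:R * y) ^+ 2) = n%:R * (y * (1 - y)).
Proof.
elim: n => [|n IH].
  by rewrite /bern_mean big_ord1 /= !mul0r subr0 expr0n mulr0.
rewrite bern_meanS.
pose z k := k%:R - n%:R * y.
rewrite (@bern_meanE _ _ _ (fun k => z k ^+ 2 + (2 * (1 - y) * z k + (1 - y) ^+ 2))); last first.
  by move=> k /=; rewrite /z -!natr1; ring.
rewrite (@bern_meanE _ _ (fun k => (k%:R - n.+1%:R * y) ^+ 2)
  (fun k => z k ^+ 2 + (- 2 * y * z k + y ^+ 2))); last first.
  by move=> k /=; rewrite /z -!natr1; ring.
rewrite !bern_meanD !bern_meanZ !bern_mean_cst IH -natr1.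
by ring.
Qed.

End bernstein.

Section trigonometric_approximation.
Variables (R : realType) (m : nat).

Lemma cos_norm (x : R) : cos `|x| = cos x.
Proof. by have [x0|x0] := leP 0 x; rewrite ?(ger0_norm x0) ?(ltr0_norm x0) ?cosN. Qed.

(* [sin u - sin v] dominates [1 - cos (u - v)] because
   [sin u - sin v = 2 sin d cos s] with [d = (u - v) / 2], [s = (u + v) / 2] and
   [cos s >= cos (pi / 2 - d) = sin d]. *)
Lemma sin_sub_ge (u v : R) : - (pi / 2) <= v -> v <= u -> u <= pi / 2 ->
  1 - cos (u - v) <= sin u - sin v.
Proof.
move=> v1 vu u1; pose d := (u - v) / 2; pose s := (u + v) / 2.
have -> : u - v = d *+ 2 by rewrite /d -mulr_natr; field.
have -> : sin u = sin (s + d) by congr sin; rewrite /s /d; field.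
have -> : sin v = sin (s - d) by congr sin; rewrite /s /d; field.
rewrite cos_mulr2n cos2sin2 sinB sinD.
have d0 : 0 <= d by rewrite divr_ge0// subr_ge0.
have dpi : d <= pi / 2 by rewrite /d; lra.
have sd : 0 <= sin d by apply: sin_ge0_pi; rewrite d0/=; have := @pi_ge0 R; lra.
have cs : sin d <= cos s.
  rewrite -cosBpihalf -(cosN (d - _)) opprB.
  rewrite -(cos_norm s).
  have s1 : `|s| <= pi / 2 - d by rewrite ler_norml /s /d; apply/andP; split; lra.
  have hs : `|s| \in `[0, pi] by rewrite in_itv/= normr_ge0/=; lra.
  have hd : pi / 2 - d \in `[0, pi] by rewrite in_itv/=; apply/andP; split; lra.
  by rewrite leNgt (ltr_cos hd hs) -leNgt.
rewrite mulr2n expr2; set a := sin d in sd cs *; set b := cos s in cs *.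
by have := ler_wpM2l sd cs; lra.
Qed.

Lemma trigpoly_bern n k (c : R) (i : 'I_m) :
  trigpoly (fun x : 'cV[R]_m => bern n ((1 + sin (c * x i 0)) / 2) k).
Proof.
have tu : trigpoly (fun x : 'cV[R]_m => (1 + sin (c * x i 0)) / 2).
  apply: eq_trigpoly (trigpolyZ (2^-1)
    (trigpolyD (trigpoly_cst m 1) (trigpoly_sin_coord c i))) => x.
  by rewrite mulrC.
have tv : trigpoly (fun x : 'cV[R]_m => 1 - (1 + sin (c * x i 0)) / 2).
  apply: eq_trigpoly (trigpolyD (trigpoly_cst m 1) (trigpolyZ (-1) tu)) => x.
  by rewrite mulN1r.
elim: n k => [|n IH] k /=; first exact: trigpoly_cst.
case: k => [|k].
  by apply: eq_trigpoly (trigpolyM tv (IH 0%N)) => x; rewrite add0r.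
exact: trigpolyD (trigpolyM tu (IH k)) (trigpolyM tv (IH k.+1)).
Qed.

Let W n (u : 'I_m -> R) (al : {ffun 'I_m -> 'I_n.+1}) := \prod_i bern n (u i) (al i).

Let sum_W n u : \sum_al W (n := n) u al = 1.
Proof.
rewrite -(bigA_distr_bigA (fun i (k : 'I_n.+1) => bern n (u i) k)) big1// => i _.
by rewrite -[RHS](bern_mean_cst n (u i)); apply: eq_bigr => k _; rewrite mulr1.
Qed.

Let W_ge0 n u al : (forall i, 0 <= u i <= 1) -> 0 <= W (n := n) u al.
Proof. by move=> u01; apply: prodr_ge0 => i _; exact: bern_ge0. Qed.

Let W_variance n u i : (0 < n)%N -> 0 <= u i <= 1 ->
  \sum_al W (n := n) u al * (u i - (al i)%:R / n%:R) ^+ 2 <= n%:R^-1.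
Proof.
move=> n0 /andP[u0 u1]; have nn0 : n%:R != 0 :> R by rewrite pnatr_eq0 -lt0n.
pose F j (k : 'I_n.+1) : R := bern n (u j) k *
  (if j == i then (u i - k%:R / n%:R) ^+ 2 else 1).
have -> : \sum_al W (n := n) u al * (u i - (al i)%:R / n%:R) ^+ 2 =
    \sum_(al : {ffun 'I_m -> 'I_n.+1}) \prod_j F j (al j).
  apply: eq_bigr => al _; rewrite big_split/=; congr (_ * _).
  by rewrite -big_mkcond big_pred1_eq.
rewrite -(bigA_distr_bigA F) (bigD1 i)//= [X in _ * X]big1 ?mulr1; last first.
  move=> j ji; rewrite -[RHS](bern_mean_cst n (u j)); apply: eq_bigr => k _.
  by rewrite /F (negbTE ji).
have -> : \sum_j F i j = (n%:R^-1) ^+ 2 * bern_mean n (u i) (fun k => (k%:R - n%:R * u i) ^+ 2).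
  rewrite -bern_meanZ; apply: eq_bigr => k _; rewrite /F eqxx; congr (_ * _).
  by field.
rewrite bern_variance.
have -> : n%:R^-1 ^+ 2 * (n%:R * (u i * (1 - u i))) = n%:R^-1 * (u i * (1 - u i)) :> R.
  by field.
by rewrite ler_piMr ?invr_ge0//; nra.
Qed.

Lemma trigpoly_approx (f : 'cV[R]_m -> R) (M L e : R) :
  continuous f -> (forall x, `|f x| <= M) -> 0 < L -> 0 < e ->
  exists h, [/\ trigpoly h, forall x, `|h x| <= M &
    forall x : 'cV[R]_m, (forall i, `|x i 0| <= L) -> `|f x - h x| <= e].
Proof.
move=> cf fM L0 e0.
have M0 : 0 <= M by apply: le_trans (fM 0); exact: normr_ge0.
have e20 : 0 < e / 2 by rewrite divr_gt0.
have [r r0 fr] := uniformly_continuous_on_box cf L e20.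
have pi0 := @pi_gt0 R.
pose c := pi / (2 * L); have c0 : 0 < c by rewrite divr_gt0// mulr_gt0.
have cL : c * L = pi / 2 by rewrite /c; field; rewrite gt_eqF.
pose r' := Num.min r L.
have r'0 : 0 < r' by rewrite lt_min r0 L0.
have r'r : r' <= r by rewrite ge_min lexx.
have r'L : r' <= L by rewrite ge_min lexx orbT.
have cr' : 0 < c * r' <= pi / 2 by rewrite mulr_gt0//= -cL ler_pM2l.
pose de := (1 - cos (c * r')) / 2.
have de0 : 0 < de.
  rewrite divr_gt0// subr_gt0 -cos0 ltr_cos//; first by case/andP: cr'.
    by rewrite in_itv/=; apply/andP; split; lra.
  by rewrite in_itv/=; apply/andP; split; lra.
pose C := 2 * M / de ^+ 2.
have C0 : 0 <= C by rewrite divr_ge0 ?mulr_ge0// sqr_ge0.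
pose n := (Num.truncn (2 * C * m%:R / e)).+1.
have n0 : (0 < n)%N by [].
have nn0 : 0 < n%:R :> R by rewrite ltr0n.
have hn : C * (m%:R / n%:R) <= e / 2.
  have h : 2 * C * m%:R / e < n%:R by exact: truncnS_gt.
  rewrite ltr_pdivrMr// in h.
  rewrite mulrA ler_pdivrMr//; lra.
pose g (k : nat) : R := asin (2 * (k%:R / n%:R) - 1).
have g01 (k : 'I_n.+1) : -1 <= 2 * (k%:R / n%:R : R) - 1 <= 1.
  have h1 : 0 <= k%:R / n%:R :> R by rewrite divr_ge0.
  have h2 : k%:R / n%:R <= 1 :> R by rewrite ler_pdivrMr// mul1r ler_nat -ltnS.
  by apply/andP; split; lra.
pose X (al : {ffun 'I_m -> 'I_n.+1}) : 'cV[R]_m := \col_i (g (al i) / c).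
pose u (x : 'cV[R]_m) i := (1 + sin (c * x i 0)) / 2.
have u01 x i : 0 <= u x i <= 1.
  have := sin_geN1 (c * x i 0); have := sin_le1 (c * x i 0).
  by rewrite /u => h1 h2; apply/andP; split; lra.
pose h x := \sum_al f (X al) * W (u x) al.
exists h; split.
- apply: trigpoly_sum => al; apply: trigpolyM; first exact: trigpoly_cst.
  by apply: trigpoly_prod => i; exact: trigpoly_bern.
- move=> x; rewrite /h (le_trans (ler_norm_sum _ _ _))//.
  rewrite -[leRHS]mulr1 -(sum_W n (u x)) mulr_sumr ler_sum// => al _.
  rewrite normrM (ger0_norm (W_ge0 al (u01 x))) ler_wpM2r//.
  exact: W_ge0.
move=> x xL.
have key al : `|f x - f (X al)| <= e / 2 + C * \sum_i (u x i - (al i)%:R / n%:R) ^+ 2.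
  have sum0 : 0 <= \sum_i (u x i - (al i)%:R / n%:R) ^+ 2.
    by apply: sumr_ge0 => i _; exact: sqr_ge0.
  have [hall|] := boolP [forall i, `|u x i - (al i)%:R / n%:R| < de]; last first.
    rewrite negb_forall => /existsP[i]; rewrite -leNgt => hi.
    apply: le_trans (_ : 2 * M <= _).
      rewrite (le_trans (ler_normB _ _))//.
      by have := fM x; have := fM (X al); lra.
    apply: le_trans (_ : C * (u x i - (al i)%:R / n%:R) ^+ 2 <= _).
      rewrite /C mulrAC ler_pdivlMr ?exprn_gt0// ler_wpM2l ?mulr_ge0//.
      rewrite -[leRHS]real_normK ?num_real//.
      by rewrite lerXn2r ?nnegrE// ltW.
    apply: le_trans (_ : C * \sum_i (u x i - (al i)%:R / n%:R) ^+ 2 <= _).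
      rewrite ler_wpM2l// (bigD1 i)//= lerDl.
      by apply: sumr_ge0 => j _; exact: sqr_ge0.
    by rewrite lerDr ltW.
  apply: le_trans (_ : e / 2 <= _); last by rewrite lerDl mulr_ge0.
  apply/ltW/fr => // i; rewrite mxE.
  have /forallP/(_ i) hi := hall.
  apply: lt_le_trans r'r.
  have gE : sin (g (al i)) = 2 * ((al i)%:R / n%:R) - 1.
    by rewrite /g asinK// in_itv/=.
  have g1 : - (pi / 2) <= g (al i) by exact: asin_geNpi2.
  have g2 : g (al i) <= pi / 2 by exact: asin_lepi2.
  have /andP[x1 x2] : - (pi / 2) <= c * x i 0 <= pi / 2.
    by rewrite -ler_norml normrM (gtr0_norm c0) -cL ler_pM2l.
  have hs : `|sin (c * x i 0) - sin (g (al i))| < 1 - cos (c * r').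
    have -> : sin (c * x i 0) - sin (g (al i)) = 2 * (u x i - (al i)%:R / n%:R).
      by rewrite gE /u; field; rewrite gt_eqF.
    by rewrite normrM (@ger0_norm _ 2)//; move: hi; rewrite /de; lra.
  have hc : 1 - cos (c * x i 0 - g (al i)) <= `|sin (c * x i 0) - sin (g (al i))|.
    have [le1|/ltW le1] := leP (g (al i)) (c * x i 0).
      by apply: le_trans (ler_norm _); exact: sin_sub_ge.
    by rewrite -cosN opprB distrC; apply: le_trans (ler_norm _); exact: sin_sub_ge.
  have hcc : cos (c * r') < cos `|c * x i 0 - g (al i)|.
    by rewrite cos_norm; move: hs hc; lra.
  have /andP[cr0 cr1] := cr'.
  have hcr : c * r' \in `[0, pi] by rewrite in_itv/=; apply/andP; split; lra.
  have hd : `|c * x i 0 - g (al i)| \in `[0, pi].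
    by rewrite in_itv/= normr_ge0/= ler_norml; apply/andP; split; lra.
  rewrite (ltr_cos hd hcr) in hcc.
  have -> : x i 0 - g (al i) / c = (c * x i 0 - g (al i)) / c.
    by field; rewrite gt_eqF.
  by rewrite normrM normfV (gtr0_norm c0) ltr_pdivrMr// (mulrC r').
have -> : f x - h x = \sum_al (f x - f (X al)) * W (u x) al.
  rewrite /h; under [in RHS]eq_bigr do rewrite mulrBl.
  by rewrite sumrB -mulr_sumr sum_W mulr1.
apply: le_trans (ler_norm_sum _ _ _) _.
apply: le_trans (_ : \sum_al (e / 2 * W (u x) al + C *
  \sum_i (W (u x) al * (u x i - (al i)%:R / n%:R) ^+ 2)) <= _).
  apply: ler_sum => al _; rewrite normrM (ger0_norm (W_ge0 al (u01 x))).
  apply: le_trans (ler_wpM2r (W_ge0 al (u01 x)) (key al)) _.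
  rewrite mulrDl lerD// -mulrA ler_wpM2l// mulr_suml ler_sum// => i _.
  by rewrite mulrC.
rewrite big_split/= -!mulr_sumr sum_W mulr1 exchange_big/=.
apply: le_trans (_ : e / 2 + C * (m%:R / n%:R) <= _); last by lra.
rewrite lerD2l; apply: ler_wpM2l => //.
apply: le_trans (_ : \sum_(i < m) n%:R^-1 <= _).
  by apply: ler_sum => i _; exact: W_variance.
by rewrite sumr_const card_ord mulr_natl.
Qed.

End trigonometric_approximation.

(** * Convergence in law of vectors *)

Section euclidean_norm.
Variables (R : realType) (m : nat).
Implicit Types (u v : 'cV[R]_m).

Lemma enorm_ge0 v : 0 <= enorm v. Proof. exact: sqrtr_ge0. Qed.

Lemma sqr_enorm v : enorm v ^+ 2 = \sum_i v i 0 ^+ 2.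
Proof. by rewrite sqr_sqrtr// sumr_ge0// => i _; exact: sqr_ge0. Qed.

Lemma le_entry_enorm v i : `|v i 0| <= enorm v.
Proof.
rewrite -sqrtr_sqr ler_wsqrtr// (bigD1 i)//= lerDl.
by apply: sumr_ge0 => j _; exact: sqr_ge0.
Qed.

Lemma enorm_le_sum v : enorm v <= \sum_i `|v i 0|.
Proof.
have s0 : 0 <= \sum_i `|v i 0| by exact: sumr_ge0.
rewrite -(ger0_norm s0) -sqrtr_sqr ler_wsqrtr// expr2 mulr_suml ler_sum// => i _.
rewrite -real_normK ?num_real// expr2 ler_wpM2l// (bigD1 i)//= lerDl.
exact: sumr_ge0.
Qed.

Lemma sum_le_enorm v : \sum_i `|v i 0| <= m%:R * enorm v.
Proof.
rewrite mulr_natl -[X in _ *+ X](card_ord m) -sumr_const ler_sum// => i _.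
exact: le_entry_enorm.
Qed.

Lemma enormD_le u v : enorm (u + v) <= m%:R * (enorm u + enorm v).
Proof.
rewrite (le_trans (enorm_le_sum _))// mulrDr.
rewrite (le_trans _ (lerD (sum_le_enorm u) (sum_le_enorm v)))//.
by rewrite -big_split ler_sum// => i _; rewrite mxE ler_normD.
Qed.

Lemma enormZ (c : R) v : enorm (c *: v) = `|c| * enorm v.
Proof.
rewrite /enorm -sqrtr_sqr -sqrtrM ?sqr_ge0// mulr_sumr; congr Num.sqrt.
by apply: eq_bigr => i _; rewrite mxE exprMn.
Qed.

Context d (Om : measurableType d).
Implicit Types (G H : Om -> 'cV[R]_m).

Lemma measurable_enorm G : vmeasurable G -> measurable_fun setT (fun w => enorm (G w)).
Proof.
move=> mG; apply: measurableT_comp.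
  by apply: continuous_measurable_fun; exact: sqrt_continuous.
by apply: measurable_sum => i; apply: measurable_funX; exact: mG.
Qed.

Lemma measurable_enorm_gt G (c : R) : vmeasurable G ->
  measurable [set w | c < enorm (G w)].
Proof.
move=> mG; have := measurable_preimageT (measurable_enorm mG) (measurable_itv `]c, +oo[).
by congr measurable; apply/seteqP; split=> w /=; rewrite in_itv/= andbT.
Qed.

Lemma vmeasurableD G H : vmeasurable G -> vmeasurable H ->
  vmeasurable (fun w => G w + H w).
Proof.
move=> mG mH i; under eq_fun do rewrite mxE.
by apply: measurable_funD; [exact: mG|exact: mH].
Qed.

Lemma vmeasurableZ (f : Om -> R) G : measurable_fun setT f -> vmeasurable G ->
  vmeasurable (fun w => f w *: G w).
Proof.
move=> mf mG i; under eq_fun do rewrite mxE.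
by apply: measurable_funM => //; exact: mG.
Qed.

Lemma vmeasurable_cst v : vmeasurable (fun _ : Om => v).
Proof. by move=> i; exact: measurable_cst. Qed.

Lemma vmeasurableB G H : vmeasurable G -> vmeasurable H ->
  vmeasurable (fun w => G w - H w).
Proof.
move=> mG mH i; under eq_fun do rewrite !mxE.
by apply: measurable_funB; [exact: mG|exact: mH].
Qed.

Lemma vmeasurable_sum n (F : nat -> Om -> 'cV[R]_m) :
  (forall j, vmeasurable (F j)) -> vmeasurable (fun w => \sum_(j < n) F j w).
Proof.
move=> mF i; under eq_fun do rewrite summxE.
by apply: measurable_sum => j; exact: mF.
Qed.

End euclidean_norm.

Section real_probability.
Context d (Om : measurableType d) (R : realType) (P : probability Om R).

Lemma fine_prob_ge0 A : 0 <= fine (P A).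
Proof. by rewrite fine_ge0. Qed.

Lemma Rintegral_indic A : measurable A -> \int[P]_w (\1_A w) = fine (P A).
Proof. by move=> mA; rewrite /Rintegral integral_indic// setIT. Qed.

Lemma integrable_indicM A (c : R) : measurable A ->
  P.-integrable setT (EFin \o (fun w => c * \1_A w)).
Proof.
move=> mA; apply: (@integrable_bounded _ _ _ _ _ `|c|).
  by apply: measurable_funM.
move=> w; rewrite normrM ler_piMr// indicE.
by case: (_ \in _); rewrite ?normr1 ?normr0.
Qed.

Lemma markov_real (X : Om -> R) (c : R) : measurable_fun setT X ->
  P.-integrable setT (EFin \o X) -> (forall w, 0 <= X w) -> 0 < c ->
  fine (P [set w | c < X w]) <= (\int[P]_w X w) / c.
Proof.
move=> mX iX X0 c0; rewrite ler_pdivlMr// mulrC.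
have mA : measurable [set w | c < X w].
  have := measurable_preimageT mX (measurable_itv `]c, +oo[).
  by congr measurable; apply/seteqP; split=> w /=; rewrite in_itv/= andbT.
rewrite -Rintegral_indic// -RintegralZl//; last first.
  by have := integrable_indicM 1 mA; apply: eq_integrable => // w _ /=; rewrite mul1r.
apply: le_Rintegral => //; first exact: integrable_indicM.
move=> w _; rewrite indicE; case: (boolP (w \in _)) => [|_].
  by rewrite inE/= mulr1 => /ltW.
by rewrite mulr0.
Qed.

Lemma Rintegral_dist_le (f h : Om -> R) (A : set Om) (e M : R) :
  measurable_fun setT f -> measurable_fun setT h -> measurable A ->
  0 <= e -> 0 <= M -> (forall w, `|f w| <= M) -> (forall w, `|h w| <= M) ->
  (forall w, ~ A w -> `|f w - h w| <= e) ->
  `|\int[P]_w f w - \int[P]_w h w| <= e + 2 * M * fine (P A).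
Proof.
move=> mf mh mA e0 M0 fM hM fh.
have if_ := integrable_bounded P mf fM.
have ih := integrable_bounded P mh hM.
rewrite -RintegralB//.
have iD : P.-integrable setT (EFin \o (fun w => f w - h w)).
  exact: (integrableB measurableT if_ ih).
apply: le_trans (le_normr_Rintegral _ iD) _ => //.
have ie : P.-integrable setT (EFin \o (fun=> e)).
  by apply: (@integrable_bounded _ _ _ _ _ e) => // w; rewrite ger0_norm.
have iA := integrable_indicM (2 * M) mA.
have -> : e + 2 * M * fine (P A) = \int[P]_w (e + 2 * M * \1_A w).
  rewrite RintegralD// RintegralZl ?Rintegral_indic//; last first.
    by have := integrable_indicM 1 mA; apply: eq_integrable => // w _ /=; rewrite mul1r.
  by congr (_ + _); rewrite /Rintegral integral_cst//= probability_setT mule1.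
apply: le_Rintegral => //.
- exact: integrable_norm iD.
- exact: (integrableD measurableT ie iA).
move=> w _; rewrite indicE; case: (boolP (w \in A)) => [_|/negP wA].
  rewrite mulr1 (le_trans (ler_normB _ _))//.
  by have := fM w; have := hM w; lra.
by rewrite mulr0 addr0; apply: fh => Aw; apply: wA; rewrite inE.
Qed.

Lemma expectation_bounded (f : Om -> R) M : measurable_fun setT f ->
  (forall w, `|f w| <= M) -> ('E_P[f])%E = (\int[P]_w f w)%:E.
Proof.
move=> mf fM; rewrite unlock fineK//.
by apply: integrable_fin_num => //; exact: (integrable_bounded P mf fM).
Qed.

End real_probability.

Section weak_convergence.
Variables (R : realType) (m : nat).

Lemma measurable_continuous_vector d (Om : measurableType d) (G : Om -> 'cV[R]_m)
    (f : 'cV[R]_m -> R) : vmeasurable G -> continuous f ->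
  (exists M, forall x, `|f x| <= M) -> measurable_fun setT (f \o G).
Proof.
move=> mG cf [M fM].
have happ k : exists h, [/\ trigpoly h, forall x, `|h x| <= M &
    forall x : 'cV[R]_m, (forall i, `|x i 0| <= k.+1%:R) -> `|f x - h x| <= k.+1%:R^-1].
  by apply: trigpoly_approx; rewrite ?invr_gt0.
have [h hP] := choice happ.
apply: (@measurable_fun_cvg _ _ _ setT (fun k => h k \o G)).
- by move=> k; have [th _ _] := hP k; exact: measurable_trigpoly.
- move=> w _; apply/cvgrPdist_le => e e0.
  near=> k; have [_ _ hk] := hP k; apply: le_trans (hk (G w) _) _.
    move=> i; apply: le_trans (le_entry_enorm (G w) i) _.
    apply: le_trans (_ : k%:R <= _); last by rewrite ler_nat.
    by near: k; exact: nbhs_infty_ger.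
  rewrite -[leRHS]invrK lef_pV2 ?posrE ?invr_gt0//.
  apply: le_trans (_ : k%:R <= _); last by rewrite ler_nat.
  by near: k; exact: nbhs_infty_ger.
Unshelve. all: end_near. Qed.

Definition tight d (Om : measurableType d) (P : probability Om R)
    (Z : nat -> Om -> 'cV[R]_m) :=
  forall e : R, 0 < e -> exists2 L : R, 0 < L &
    \forall n \near \oo, fine (P [set w | L < enorm (Z n w)]) <= e.

Lemma tight_const d (Om : measurableType d) (P : probability Om R)
    (G : Om -> 'cV[R]_m) : vmeasurable G -> tight P (fun=> G).
Proof.
move=> mG e e0.
pose A k := [set w | k.+1%:R < enorm (G w)].
have mA k : measurable (A k) by exact: measurable_enorm_gt.
have A0 : \bigcap_k A k = set0.
  apply/seteqP; split=> w //= Aw.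
  have /(_ I) := Aw (Num.truncn (enorm (G w))).
  by rewrite /A/= ltNge => /negP; apply; apply: ltW; exact: truncnS_gt.
have cA : P (A k) @[k --> \oo] --> (0 : \bar R)%E.
  rewrite -(measure0 P) -A0; apply: nonincreasing_cvg_mu => //.
  - by rewrite (le_lt_trans (probability_le1 _ _))// ltry.
  - by rewrite A0.
  - move=> i j ij; apply/subsetPset => w; rewrite /A/=; apply: le_lt_trans.
    by rewrite ler_nat.
have /(_ eventually_filter)/cvgrPdist_le/(_ _ e0)[N _ hN] := fine_cvg cA.
exists N.+1%:R => //; apply: nearW => n.
have /= := hN N (leqnn N).
by rewrite sub0r normrN ger0_norm ?fine_prob_ge0.
Qed.

Lemma cvg_in_law_trigpoly d (Om : measurableType d) (P : probability Om R)
    d' (Om' : measurableType d') (P' : probability Om' R)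
    (Z : nat -> Om -> 'cV[R]_m) (G : Om' -> 'cV[R]_m) :
  (forall n, vmeasurable (Z n)) -> vmeasurable G -> tight P Z ->
  (forall h, trigpoly h ->
    \int[P]_w h (Z n w) @[n --> \oo] --> \int[P']_w h (G w)) ->
  cvg_in_law P P' Z G.
Proof.
move=> mZ mG tZ trig f cf fb; have [M fM] := fb.
have mfZ n := measurable_continuous_vector (mZ n) cf fb.
have mfG := measurable_continuous_vector mG cf fb.
rewrite (expectation_bounded _ mfG (fun w => fM (G w))).
under eq_fun do rewrite (expectation_bounded _ (mfZ _) (fun w => fM (Z _ w))).
apply: cvg_EFin; first exact: nearW.
have M0 : 0 <= M by apply: le_trans (fM 0); exact: normr_ge0.
apply/cvgrPdist_le => e e0.
pose e1 := e / (5 + 4 * M).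
have d0 : 0 < 5 + 4 * M by lra.
have e10 : 0 < e1 by rewrite divr_gt0.
have e1E : e = e1 * (5 + 4 * M) by rewrite /e1 divfK// gt_eqF.
have [L1 L10 hL1] := tZ _ e10.
have [L2 L20 hL2] := tight_const P' mG e10.
pose L := Num.max L1 L2.
have LL1 : L1 <= L by rewrite le_max lexx.
have LL2 : L2 <= L by rewrite le_max lexx orbT.
have L0 : 0 < L by exact: lt_le_trans LL1.
have [h [th hM hf]] := trigpoly_approx cf fM L0 e10.
have bad_le d2 (Om2 : measurableType d2) (P2 : probability Om2 R) (H : Om2 -> 'cV[R]_m) l :
    vmeasurable H -> l <= L -> fine (P2 [set w | l < enorm (H w)]) <= e1 ->
    `|\int[P2]_w f (H w) - \int[P2]_w h (H w)| <= e1 + 2 * M * e1.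
  move=> mH lL Pl.
  have close w : ~ [set w | l < enorm (H w)] w -> `|f (H w) - h (H w)| <= e1.
    move=> /= /negP; rewrite -leNgt => wl; apply: hf => i.
    exact: le_trans (le_entry_enorm _ i) (le_trans wl lL).
  have mfH := measurable_continuous_vector mH cf fb.
  have := Rintegral_dist_le P2 mfH (measurable_trigpoly th mH)
    (measurable_enorm_gt l mH) (ltW e10) M0 (fun w => fM (H w)) (fun w => hM (H w)) close.
  by move=> /le_trans; apply; rewrite lerD2l ler_wpM2l// mulr_ge0.
have /cvgrPdist_le/(_ _ e10) hG := trig h th.
have [N _ hN] := hL2.
have boundG := bad_le _ _ P' G L2 mG LL2 (hN N (leqnn N)).
near=> n.
have boundZ : `|\int[P]_w f (Z n w) - \int[P]_w h (Z n w)| <= e1 + 2 * M * e1.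
  by apply: (bad_le _ _ P (Z n) L1) => //; near: n.
have bh : `|\int[P']_w h (G w) - \int[P]_w h (Z n w)| <= e1.
  by near: n; exact: hG.
rewrite /= e1E.
have -> : \int[P']_w f (G w) - \int[P]_w f (Z n w) =
  (\int[P']_w f (G w) - \int[P']_w h (G w)) +
  (\int[P']_w h (G w) - \int[P]_w h (Z n w)) -
  (\int[P]_w f (Z n w) - \int[P]_w h (Z n w)) by ring.
rewrite (le_trans (ler_normB _ _))//.
have := ler_normD (\int[P']_w f (G w) - \int[P']_w h (G w)) (\int[P']_w h (G w) - \int[P]_w h (Z n w)).
by nra.
Unshelve. all: end_near. Qed.

End weak_convergence.

Section slutsky.
Context d (Om : measurableType d) (R : realType) (P : probability Om R) (m : nat).
Variables (Z Z' : nat -> Om -> 'cV[R]_m).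
Hypotheses (mZ : forall n, vmeasurable (Z n)) (mZ' : forall n, vmeasurable (Z' n)).
Hypothesis close : forall e : R, 0 < e ->
  fine (P [set w | e < enorm (Z' n w - Z n w)]) @[n --> \oo] --> (0 : R).

Lemma fine_prob_le (A B : set Om) : measurable A -> measurable B -> A `<=` B ->
  fine (P A) <= fine (P B).
Proof.
by move=> mA mB AB; rewrite fine_le ?fin_num_measure// le_measure ?inE.
Qed.

Lemma fine_probU_le (A B : set Om) : measurable A -> measurable B ->
  fine (P (A `|` B)) <= fine (P A) + fine (P B).
Proof.
move=> mA mB; rewrite -fineD ?fin_num_measure// fine_le ?fin_num_measure//.
- exact: measurableU.
- by rewrite fin_numD !fin_num_measure.
- exact: measureU2.
Qed.

Lemma tight_slutsky : tight P Z -> tight P Z'.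
Proof.
move=> tZ e e0; have e20 : 0 < e / 2 by rewrite divr_gt0.
have [L L0 hL] := tZ _ e20.
have /cvgrPdist_le/(_ _ e20) h1 := close ltr01.
exists (m.+1%:R * (L + 1)); first by rewrite mulr_gt0// addr_gt0.
near=> n.
have mD := vmeasurableB (mZ' n) (mZ n).
have mA := measurable_enorm_gt L (mZ n); have mB := measurable_enorm_gt 1 mD.
apply: le_trans (_ : fine (P ([set w | L < enorm (Z n w)] `|`
  [set w | 1 < enorm (Z' n w - Z n w)])) <= _).
  apply: fine_prob_le; [exact: measurable_enorm_gt|exact: measurableU|].
  move=> w /= big.
  have [|hl] := ltP L (enorm (Z n w)); first by left.
  have [|hd] := ltP 1 (enorm (Z' n w - Z n w)); first by right.
  have := enormD_le (Z n w) (Z' n w - Z n w); rewrite addrC subrK => hh.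
  exfalso; move: big; rewrite ltNge => /negP; apply; apply: le_trans hh _.
  by apply: ler_pM => //; [rewrite addr_ge0 ?enorm_ge0|rewrite ler_nat|exact: lerD].
rewrite (le_trans (fine_probU_le mA mB))//.
have p1 : fine (P [set w | L < enorm (Z n w)]) <= e / 2 by near: n.
have p2 : `|0 - fine (P [set w | 1 < enorm (Z' n w - Z n w)])| <= e / 2 by near: n.
rewrite sub0r normrN ger0_norm ?fine_prob_ge0// in p2.
by lra.
Unshelve. all: end_near. Qed.

Lemma trigpoly_slutsky (h : 'cV[R]_m -> R) (l : R) : trigpoly h ->
  \int[P]_w h (Z n w) @[n --> \oo] --> l ->
  \int[P]_w h (Z' n w) @[n --> \oo] --> l.
Proof.
move=> th hZ; have [M hM] := trigpoly_bounded th.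
have [K K0 hK] := trigpoly_lipschitz th.
have M0 : 0 <= M by apply: le_trans (hM 0); exact: normr_ge0.
apply/cvgrPdist_le => e e0.
pose e1 := e / (2 + 2 * M).
have d0 : 0 < 2 + 2 * M by lra.
have e10 : 0 < e1 by rewrite divr_gt0.
have e1E : e = e1 * (2 + 2 * M) by rewrite /e1 divfK// gt_eqF.
pose c := e1 / (K * m%:R + 1).
have Km : 0 < K * m%:R + 1 by rewrite ltr_wpDl// mulr_ge0.
have c0 : 0 < c by rewrite divr_gt0.
have cE : K * m%:R * c <= e1.
  by rewrite /c mulrA ler_pdivrMr//; have := ltW e10; lra.
have /cvgrPdist_le/(_ _ e10) h1 := close c0.
have /cvgrPdist_le/(_ _ e10) h2 := hZ.
near=> n.
have mD := vmeasurableB (mZ' n) (mZ n).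
have diff w : ~ [set w | c < enorm (Z' n w - Z n w)] w ->
    `|h (Z' n w) - h (Z n w)| <= e1.
  move=> /= /negP; rewrite -leNgt => cw; apply: le_trans (hK _ _) _.
  apply: le_trans cE; rewrite -mulrA ler_wpM2l//.
  apply: le_trans (_ : \sum_i `|(Z' n w - Z n w) i 0| <= _).
    by apply: ler_sum => i _; rewrite !mxE.
  by apply: le_trans (sum_le_enorm _) _; rewrite ler_wpM2l.
have := Rintegral_dist_le P (measurable_trigpoly th (mZ' n)) (measurable_trigpoly th (mZ n))
  (measurable_enorm_gt c mD) (ltW e10) M0 (fun w => hM (Z' n w)) (fun w => hM (Z n w)) diff.
set q := fine _ => b1.
have b2 : `|l - \int[P]_w h (Z n w)| <= e1 by near: n.
have b3 : `|0 - q| <= e1 by rewrite /q; near: n.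
rewrite sub0r normrN ger0_norm ?fine_prob_ge0// in b3.
rewrite /= -(subrKA (\int[P]_w h (Z n w))) (le_trans (ler_normD _ _))//.
rewrite [X in _ + X]distrC.
have : 2 * M * q <= 2 * M * e1 by rewrite ler_wpM2l// mulr_ge0.
by rewrite e1E; lra.
Unshelve. all: end_near. Qed.

End slutsky.

Section finite_sums.
Context d (Om : measurableType d) (R : realType) (P : probability Om R).

Lemma integrable_sumR (I : Type) (r : seq I) (F : I -> Om -> R) :
  (forall i, P.-integrable setT (EFin \o F i)) ->
  P.-integrable setT (EFin \o (fun w => \sum_(i <- r) F i w)).
Proof.
move=> iF; elim: r => [|i r IH].
  apply: (@integrable_bounded _ _ _ _ _ 0) => [|w].
    by under eq_fun do rewrite big_nil; exact: measurable_cst.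
  by rewrite big_nil normr0.
have -> : EFin \o (fun w => \sum_(j <- i :: r) F j w) =
    (EFin \o F i) \+ (EFin \o (fun w => \sum_(j <- r) F j w)).
  by apply/funext => w /=; rewrite big_cons EFinD.
exact: integrableD.
Qed.

Lemma Rintegral_sum (I : Type) (r : seq I) (F : I -> Om -> R) :
  (forall i, P.-integrable setT (EFin \o F i)) ->
  \int[P]_w (\sum_(i <- r) F i w) = \sum_(i <- r) \int[P]_w F i w.
Proof.
move=> iF; elim: r => [|i r IH].
  under eq_Rintegral do rewrite big_nil.
  by rewrite big_nil /Rintegral integral0.
under eq_Rintegral do rewrite big_cons.
rewrite RintegralD//; last exact: integrable_sumR.
by rewrite big_cons IH.
Qed.

Lemma integrable_mul_sqr (f g : Om -> R) :
  measurable_fun setT f -> measurable_fun setT g ->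
  P.-integrable setT (EFin \o (fun w => f w ^+ 2)) ->
  P.-integrable setT (EFin \o (fun w => g w ^+ 2)) ->
  P.-integrable setT (EFin \o (fun w => f w * g w)).
Proof.
move=> mf mg if_ ig.
have i2 : P.-integrable setT (EFin \o (fun w => f w ^+ 2 + g w ^+ 2)).
  exact: (integrableD measurableT if_ ig).
apply: le_integrable i2 => //; first by apply/measurable_EFinP; exact: measurable_funM.
move=> w _; rewrite lee_fin [leRHS]ger0_norm ?addr_ge0 ?sqr_ge0// ler_norml.
have := sqr_ge0 (f w + g w); have := sqr_ge0 (f w - g w).
have := sqr_ge0 (f w); have := sqr_ge0 (g w).
by rewrite !expr2 => *; apply/andP; split; lra.
Qed.

End finite_sums.

Section iid_vectors.
Context d (Om : measurableType d) (R : realType) (P : probability Om R).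
Context d' (D : measurableType d') (W : nat -> Om -> D).
Hypothesis mW : forall j, measurable_fun setT (W j).
Hypothesis indepW : independent_seq P W.
Hypothesis lawW : forall j A, measurable A -> P (W j @^-1` A) = P (W 0%N @^-1` A).

Lemma indep_partial_sum (u : D -> R) : measurable_fun setT u ->
  forall n A B, measurable A -> measurable B ->
  P (partial_sum (fun j w => u (W j w)) n @^-1` A `&` (fun w => u (W n w)) @^-1` B) =
  (P (partial_sum (fun j w => u (W j w)) n @^-1` A) *
   P ((fun w => u (W n w)) @^-1` B))%E.
Proof.
move=> mu n A B mA mB.
pose s (t : n.-tuple D) := \sum_(i < n) u (tnth t i).
have ms : measurable_fun setT s.
  apply: measurable_sum => i; apply: (measurableT_comp mu).
  exact: measurable_tnth.
have sE : partial_sum (fun j w => u (W j w)) n = s \o (fun w => [tuple W j w | j < n]).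
  by apply/funext => w; apply: eq_bigr => i _; rewrite tnth_mktuple.
rewrite sE.
exact: (independent_next mW indepW (measurable_preimageT ms mA) (measurable_preimageT mu mB)).
Qed.

Lemma sum_second_moment (u : D -> R) : measurable_fun setT u ->
  P.-integrable setT (EFin \o (fun w => u (W 0%N w) ^+ 2)) ->
  \int[P]_w u (W 0%N w) = 0 ->
  forall n, P.-integrable setT (EFin \o (fun w => (\sum_(j < n) u (W j w)) ^+ 2)) /\
  \int[P]_w ((\sum_(j < n) u (W j w)) ^+ 2) = n%:R * \int[P]_w (u (W 0%N w) ^+ 2).
Proof.
move=> mu iu2 Eu n.
have [] := @partial_sum_second_moment _ _ _ P (fun j w => u (W j w))
  (fun j => measurableT_comp mu (mW j)) (indep_partial_sum mu) _ iu2 Eu n.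
  by move=> j A mA; exact: (lawW j (measurable_preimageT mu mA)).
by move=> h1 _ h2; split.
Qed.

Variables (m : nat) (psi : D -> 'cV[R]_m).
Hypothesis mpsi : vmeasurable psi.
Hypothesis ipsi : forall i,
  P.-integrable setT (EFin \o (fun w => psi (W 0%N w) i 0 ^+ 2)).
Hypothesis Epsi : forall i, \int[P]_w psi (W 0%N w) i 0 = 0.

Definition second_moment_mx : 'M[R]_m :=
  \matrix_(i, j) \int[P]_w (psi (W 0%N w) i 0 * psi (W 0%N w) j 0).
Local Notation V := second_moment_mx.

Let mpsiW j : vmeasurable (fun w => psi (W j w)).
Proof. by move=> i; exact: measurableT_comp (mpsi i) (mW j). Qed.

Let ipsi1 i : P.-integrable setT (EFin \o (fun w => psi (W 0%N w) i 0)).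
Proof. exact: square_integrable_integrable (@mpsiW 0%N i) (ipsi i). Qed.

Let ipp i j : P.-integrable setT
  (EFin \o (fun w => psi (W 0%N w) i 0 * psi (W 0%N w) j 0)).
Proof. exact: (integrable_mul_sqr (@mpsiW 0%N i) (@mpsiW 0%N j)). Qed.

Let dot_sqr (a v : 'cV[R]_m) :
  (a^T *m v) 0 0 ^+ 2 = \sum_i \sum_j (a i 0 * a j 0) * (v i 0 * v j 0).
Proof.
rewrite dotmxE expr2 big_distrl; apply: eq_bigr => i _; rewrite /= big_distrr.
by apply: eq_bigr => j _; rewrite mulrACA.
Qed.

Let ipsiZ (a : 'cV[R]_m) i j : P.-integrable setT
  (EFin \o (fun w => (a i 0 * a j 0) * (psi (W 0%N w) i 0 * psi (W 0%N w) j 0))).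
Proof. exact: (integrableZl measurableT _ (ipp i j)). Qed.

Let idot (a : 'cV[R]_m) :
  P.-integrable setT (EFin \o (fun w => (a^T *m psi (W 0%N w)) 0 0 ^+ 2)).
Proof.
under eq_fun do rewrite dot_sqr.
by apply: integrable_sumR => i; apply: integrable_sumR => j.
Qed.

Let Edot2 (a : 'cV[R]_m) :
  \int[P]_w ((a^T *m psi (W 0%N w)) 0 0 ^+ 2) = (a^T *m V *m a) 0 0.
Proof.
under eq_Rintegral do rewrite dot_sqr.
rewrite Rintegral_sum; last by move=> i; exact: integrable_sumR.
rewrite -mulmxA dotmxE; apply: eq_bigr => i _.
rewrite Rintegral_sum// mxE mulr_sumr; apply: eq_bigr => j _.
by rewrite RintegralZl// !mxE mulrAC mulrA.
Qed.

Let Edot (a : 'cV[R]_m) : \int[P]_w (a^T *m psi (W 0%N w)) 0 0 = 0.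
Proof.
under eq_Rintegral do rewrite dotmxE.
rewrite Rintegral_sum; last first.
  by move=> i; exact: (integrableZl measurableT _ (ipsi1 i)).
by rewrite big1// => i _; rewrite RintegralZl// Epsi mulr0.
Qed.

Lemma psd_second_moment_mx : psd V.
Proof.
split.
  by apply/matrixP => i j; rewrite !mxE; apply: eq_Rintegral => w _; rewrite mulrC.
by move=> a; rewrite -Edot2; apply: Rintegral_ge0 => w _; exact: sqr_ge0.
Qed.

Definition normalized_sum n w : 'cV[R]_m :=
  (Num.sqrt n%:R)^-1 *: \sum_(j < n) psi (W j w).
Local Notation Z := normalized_sum.

Lemma vmeasurable_normalized_sum n : vmeasurable (Z n).
Proof.
apply: vmeasurableZ; first exact: measurable_cst.
exact: (vmeasurable_sum n mpsiW).
Qed.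

Lemma tight_normalized_sum : tight P Z.
Proof.
move=> e e0.
pose t := \sum_i \int[P]_w (psi (W 0%N w) i 0 ^+ 2).
have t0 : 0 <= t by apply: sumr_ge0 => i _; apply: Rintegral_ge0 => w _; exact: sqr_ge0.
pose L := Num.sqrt (t / e) + 1.
have L0 : 0 < L by rewrite ltr_wpDl ?sqrtr_ge0.
have L2 : t / e <= L ^+ 2.
  have h : t / e = Num.sqrt (t / e) ^+ 2 by rewrite sqr_sqrtr// divr_ge0// ltW.
  by rewrite {1}h lerXn2r ?nnegrE ?sqrtr_ge0// ?ltW// /L ltrDl.
exists L => //; apply: nearW => n.
have En w : enorm (Z n w) ^+ 2 = \sum_i (n%:R^-1 * (\sum_(j < n) psi (W j w) i 0) ^+ 2).
  rewrite sqr_enorm; apply: eq_bigr => i _.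
  by rewrite /normalized_sum mxE summxE exprMn sqr_inv_sqrtn.
have coord i : P.-integrable setT
      (EFin \o (fun w => n%:R^-1 * (\sum_(j < n) psi (W j w) i 0) ^+ 2)) /\
    \int[P]_w (n%:R^-1 * (\sum_(j < n) psi (W j w) i 0) ^+ 2) <=
      \int[P]_w (psi (W 0%N w) i 0 ^+ 2).
  have [h1 h2] := sum_second_moment (mpsi i) (ipsi i) (Epsi i) n.
  split; first exact: (integrableZl measurableT _ h1).
  rewrite RintegralZl// h2.
  have [->|n0] := posnP n.
    by rewrite mul0r mulr0; apply: Rintegral_ge0 => w _; exact: sqr_ge0.
  by rewrite mulrA mulVf ?mul1r// pnatr_eq0 -lt0n.
have iE : P.-integrable setT (EFin \o (fun w => enorm (Z n w) ^+ 2)).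
  under eq_fun do rewrite En.
  by apply: integrable_sumR => i; have [] := coord i.
have EE : \int[P]_w (enorm (Z n w) ^+ 2) <= t.
  under eq_Rintegral do rewrite En.
  rewrite Rintegral_sum; last by move=> i; have [] := coord i.
  by apply: ler_sum => i _; have [] := coord i.
have mE : measurable_fun setT (fun w => enorm (Z n w) ^+ 2).
  by apply: measurable_funX; apply: measurable_enorm; exact: vmeasurable_normalized_sum.
have := markov_real mE iE (fun w => sqr_ge0 _) (exprn_gt0 2 L0).
rewrite (_ : [set w | L ^+ 2 < _] = [set w | L < enorm (Z n w)]); last first.
  by apply/seteqP; split=> w /=; rewrite ltr_pXn2r ?nnegrE ?enorm_ge0 ?(ltW L0).
move=> /le_trans; apply; rewrite ler_pdivrMr ?exprn_gt0//.
apply: le_trans EE _; rewrite mulrC -ler_pdivrMr//.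
Qed.

Lemma trigpoly_clt d'' (Om' : measurableType d'') (P' : probability Om' R)
    (G : Om' -> 'cV[R]_m) (h : 'cV[R]_m -> R) :
  gaussian_vector P' G 0 V -> trigpoly h ->
  \int[P]_w h (Z n w) @[n --> \oo] --> \int[P']_w h (G w).
Proof.
move=> [mG lawG] th.
elim: th => [a b|f g tf IHf tg IHg|c f tf IHf]; last first.
- have ib d2 (Om2 : measurableType d2) (P2 : probability Om2 R) (H : Om2 -> 'cV[R]_m) :
      vmeasurable H -> P2.-integrable setT (EFin \o (fun w => f (H w))).
    move=> mH; have [M fM] := trigpoly_bounded tf.
    by apply: integrable_bounded (measurable_trigpoly tf mH) (fun w => fM (H w)).
  rewrite RintegralZl//; last exact: ib.
  have e n : \int[P]_w (c * f (Z n w)) = c * \int[P]_w f (Z n w).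
    by rewrite RintegralZl//; apply: ib; exact: vmeasurable_normalized_sum.
  under eq_fun do rewrite e.
  by apply: cvgM => //; exact: cvg_cst.
- have ib k (tk : trigpoly k) d2 (Om2 : measurableType d2) (P2 : probability Om2 R)
      (H : Om2 -> 'cV[R]_m) :
      vmeasurable H -> P2.-integrable setT (EFin \o (fun w => k (H w))).
    move=> mH; have [M fM] := trigpoly_bounded tk.
    by apply: integrable_bounded (measurable_trigpoly tk mH) (fun w => fM (H w)).
  rewrite RintegralD//; [|exact: ib|exact: ib].
  have e n : \int[P]_w (f (Z n w) + g (Z n w)) =
      \int[P]_w f (Z n w) + \int[P]_w g (Z n w).
    by rewrite RintegralD//; apply: ib => //; exact: vmeasurable_normalized_sum.
  under eq_fun do rewrite e.
  exact: cvgD.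
pose s := (a^T *m V *m a) 0 0.
have [_ Vp] := psd_second_moment_mx.
have s0 : 0 <= s by exact: Vp.
have lawX : has_law P' (fun w => (a^T *m G w) 0 0) (normal_law 0 s).
  by have := lawG a; rewrite mulmx0 (_ : (0 : 'M[R]_(1, 1)) 0 0 = 0)// mxE.
have mX := measurable_dotmx a mG.
have mu : measurable_fun setT (fun x : D => (a^T *m psi x) 0 0) := measurable_dotmx a mpsi.
pose y j w := (a^T *m psi (W j w)) 0 0.
have lawy j A : measurable A -> P (y j @^-1` A) = P (y 0%N @^-1` A).
  by move=> mA; exact: (lawW j (measurable_preimageT mu mA)).
have g1 n : `|normal_char (s / n%:R)| <= 1 by exact: normal_char_le1.
have gG n : (0 < n)%N -> normal_char (s / n%:R) ^+ n = normal_char s.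
  move=> n0; rewrite -normal_charX ?divr_ge0//; congr normal_char.
  by field; rewrite pnatr_eq0 -lt0n.
have cg : n%:R * (1 - normal_char (s / n%:R)) @[n --> \oo] --> (\int[P]_w (y 0%N w ^+ 2)) / 2.
  by rewrite Edot2; exact: normal_char_scaled_cvg.
have [cc cs] := @char_function_cvg _ _ _ P y
  (fun j => measurableT_comp mu (mW j)) (indep_partial_sum mu) lawy (idot a) (Edot a)
  _ _ g1 gG cg.
have ZE n w : (a^T *m Z n w) 0 0 = (Num.sqrt n%:R)^-1 * partial_sum y n w.
  rewrite /normalized_sum dotmxZr; congr (_ * _).
  by rewrite mulmx_sumr summxE.
have expand d2 (Om2 : measurableType d2) (P2 : probability Om2 R) (X : Om2 -> R) :
    measurable_fun setT X ->
    \int[P2]_w cos (X w + b) = cos b * (\int[P2]_w cos (X w)) - sin b * \int[P2]_w sin (X w).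
  move=> mX2.
  have i1 : P2.-integrable setT (EFin \o (fun w => cos (X w))).
    by have := integrable_cosM P2 mX2 1; apply: eq_integrable => // w _ /=; rewrite mul1r.
  have i2 : P2.-integrable setT (EFin \o (fun w => sin (X w))).
    by have := integrable_sinM P2 mX2 1; apply: eq_integrable => // w _ /=; rewrite mul1r.
  rewrite -!RintegralZl// -RintegralB//.
  - by apply: eq_Rintegral => w _; rewrite cosD (mulrC (cos b)) (mulrC (sin b)).
  - exact: (integrableZl measurableT _ i1).
  - exact: (integrableZl measurableT _ i2).
rewrite expand// (has_law_normal_cos s0 mX lawX) (has_law_normal_sin s0 mX lawX).
have e n : \int[P]_w cos ((a^T *m Z n w) 0 0 + b) =
    cos b * (\int[P]_w cos ((Num.sqrt n%:R)^-1 * partial_sum y n w)) -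
    sin b * \int[P]_w sin ((Num.sqrt n%:R)^-1 * partial_sum y n w).
  rewrite expand; last exact: measurable_dotmx (@vmeasurable_normalized_sum n).
  by congr (_ * _ - _ * _); apply: eq_Rintegral => w _; rewrite ZE.
under eq_fun do rewrite e.
by apply: cvgB; apply: cvgM => //; exact: cvg_cst.
Qed.

End iid_vectors.

(** * Complete cases *)

Section probability_partition.
Context d (Om : measurableType d) (R : realType) (P : probability Om R).

Lemma prob_partition (N : Om -> nat) K (B : set Om) :
  (forall w, (N w < K)%N) -> (forall k, measurable [set w | N w = k]) ->
  measurable B ->
  fine (P B) = \sum_(k < K) fine (P (B `&` [set w | N w = k])).
Proof.
move=> NK mN mB; rewrite -Rintegral_indic//.
rewrite -(eq_bigr _ (fun (k : 'I_K) _ => Rintegral_indic P (measurableI _ _ mB (mN k)))).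
rewrite -Rintegral_sum; last first.
  move=> k; have := integrable_indicM P 1 (measurableI _ _ mB (mN k)).
  by apply: eq_integrable => // w _ /=; rewrite mul1r.
apply: eq_Rintegral => w _; rewrite (bigD1 (Ordinal (NK w)))//= big1 ?addr0.
  by rewrite !indicE in_setI [X in _ && X]mem_set ?andbT.
move=> k kN; rewrite indicE memNset//= => -[_ Nk]; move/eqP: kN; apply.
exact: val_inj.
Qed.

End probability_partition.

Section complete_case_sequence.
Context d (Om : measurableType d) (R : realType) (P : probability Om R).
Context d' (D : measurableType d').
Variables (W : nat -> Om -> D * bool) (x0 : D) (p : R) (Qt : probability D R).
Hypothesis mW : forall j, measurable_fun setT (W j).
Hypothesis indepW : independent_seq P W.
Hypothesis lawW : forall j A, measurable A -> P (W j @^-1` A) = P (W 0%N @^-1` A).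
Hypothesis lawQt : forall A, measurable A ->
  fine (P (W 0%N @^-1` (A `*` [set true]))) = p * fine (Qt A).
Hypothesis p0 : 0 < p.

Local Notation pr B := (fine (P B)).
Local Notation q A := (fine (Qt A)).

Definition cases n w : seq D := [seq (W j w).1 | j <- iota 0 n & (W j w).2].

Lemma casesS n w :
  cases n.+1 w = if (W n w).2 then rcons (cases n w) (W n w).1 else cases n w.
Proof.
rewrite /cases -[in iota _ _]addn1 iotaD filter_cat map_cat add0n /=.
by case: ifP => _ /=; rewrite ?cats1 ?cats0.
Qed.

Lemma size_cases_le n w : (size (cases n w) <= n)%N.
Proof.
rewrite size_map size_filter (leq_trans (count_size _ _))//.
by rewrite size_iota.
Qed.

Lemma size_casesE n w : (size (cases n w))%:R = \sum_(j < n) ((W j w).2)%:R :> R.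
Proof.
elim: n => [|n IH]; first by rewrite big_ord0.
rewrite casesS big_ord_recr/= -IH; case: ifP => _; last by rewrite addr0.
by rewrite size_rcons -natr1.
Qed.

Definition case_event n k (A : nat -> set D) : set Om :=
  [set w | size (cases n w) = k /\ forall i, (i < k)%N -> A i (nth x0 (cases n w) i)].

Let case_event0 k A : case_event 0 k A = if k == 0%N then setT else set0.
Proof.
case: ifPn => [/eqP ->|k0]; apply/seteqP; split=> w //=.
by move=> [/esym/eqP]; rewrite (negbTE k0).
Qed.

Let case_eventS n k A : case_event n.+1 k A =
  (case_event n k A `&` W n @^-1` (setT `*` [set false])) `|`
  (if k is k'.+1 then case_event n k' A `&` W n @^-1` (A k' `*` [set true]) else set0).
Proof.
apply/seteqP; split=> w; rewrite /case_event /= casesS.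
- case: ifP => dn [sk Ak]; last by left.
  right; case: k sk Ak => [|k]; rewrite size_rcons// => -[sk] Ak; split.
    split=> // i ik; have := Ak i (ltn_trans ik (ltnSn k)).
    by rewrite nth_rcons sk ik.
  split => //=; have := Ak k (ltnSn k).
  by rewrite nth_rcons sk ltnn eqxx.
- move=> [[[sk Ak] [_ /= ->]]//|].
  case: k => [//|k] [[sk Ak] [/= Ax ->]]; split; first by rewrite size_rcons sk.
  move=> i; rewrite ltnS leq_eqVlt => /orP[/eqP ->|ik].
    by rewrite nth_rcons sk ltnn eqxx.
  by rewrite nth_rcons sk ik; exact: Ak.
Qed.

Lemma measurable_case_event n k A : (forall i, measurable (A i)) ->
  measurable (case_event n k A).
Proof.
move=> mA; elim: n k => [|n IH] k; first by rewrite case_event0; case: ifP.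
have mX B b : measurable B -> measurable (W n @^-1` (B `*` [set b])).
  by move=> mB; apply: measurable_preimageT => //; exact: measurableX.
rewrite case_eventS; apply: measurableU; first by apply: measurableI => //; exact: mX.
by case: k => [|k] //; apply: measurableI => //; exact: mX.
Qed.

Let F (J : {fset nat}) (B : nat -> set (D * bool)) :=
  \bigcap_(j in [set` J]) (W j @^-1` B j).

Let mF J B : (forall j, measurable (B j)) -> measurable (F J B).
Proof.
move=> mB; apply: fin_bigcap_measurable; first exact: finite_fset.
by move=> j _; apply: measurable_preimageT.
Qed.

Let F_next n J B C : n \notin J -> (forall j, measurable (B j)) -> measurable C ->
  exists2 B', (forall j, measurable (B' j)) &
    F (n |` J)%fset B' = F J B `&` W n @^-1` C /\
    pr (F (n |` J)%fset B') = pr (F J B) * pr (W n @^-1` C).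
Proof.
move=> nJ mB mC; pose B' j := if j == n then C else B j.
have mB' j : measurable (B' j) by rewrite /B'; case: ifP.
have B'J j : j \in J -> B' j = B j.
  by move=> jJ; rewrite /B'; case: eqP => // jn; move: nJ; rewrite -jn jJ.
exists B' => //; split.
  apply/seteqP; split=> w.
    move=> h; split.
      by move=> j /= jJ; rewrite -(B'J _ jJ); apply: h; rewrite /= in_fset1U jJ orbT.
    by have := h n; rewrite /= in_fset1U eqxx /B' eqxx; exact.
  move=> [h hn] j /=; rewrite in_fset1U => /orP[/eqP ->|jJ].
    by rewrite /B' eqxx.
  by rewrite (B'J _ jJ); exact: h.
rewrite /F !indepW// big_fsetU1//= /B' eqxx fineM; last 2 first.
- by apply: fin_num_measure; exact: measurable_preimageT.
- apply: prode_fin_num => j _; apply: fin_num_measure.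
  by apply: measurable_preimageT => //; case: ifP.
rewrite mulrC; congr (fine _ * _); apply: eq_big_seq => j jJ.
by rewrite -/(B' j) (B'J _ jJ).
Qed.

Let pr_true n A : measurable A -> pr (W n @^-1` (A `*` [set true])) = p * q A.
Proof. by move=> mA; rewrite lawW ?lawQt//; exact: measurableX. Qed.

Let pr_false n : pr (W n @^-1` (setT `*` [set false])) = 1 - p.
Proof.
have mt : measurable (W n @^-1` (setT `*` [set true])).
  by apply: measurable_preimageT => //; exact: measurableX.
have -> : W n @^-1` (setT `*` [set false]) = ~` (W n @^-1` (setT `*` [set true])).
  apply/seteqP; split=> w /=; first by move=> [_ ->] [].
  by move=> h; split=> //; case E : (W n w).2 => //; case: h.
by rewrite probability_setC// fineB ?fin_num_measure// pr_true// probability_setT mulr1.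
Qed.

Let pr_case_eventF n k A J B : (forall i, measurable (A i)) ->
  (forall j, measurable (B j)) -> (forall j, j \in J -> (n <= j)%N) ->
  pr (case_event n k A `&` F J B) =
  bern n p k * (\prod_(i < k) q (A i)) * pr (F J B).
Proof.
move=> mA; elim: n k J B => [|n IH] k J B mB nJ.
  rewrite case_event0 /=; case: eqP => [->|_].
    by rewrite setTI big_ord0 mulr1 mul1r.
  by rewrite set0I measure0 !mul0r.
have nJ' : n \notin J by apply/negP => /nJ; rewrite ltnn.
have nU j : j \in (n |` J)%fset -> (n <= j)%N.
  by rewrite in_fset1U => /orP[/eqP ->//|/nJ/ltnW].
have step k' C : measurable C ->
    pr ((case_event n k' A `&` W n @^-1` C) `&` F J B) =
    bern n p k' * (\prod_(i < k') q (A i)) * (pr (F J B) * pr (W n @^-1` C)).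
  move=> mC; have [B' mB' [FE PE]] := F_next nJ' mB mC.
  by rewrite -PE -IH// FE -setIA (setIC (W n @^-1` C)).
have mfalse : measurable ([set: D] `*` [set false]) by exact: measurableX.
have mtrue k' : measurable (A k' `*` [set true]) by exact: measurableX.
have mE k' C : measurable C -> measurable (case_event n k' A `&` W n @^-1` C `&` F J B).
  move=> mC; apply: measurableI; last exact: mF.
  apply: measurableI; first exact: measurable_case_event.
  exact: measurable_preimageT.
rewrite case_eventS setIUl; case: k => [|k] /=.
  by rewrite set0I setU0 step// pr_false; ring.
rewrite measureU; [|exact: mE|exact: mE|]; last first.
  apply/seteqP; split=> w //= -[[[_ [_ /= d1]] _] [[_ [_ /= d2]] _]].
  by rewrite d1 in d2.
have hf k' C : measurable C ->
    P (case_event n k' A `&` W n @^-1` C `&` F J B) \is a fin_num.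
  by move=> mC; apply: fin_num_measure; exact: mE.
rewrite (fineD (hf _ _ mfalse) (hf _ _ (mtrue k))).
rewrite !step// pr_false pr_true// big_ord_recr/=.
by ring.
Qed.

Lemma prob_case_event n k A : (forall i, measurable (A i)) ->
  pr (case_event n k A) = bern n p k * \prod_(i < k) q (A i).
Proof.
move=> mA; have := @pr_case_eventF n k A fset0 (fun=> setT) mA (fun=> measurableT).
have -> : F fset0 (fun=> setT) = setT by apply/seteqP; split.
by rewrite setIT probability_setT mulr1; apply => j; rewrite in_fset0.
Qed.

Lemma cases_prefix n n' w : (n <= n')%N ->
  exists s, cases n' w = cases n w ++ s.
Proof.
move=> /subnK <-; elim: (n' - n)%N => [|k [s IH]]; first by exists [::]; rewrite cats0.
rewrite addSn casesS IH; case: ifP => _; last by exists s.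
by exists (rcons s (W (k + n) w).1); rewrite rcons_cat.
Qed.

Definition kth_case k w : D :=
  nth x0 (cases (xget 0%N [set n | (k < size (cases n w))%N]) w) k.
Local Notation Z := kth_case.

Lemma nth_cases n k w : (k < size (cases n w))%N -> nth x0 (cases n w) k = Z k w.
Proof.
move=> kn; rewrite /Z; case: xgetP => [n' _ /= kn'|/(_ n)//].
have [nn'|/ltnW nn'] := leqP n n'.
  by have [s ->] := cases_prefix w nn'; rewrite nth_cat kn.
by have [s ->] := cases_prefix w nn'; rewrite nth_cat kn'.
Qed.

Lemma cases_kth n w : cases n w = [seq Z i w | i <- iota 0 (size (cases n w))].
Proof.
apply: (@eq_from_nth _ x0); first by rewrite size_map size_iota.
move=> i ik; rewrite nth_cases// (nth_map 0%N) ?size_iota// nth_iota//.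
Qed.

Lemma measurable_size_cases n k : measurable [set w | size (cases n w) = k].
Proof.
have := measurable_case_event n k (A := fun=> setT) (fun=> measurableT).
by congr measurable; apply/seteqP; split=> w [].
Qed.

Lemma measurable_kth_case k : measurable_fun setT (Z k).
Proof.
move=> _ A mA; rewrite setTI.
pose H n := \bigcup_l case_event n (k.+1 + l) (fun i => if i == k then A else setT).
have HE n w : H n w <-> (k < size (cases n w))%N /\ A (nth x0 (cases n w) k).
  split=> [[l _ [sz hA]]|[kn An]].
    have kl : (k < k.+1 + l)%N by rewrite addSn ltnS leq_addr.
    by split; [rewrite sz|have := hA k kl; rewrite eqxx].
  exists (size (cases n w) - k.+1)%N => //; split; first by rewrite subnKC.
  by move=> i _; case: eqP => [->|].
have -> : Z k @^-1` A = (\bigcup_n H n) `|`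
    ((if x0 \in A then setT else set0) `&` \bigcap_n \bigcup_(l in [set l | (l <= k)%N])
      [set w | size (cases n w) = l]).
  apply/seteqP; split=> w.
    move=> /= ZA; have [[n kn]|nex] := pselect (exists n, (k < size (cases n w))%N).
      by left; exists n => //; apply/HE; split; rewrite ?nth_cases.
    right; split.
      move: ZA; rewrite /Z; case: xgetP => [n' _ /= kn'|_]; first by case: nex; exists n'.
      by rewrite nth_nil => x0A; rewrite mem_set.
    by move=> n _; exists (size (cases n w)) => //=; rewrite leqNgt; apply/negP => kn; apply: nex; exists n.
  move=> [[n _ /HE[kn An]]|[x0A small]]; first by rewrite /= -(nth_cases kn).
  rewrite /= /Z; case: xgetP => [n' _ /= kn'|_].
    have [l /= lk sz] := small n' I; move: kn'; rewrite sz ltnNge lk//.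
  by rewrite nth_nil; case: ifPn x0A => //; rewrite inE.
apply: measurableU.
  apply: bigcup_measurable => n _; apply: bigcup_measurable => l _.
  by apply: measurable_case_event => i; case: ifP.
apply: measurableI; first by case: ifP.
apply: bigcap_measurable; first by exists 0%N.
move=> n _; apply: bigcup_measurable => l _; exact: measurable_size_cases.
Qed.

Let mbool : measurable_fun [set: bool] (fun b : bool => b%:R : R).
Proof. by []. Qed.

Let integrable_count : P.-integrable setT
  (EFin \o (fun w => (((W 0%N w).2)%:R - p) ^+ 2)).
Proof.
apply: (@integrable_bounded _ _ _ _ _ ((1 + `|p|) ^+ 2)).
  apply: measurable_funX; apply: measurable_funB => //.
  by apply: (measurableT_comp mbool); exact: measurableT_comp.
move=> w; rewrite normrX lerXn2r ?nnegrE ?addr_ge0// (le_trans (ler_normB _ _))// lerD2r.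
by case: (W 0%N w).2; rewrite ?normr1 ?normr0.
Qed.

Lemma measurable_count : measurable_fun setT (fun z : D * bool => (z.2)%:R - p).
Proof.
apply: measurable_funB => //.
exact: (measurableT_comp mbool).
Qed.

Let expectation_count : \int[P]_w (((W 0%N w).2)%:R - p) = 0.
Proof.
have mt : measurable (W 0%N @^-1` (setT `*` [set true])).
  by apply: measurable_preimageT => //; exact: measurableX.
have e w : ((W 0%N w).2)%:R - p = \1_(W 0%N @^-1` (setT `*` [set true])) w - p.
  congr (_ - _); rewrite indicE; case E : (W 0%N w).2.
    by rewrite mem_set//=; split.
  by rewrite memNset//= => -[_]; rewrite E.
under eq_Rintegral do rewrite e.
rewrite RintegralB//.
- rewrite Rintegral_indic// pr_true// probability_setT mulr1.
  by rewrite /Rintegral integral_cst//= probability_setT mule1 subrr.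
- have := integrable_indicM P 1 mt.
  by apply: eq_integrable => // w _ /=; rewrite mul1r.
- by apply: (@integrable_bounded _ _ _ _ _ `|p|).
Qed.

Lemma size_cases_dev n w : (size (cases n w))%:R - n%:R * p =
  \sum_(j < n) (((W j w).2)%:R - p) :> R.
Proof. by rewrite size_casesE sumrB sumr_const card_ord mulr_natl. Qed.

Lemma measurable_size_dev n :
  measurable_fun setT (fun w => (size (cases n w))%:R - n%:R * p : R).
Proof.
under eq_fun do rewrite size_cases_dev.
apply: measurable_sum => j; exact: (measurableT_comp measurable_count (mW j)).
Qed.

Lemma measurable_size_dev_gt n (c : R) :
  measurable [set w | c < `|(size (cases n w))%:R - n%:R * p|].
Proof.
have m1 : measurable_fun setT (fun w => `|(size (cases n w))%:R - n%:R * p| : R).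
  by apply: measurableT_comp => //; exact: measurable_size_dev.
have := measurable_preimageT m1 (measurable_itv `]c, +oo[).
by congr measurable; apply/seteqP; split=> w /=; rewrite in_itv/= andbT.
Qed.

Lemma weak_law_cases (e : R) : 0 < e ->
  pr [set w | e * n%:R < `|(size (cases n w))%:R - n%:R * p|] @[n --> \oo] --> (0 : R).
Proof.
move=> e0; pose v := \int[P]_w ((((W 0%N w).2)%:R - p) ^+ 2).
have h : v / e ^+ 2 * n%:R^-1 @[n --> \oo] --> (0 : R).
  rewrite -[X in _ --> X](mulr0 (v / e ^+ 2)); apply: cvgM; first exact: cvg_cst.
  exact: cvg_invn.
apply: (squeeze_cvgr _ (cvg_cst 0) h); exists 1%N => // n /= n0.
rewrite fine_prob_ge0/=.
have nn0 : 0 < n%:R :> R by rewrite ltr0n.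
have [i2 e2] := sum_second_moment mW indepW lawW measurable_count
  integrable_count expectation_count n.
have mX : measurable_fun setT (fun w => (\sum_(j < n) (((W j w).2)%:R - p)) ^+ 2).
  apply: measurable_funX; apply: measurable_sum => j.
  exact: (measurableT_comp measurable_count (mW j)).
have en : 0 < (e * n%:R) ^+ 2 by rewrite exprn_gt0// mulr_gt0.
have := markov_real mX i2 (fun w => sqr_ge0 _) en.
have key w : ((e * n%:R) ^+ 2 < (\sum_(j < n) (((W j w).2)%:R - p)) ^+ 2) =
    (e * n%:R < `|\sum_(j < n) (((W j w).2)%:R - p)|).
  rewrite -[X in _ < X]real_normK ?num_real//.
  by rewrite ltr_pXn2r ?nnegrE ?mulr_ge0 ?(ltW e0).
rewrite (_ : [set w | (e * n%:R) ^+ 2 < _] =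
  [set w | e * n%:R < `|(size (cases n w))%:R - n%:R * p|]); last first.
  by apply/seteqP; split=> w /=; rewrite size_cases_dev key.
move=> /le_trans; apply; rewrite e2 -/v le_eqVlt; apply/orP; left; apply/eqP.
by field; rewrite !gt_eqF.
Qed.

Lemma few_cases_cvg K :
  pr [set w | (size (cases n w) < K)%N] @[n --> \oo] --> (0 : R).
Proof.
have p20 : 0 < p / 2 by rewrite divr_gt0.
apply: (squeeze_cvgr _ (cvg_cst 0) (weak_law_cases p20)).
near=> n; rewrite fine_prob_ge0/=; apply: fine_prob_le.
- rewrite (_ : [set w | _] = \bigcup_(k in [set k | (k < K)%N]) [set w | size (cases n w) = k]).
    by apply: bigcup_measurable => k _; exact: measurable_size_cases.
  apply/seteqP; split=> w /=; first by move=> h; exists (size (cases n w)).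
  by move=> [k /= kK ->].
- exact: measurable_size_dev_gt.
move=> w /= sK.
have hK : K%:R < p / 2 * n%:R.
  rewrite mulrC -ltr_pdivrMr//; near: n; exact: nbhs_infty_gtr.
have sK' : (size (cases n w))%:R < K%:R :> R by rewrite ltr_nat.
by rewrite distrC (lt_le_trans _ (ler_norm _))//; lra.
Unshelve. all: end_near. Qed.

Lemma kth_case_prefix_law K A : (forall i, measurable (A i)) ->
  pr [set w | forall i, (i < K)%N -> A i (Z i w)] = \prod_(i < K) q (A i).
Proof.
move=> mA; set B := [set w | _].
have mB : measurable B.
  rewrite (_ : B = \bigcap_(i in [set i | (i < K)%N]) (Z i @^-1` A i)).
    apply: bigcap_measurableType => i _; apply: measurable_preimageT => //.
    exact: measurable_kth_case.
  by apply/seteqP; split.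
set G := \prod_(i < K) q (A i).
pose few n := [set w | (size (cases n w) < K)%N].
have mfew n : measurable (few n).
  rewrite (_ : few n = \bigcup_(k in [set k | (k < K)%N]) [set w | size (cases n w) = k]).
    by apply: bigcup_measurable => k _; exact: measurable_size_cases.
  apply/seteqP; split=> w /=; first by move=> h; exists (size (cases n w)).
  by move=> [k /= kK]; rewrite /few/= => ->.
have eqn n : pr (B `\` few n) = G * (1 - pr (few n)).
  have NK w : (size (cases n w) < n.+1)%N by rewrite ltnS size_cases_le.
  rewrite (prob_partition P NK (measurable_size_cases n)); last exact: measurableD.
  have -> : 1 - pr (few n) = pr (~` few n).
    by rewrite probability_setC// fineB ?fin_num_measure.
  rewrite (prob_partition P NK (measurable_size_cases n)); last exact: measurableC.
  rewrite mulr_sumr; apply: eq_bigr => k _.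
  have [kK|Kk] := ltnP k K.
    rewrite (_ : _ `&` _ = set0); last first.
      apply/seteqP; split=> w //= -[[_ nf] sk]; apply: nf.
      by rewrite /few/= sk.
    rewrite [X in _ = G * fine (P X)](_ : _ = set0) ?measure0 ?mulr0//.
    apply/seteqP; split=> w //= -[nf sk]; apply: nf.
    by rewrite /few/= sk.
  have -> : ~` few n `&` [set w | size (cases n w) = k] = case_event n k (fun=> setT).
    apply/seteqP; split=> w /=; first by move=> [].
    by move=> [sk _]; split => //; rewrite /few/= sk; apply/negP; rewrite -leqNgt.
  pose A' i := if (i < K)%N then A i else setT.
  have mA' i : measurable (A' i) by rewrite /A'; case: ifP.
  have -> : (B `\` few n) `&` [set w | size (cases n w) = k] = case_event n k A'.
    apply/seteqP; split=> w /=.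
      move=> [[Bw _] sk]; split => // i ik; rewrite /A'; case: ifP => // iK.
      by rewrite nth_cases ?sk//; exact: Bw.
    move=> [sk Aw]; split => //; split; last first.
      by rewrite /few/= sk; apply/negP; rewrite -leqNgt.
    move=> i iK; have ik : (i < k)%N by exact: leq_trans Kk.
    by have := Aw i ik; rewrite /A' iK nth_cases ?sk.
  rewrite !prob_case_event// [X in _ = G * (_ * X)]big1; last by move=> i _; rewrite probability_setT.
  rewrite mulr1 mulrC; congr (_ * _).
  rewrite /G (big_ord_widen _ (fun i => q (A i)) Kk) [RHS]big_mkcond; apply: eq_bigr => i _.
  by rewrite /A'; case: ifP => //; rewrite probability_setT.
have c1 : G * (1 - pr (few n)) @[n --> \oo] --> G.
  rewrite -[X in _ --> X]mulr1; apply: cvgM; first exact: cvg_cst.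
  rewrite -[X in _ --> X]subr0; apply: cvgB; first exact: cvg_cst.
  exact: few_cases_cvg.
have c2 : G * (1 - pr (few n)) @[n --> \oo] --> pr B.
  apply/subr_cvg0/norm_cvg0P.
  apply: (squeeze_cvgr _ (cvg_cst 0) (few_cases_cvg K)).
  apply: nearW => n; rewrite normr_ge0/= -eqn distrC.
  have PB : pr B = pr (B `\` few n) + pr (B `&` few n).
    rewrite -fineD ?fin_num_measure//; [|exact: measurableD|exact: measurableI].
    rewrite addeC -measureU//; [|exact: measurableI|exact: measurableD|].
      by rewrite setUIDK.
    by apply/seteqP; split=> w //= -[[_ ?] [_]].
  rewrite PB [X in `|X|](_ : _ = pr (B `&` few n)); last by ring.
  rewrite ger0_norm ?fine_prob_ge0//; apply: fine_prob_le.
  - exact: measurableI.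
  - exact: mfew.
  - by move=> w [].
exact: (cvg_unique _ c2 c1).
Qed.

End complete_case_sequence.

Lemma in_tuple_eq (D : Type) (C : Type) (f : forall k, k.-tuple D -> C) (s : seq D) k
    (t : k.-tuple D) : tval t = s -> f (size s) (in_tuple s) = f k t.
Proof.
case: t => s' sz /= <-; have /eqP e := sz.
by move: (sz); case: k / e {sz} => sz; congr f; exact: val_inj.
Qed.

Section oP_real.
Context d (Om : measurableType d) (R : realType) (P : probability Om R) (m : nat).

Lemma oP_fine (S : nat -> Om -> 'cV[R]_m) (r : nat -> R) :
  oP P S r -> forall e, 0 < e ->
  fine (P [set w | e * r n < enorm (S n w)]) @[n --> \oo] --> (0 : R).
Proof. by move=> h e e0; have /(_ eventually_filter) := fine_cvg (h e e0). Qed.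

Lemma fine_oP (S : nat -> Om -> 'cV[R]_m) (r : nat -> R) :
  (forall n, vmeasurable (S n)) ->
  (forall e, 0 < e ->
    fine (P [set w | e * r n < enorm (S n w)]) @[n --> \oo] --> (0 : R)) ->
  oP P S r.
Proof.
move=> mS h e e0; have := h e e0.
under [in X in _ -> X]eq_fun => n.
  rewrite -[P _]fineK; last by apply: fin_num_measure; exact: measurable_enorm_gt.
  over.
by move=> hh; apply: cvg_EFin => //; exact: nearW.
Qed.

End oP_real.

Section conditional_law.
Context d (Om : measurableType d) (R : realType) (P : probability Om R).
Context d' (D : measurableType d') (W0 : Om -> D * bool).
Variables (p : R) (Qt : probability D R).
Hypothesis mW : measurable_fun setT W0.
Hypothesis lawQt : forall A, measurable A ->
  fine (P (W0 @^-1` (A `*` [set true]))) = p * fine (Qt A).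
Hypothesis p0 : 0 < p.

Let E := W0 @^-1` (setT `*` [set true]).

Let mE : measurable E.
Proof. by apply: measurable_preimageT => //; exact: measurableX. Qed.

Let mfst : measurable_fun setT (fun w => (W0 w).1).
Proof. exact: measurableT_comp. Qed.

Let mbool : measurable_fun [set: bool] (fun b : bool => b%:R : R).
Proof. by []. Qed.

Let pn : {nonneg R} := NngNum (ltW p0).

Let ge0_integral_case (g : D -> \bar R) : measurable_fun setT g ->
  (forall x, 0 <= g x)%E ->
  (\int[P]_w (((W0 w).2)%:R%:E * g (W0 w).1) = p%:E * \int[Qt]_x g x)%E.
Proof.
move=> mg g0.
pose Dt : set (D * bool) := setT `*` [set true].
have mDt : measurable Dt by exact: measurableX.
have mpair : measurable_fun [set: D] (fun x => (x, true)).
  by apply/measurable_fun_pair.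
pose nu := image_measure P mW.
pose ka := image_measure (mscale pn Qt) mpair.
have mg1 : measurable_fun Dt (fun z : D * bool => g z.1).
  by apply: measurable_funTS; exact: measurableT_comp.
have eq_nu A : measurable A -> A `<=` Dt -> nu A = ka A.
  move=> mA ADt; rewrite /nu /ka /= /pushforward /mscale/=.
  have mA1 : measurable ((fun x => (x, true)) @^-1` A) by exact: measurable_preimageT.
  have -> : W0 @^-1` A = W0 @^-1` (((fun x => (x, true)) @^-1` A) `*` [set true]).
    apply/seteqP; split=> w /=.
      by move=> Aw; have [_ /= e] := ADt _ Aw; split=> //; move: Aw; rewrite -e -surjective_pairing.
    by case: (W0 w) => x b /= [Ax ->].
  have mB : measurable (W0 @^-1` (((fun x => (x, true)) @^-1` A) `*` [set true])).
    by apply: measurable_preimageT => //; exact: measurableX.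
  rewrite -(fineK (fin_num_measure P _ mB)) lawQt// EFinM fineK//.
  exact: fin_num_measure.
transitivity (\int[P]_(w in E) g (W0 w).1)%E.
  rewrite [RHS]integral_mkcond; apply: eq_integral => w _; rewrite patchE.
  case: ifPn => [|]; first by rewrite inE => -[_ /= ->]; rewrite mul1e.
  rewrite notin_setE => nE; case e : (W0 w).2; last by rewrite mul0e.
  by case: nE; split.
have h1 := @ge0_integral_pushforward _ _ _ _ R W0 mW P Dt (fun z => g z.1) mDt mg1
  (fun z _ => g0 z.1).
have h2 := @ge0_integral_pushforward _ _ _ _ R _ mpair (mscale pn Qt) Dt (fun z => g z.1)
  mDt mg1 (fun z _ => g0 z.1).
have -> : (\int[P]_(w in E) g (W0 w).1 = \int[nu]_(z in Dt) g z.1)%E by rewrite h1.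
rewrite (eq_measure_integral ka) => [|A mA ADt]; last exact: eq_nu.
transitivity (\int[mscale pn Qt]_(x in (fun x => (x, true)) @^-1` Dt) g x)%E; first exact: h2.
have -> : (fun x => (x, true)) @^-1` Dt = [set: D] by apply/seteqP; split.
exact: (@ge0_integral_mscale _ _ _ Qt setT measurableT pn g mg (fun x _ => g0 x)).
Qed.

Lemma integrable_case (g : D -> R) : measurable_fun setT g ->
  Qt.-integrable setT (EFin \o g) ->
  P.-integrable setT (EFin \o (fun w => ((W0 w).2)%:R * g (W0 w).1)).
Proof.
move=> mg ig; apply/integrableP; split.
  apply/measurable_EFinP; apply: measurable_funM; last exact: measurableT_comp.
  by apply: (measurableT_comp mbool); exact: measurableT_comp.
under eq_integral => w _ do rewrite /= normrM ger0_norm// EFinM.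
rewrite (ge0_integral_case (g := fun x => `|g x|%:E))//; last first.
  by apply/measurable_EFinP; exact: measurableT_comp.
rewrite lte_mul_pinfty// ?lee_fin ?(ltW p0)//.
by have /integrableP[] := ig.
Qed.

Lemma Rintegral_case (g : D -> R) : measurable_fun setT g ->
  Qt.-integrable setT (EFin \o g) ->
  \int[P]_w (((W0 w).2)%:R * g (W0 w).1) = p * \int[Qt]_x g x.
Proof.
move=> mg ig.
have mp : measurable_fun setT (fun x => Num.max (g x) 0) by exact: measurable_maxr.
have mn : measurable_fun setT (fun x => Num.max (- g x) 0).
  by apply: measurable_maxr => //; exact: measurableT_comp.
have part (h : D -> R) : measurable_fun setT h -> (forall x, 0 <= h x) ->
    (forall x, h x <= `|g x|) ->
    [/\ Qt.-integrable setT (EFin \o h),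
        P.-integrable setT (EFin \o (fun w => ((W0 w).2)%:R * h (W0 w).1)) &
        \int[P]_w (((W0 w).2)%:R * h (W0 w).1) = p * \int[Qt]_x h x].
  move=> mh h0 hg.
  have ih : Qt.-integrable setT (EFin \o h).
    apply: le_integrable ig => //; first exact/measurable_EFinP.
    by move=> x _; rewrite lee_fin ger0_norm.
  split => //; first exact: integrable_case.
  rewrite /Rintegral -[p]/(fine p%:E) -fineM//; last exact: integrable_fin_num.
  rewrite -(ge0_integral_case (g := EFin \o h))//.
  exact/measurable_EFinP.
have mp0 x : 0 <= Num.max (g x) 0 by rewrite le_max lexx orbT.
have mn0 x : 0 <= Num.max (- g x) 0 by rewrite le_max lexx orbT.
have mp1 x : Num.max (g x) 0 <= `|g x| by rewrite ge_max ler_norm normr_ge0.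
have mn1 x : Num.max (- g x) 0 <= `|g x| by rewrite ge_max -normrN ler_norm normr_ge0.
have [iP iPP eP] := part _ mp mp0 mp1.
have [iN iPN eN] := part _ mn mn0 mn1.
have gE x : g x = Num.max (g x) 0 - Num.max (- g x) 0.
  case: (boolP (0 <= g x)) => [g0|]; last rewrite -ltNge => /ltW g0.
    by rewrite max_l// max_r ?subr0// oppr_le0.
  by rewrite max_r// max_l ?sub0r ?opprK// oppr_ge0.
under eq_Rintegral do rewrite gE mulrBr.
under [in RHS]eq_Rintegral do rewrite gE.
by rewrite !RintegralB// eP eN mulrBr.
Qed.

End conditional_law.

Section complete_case_expansion.
Context d (Om : measurableType d) (R : realType) (P : probability Om R).
Context d' (D : measurableType d').
Variables (W : nat -> Om -> D * bool) (x0 : D) (p : R) (Qt : probability D R).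
Hypothesis mW : forall j, measurable_fun setT (W j).
Hypothesis indepW : independent_seq P W.
Hypothesis lawW : forall j A, measurable A -> P (W j @^-1` A) = P (W 0%N @^-1` A).
Hypothesis lawQt : forall A, measurable A ->
  fine (P (W 0%N @^-1` (A `*` [set true]))) = p * fine (Qt A).
Hypothesis p0 : 0 < p.

Local Notation pr B := (fine (P B)).
Local Notation q A := (fine (Qt A)).
Local Notation N n w := (size (cases W n w)).
Local Notation Z := (kth_case W x0).

Let mZ k : measurable_fun setT (Z k).
Proof. exact: measurable_kth_case. Qed.

Let mN n k : measurable [set w | N n w = k].
Proof. exact: measurable_size_cases. Qed.

Lemma kth_case_iid : iid P Z Qt.
Proof.
have q1 : q setT = 1 by rewrite probability_setT.
split.
  move=> J A mA; pose K := (\max_(j <- J) j).+1.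
  have JK j : j \in J -> (j < K)%N.
    by move=> jJ; rewrite ltnS (bigD1_seq j)//= leq_maxl.
  pose A' j := if j \in J then A j else setT.
  have mA' j : measurable (A' j) by rewrite /A'; case: ifP.
  have marg j : pr (Z j @^-1` A j) = q (A j).
    pose B i := if i == j then A j else setT.
    have mB i : measurable (B i) by rewrite /B; case: ifP.
    rewrite (_ : Z j @^-1` A j = [set w | forall i, (i < j.+1)%N -> B i (Z i w)]).
      rewrite (kth_case_prefix_law x0 mW indepW lawW lawQt p0 j.+1 mB).
      rewrite big_ord_recr/= big1 => [|i _]; first by rewrite mul1r /B eqxx.
      by rewrite /B ltn_eqF.
    apply/seteqP; split=> w /=.
      by move=> Aw i _; rewrite /B; case: eqP => [->|].
    by move=> /(_ j (ltnSn j)); rewrite /B eqxx.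
  have mpre j : measurable (Z j @^-1` A j) by exact: measurable_preimageT.
  have -> : \bigcap_(j in [set` J]) (Z j @^-1` A j) =
      [set w | forall i, (i < K)%N -> A' i (Z i w)].
    apply/seteqP; split=> w /=.
      by move=> h i _; rewrite /A'; case: ifP => // iJ; exact: h.
    by move=> h j /= jJ; have := h j (JK j jJ); rewrite /A' jJ.
  have mset : measurable [set w | forall i, (i < K)%N -> A' i (Z i w)].
    rewrite (_ : [set w | _] = \bigcap_(i in [set i | (i < K)%N]) (Z i @^-1` A' i)).
      by apply: bigcap_measurableType => i _; exact: measurable_preimageT.
    by apply/seteqP; split.
  rewrite -[LHS]fineK ?fin_num_measure//.
  rewrite (kth_case_prefix_law x0 mW indepW lawW lawQt p0 K mA').
  rewrite (eq_bigr (fun j => (pr (Z j @^-1` A j))%:E)); last first.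
    by move=> j _; rewrite fineK// fin_num_measure.
  rewrite prodEFin; congr EFin.
  rewrite -(big_mkord xpredT (fun i => q (A' i))).
  rewrite (bigID (fun i => i \in J))/= [X in _ * X]big1 ?mulr1; last first.
    by move=> i iJ; rewrite /A' (negbTE iJ).
  rewrite -big_filter.
  rewrite (perm_big (enum_fset J)); last first.
    apply: uniq_perm; [exact: filter_uniq (iota_uniq _ _)|exact: fset_uniq|].
    move=> i; rewrite mem_filter mem_index_iota /= andb_idr//; exact: JK.
  by apply: eq_big_seq => j jJ; rewrite marg /A' jJ.
move=> j A mA.
pose B i := if i == j then A else setT.
have mB i : measurable (B i) by rewrite /B; case: ifP.
have mpre : measurable (Z j @^-1` A) by exact: measurable_preimageT.
rewrite -[LHS]fineK ?fin_num_measure// -[RHS]fineK ?fin_num_measure//; congr EFin.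
rewrite (_ : Z j @^-1` A = [set w | forall i, (i < j.+1)%N -> B i (Z i w)]).
  rewrite (kth_case_prefix_law x0 mW indepW lawW lawQt p0 j.+1 mB).
  rewrite big_ord_recr/= big1 => [|i _]; first by rewrite mul1r /B eqxx.
  by rewrite /B ltn_eqF.
apply/seteqP; split=> w /=.
  by move=> Aw i _; rewrite /B; case: eqP => [->|].
by move=> /(_ j (ltnSn j)); rewrite /B eqxx.
Qed.

Let mtup k : measurable_fun setT (fun w => [tuple Z i w | i < k]).
Proof. exact: measurable_tuple_of. Qed.

Lemma prob_size_tuple n k (B : set (k.-tuple D)) : measurable B ->
  pr ([set w | N n w = k] `&` (fun w => [tuple Z i w | i < k]) @^-1` B) =
  pr [set w | N n w = k] * pr ((fun w => [tuple Z i w | i < k]) @^-1` B).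
Proof.
move=> mB.
pose m1 := image_measure (mrestr P (mN n k)) (@mtup k).
pose c : {nonneg R} := NngNum (fine_prob_ge0 P [set w | N n w = k]).
pose m2 : {measure set (k.-tuple D) -> \bar R} := mscale c (image_measure P (@mtup k)).
have m1E X : m1 X = P ((fun w => [tuple Z i w | i < k]) @^-1` X `&` [set w | N n w = k]) by [].
have m2E X : m2 X = ((pr [set w | N n w = k])%:E * P ((fun w => [tuple Z i w | i < k]) @^-1` X))%E by [].
have mpre X : measurable X -> measurable ((fun w => [tuple Z i w | i < k]) @^-1` X).
  by move=> mX; exact: (measurable_preimageT (@mtup k) mX).
have : m1 B = m2 B.
  apply: tuple_measure_unique => //.
    rewrite m1E (le_lt_trans (probability_le1 _ _)) ?ltry//.
    by apply: measurableI; [exact: mpre|exact: mN].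
  move=> A mA; have mR := measurable_tuple_rect (n := k) mA.
  rewrite m1E m2E.
  have mI : measurable ((fun w => [tuple Z i w | i < k]) @^-1` tuple_rect k A `&` [set w | N n w = k]).
    by apply: measurableI; [exact: mpre|exact: mN].
  rewrite -[LHS]fineK ?fin_num_measure//.
  rewrite -[X in _ = (_ * X)%E]fineK; last by apply: fin_num_measure; exact: mpre.
  rewrite -EFinM; congr EFin.
  have -> : (fun w => [tuple Z i w | i < k]) @^-1` tuple_rect k A =
      [set w | forall i, (i < k)%N -> A i (Z i w)].
    apply/seteqP; split=> w /=.
      by move=> h i ik; have := h (Ordinal ik); rewrite tnth_mktuple.
    by move=> h i; rewrite tnth_mktuple; exact: h.
  rewrite (kth_case_prefix_law x0 mW indepW lawW lawQt p0 k mA).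
  have -> : [set w | N n w = k] = case_event W x0 n k (fun=> setT).
    by apply/seteqP; split=> w; [split|case].
  have -> : [set w | forall i, (i < k)%N -> A i (Z i w)] `&` case_event W x0 n k (fun=> setT) =
      case_event W x0 n k A.
    apply/seteqP; split=> w /=.
      move=> [h [sk _]]; split => // i ik; rewrite nth_cases ?sk//; exact: h.
    move=> [sk h]; split; last by split.
    by move=> i ik; have := h i ik; rewrite nth_cases ?sk.
  rewrite !(prob_case_event x0 mW indepW lawW lawQt)//.
  by rewrite [X in _ = _ * X * _]big1 ?mulr1// => i _; rewrite probability_setT.
rewrite m1E m2E setIC => ->.
by rewrite fineM// fin_num_measure//; exact: mpre.
Qed.

Lemma cases_tuple n k w : N n w = k -> tval [tuple Z i w | i < k] = cases W n w.
Proof.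
move=> <-; rewrite [RHS](cases_kth W x0) -val_enum_ord -map_comp.
by rewrite [LHS]/=; apply: eq_map.
Qed.

Definition bad_cases (bad : forall k, k.-tuple D -> Prop) n : set Om :=
  [set w | (0 < N n w)%N /\ bad _ (in_tuple (cases W n w))].

Section random_index.
Variable bad : forall k, k.-tuple D -> Prop.
Arguments bad {k}.
Hypothesis mbad : forall k, (0 < k)%N -> measurable [set t : k.-tuple D | bad t].

Let bad_casesE n k : (0 < k)%N ->
  bad_cases (@bad) n `&` [set w | N n w = k] =
  [set w | N n w = k] `&` (fun w => [tuple Z i w | i < k]) @^-1` [set t | bad t].
Proof.
move=> k0; apply/seteqP; split=> w /=.
  move=> [[_ hb] sk]; split => //.
  by rewrite -(in_tuple_eq (@bad) (cases_tuple sk)).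
move=> [sk hb]; split => //; split; first by rewrite sk.
by rewrite (in_tuple_eq (@bad) (cases_tuple sk)).
Qed.

Lemma measurable_bad_cases n : measurable (bad_cases (@bad) n).
Proof.
rewrite (_ : bad_cases _ n = \bigcup_(k in [set k | (0 < k)%N])
  (bad_cases (@bad) n `&` [set w | N n w = k])).
  apply: bigcup_measurable => k k0; rewrite bad_casesE//.
  apply: measurableI; first exact: mN.
  exact: (measurable_preimageT (@mtup k) (mbad k0)).
apply/seteqP; split=> w; last by move=> [k _ []].
by move=> Bw; exists (N n w) => //; case: Bw.
Qed.

Lemma bad_cases_cvg :
  pr ((fun w => [tuple Z i w | i < k]) @^-1` [set t | bad t]) @[k --> \oo] --> (0 : R) ->
  pr (bad_cases (@bad) n) @[n --> \oo] --> (0 : R).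
Proof.
move=> cb; apply/cvgrPdist_le => e e0.
have e20 : 0 < e / 2 by rewrite divr_gt0.
have /cvgrPdist_le/(_ _ e20)[K _ hK] := cb.
have /cvgrPdist_le/(_ _ e20) hfew := few_cases_cvg x0 mW indepW lawW lawQt p0 K.
near=> n.
have mfew : measurable [set w | (N n w < K)%N].
  rewrite (_ : [set w | _] = \bigcup_(k in [set k | (k < K)%N]) [set w | N n w = k]).
    by apply: bigcup_measurable => k _; exact: mN.
  apply/seteqP; split=> w /=; first by move=> h; exists (N n w).
  by move=> [k /= kK ->].
have NK w : (N n w < n.+1)%N by rewrite ltnS size_cases_le.
have few : pr [set w | (N n w < K)%N] <= e / 2.
  have : `|0 - pr [set w | (N n w < K)%N]| <= e / 2 by near: n.
  by rewrite sub0r normrN ger0_norm ?fine_prob_ge0.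
rewrite sub0r normrN ger0_norm ?fine_prob_ge0//.
rewrite (prob_partition P NK (mN n)); last exact: measurable_bad_cases.
apply: le_trans (_ : \sum_(k < n.+1) (e / 2 * pr (setT `&` [set w | N n w = k]) +
  pr ([set w | (N n w < K)%N] `&` [set w | N n w = k])) <= _); last first.
  rewrite big_split/= -mulr_sumr.
  rewrite -(prob_partition P NK (mN n) measurableT) -(prob_partition P NK (mN n) mfew).
  by rewrite probability_setT mulr1; lra.
apply: ler_sum => k _; rewrite setTI.
have [kK|Kk] := ltnP k K.
  apply: le_trans (_ : pr ([set w | (N n w < K)%N] `&` [set w | N n w = k]) <= _); last first.
    by rewrite lerDr mulr_ge0 ?fine_prob_ge0 ?ltW.
  apply: fine_prob_le.
  - by apply: measurableI; [exact: measurable_bad_cases|exact: mN].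
  - by apply: measurableI => //; exact: mN.
  - by move=> w /= [_ sk]; split => //; rewrite sk.
have [k0|k0] := posnP k.
  rewrite (_ : bad_cases _ n `&` _ = set0).
    by rewrite measure0/= addr_ge0 ?mulr_ge0 ?fine_prob_ge0 ?ltW.
  by apply/seteqP; split=> w //= -[[Nw _] sk]; rewrite sk k0 in Nw.
rewrite bad_casesE// prob_size_tuple; last exact: mbad.
rewrite ler_wpDr ?fine_prob_ge0// mulrC ler_wpM2r ?fine_prob_ge0//.
have := hK k Kk; rewrite /= sub0r normrN ger0_norm ?fine_prob_ge0//.
Unshelve. all: end_near. Qed.

End random_index.

End complete_case_expansion.

(** * Transfer principle *)

Section centered_square_integrable_theory.
Context d (Om : measurableType d) (R : realType) (P : probability Om R) (m : nat).
Implicit Type f : Om -> 'cV[R]_m.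

Lemma integrable_enorm_sqr f : vmeasurable f ->
  (forall i, P.-integrable setT (EFin \o (fun w => f w i 0 ^+ 2))) ->
  P.-integrable setT (EFin \o (fun w => enorm (f w) ^+ 2)).
Proof.
move=> mf if2; under eq_fun do rewrite sqr_enorm.
exact: integrable_sumR.
Qed.

Lemma centered_square_integrableP f : centered_square_integrable P f <->
  [/\ vmeasurable f,
      forall i, P.-integrable setT (EFin \o (fun w => f w i 0 ^+ 2)) &
      forall i, \int[P]_w f w i 0 = 0].
Proof.
split=> -[mf h1 h2]; split => //.
- move=> i; apply: (@le_integrable _ _ _ P _ measurableT _ (EFin \o (fun w => enorm (f w) ^+ 2))).
  + by apply/measurable_EFinP; apply: measurable_funX; exact: mf.
  + move=> w _; rewrite lee_fin !ger0_norm ?sqr_ge0//.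
    by rewrite -real_normK ?num_real// lerXn2r ?nnegrE ?enorm_ge0// le_entry_enorm.
  apply/integrableP; split.
    by apply/measurable_EFinP; apply: measurable_funX; exact: measurable_enorm.
  move: h2; rewrite unlock; apply: le_lt_trans.
  by rewrite le_eqVlt; apply/orP; left; apply/eqP; apply: eq_integral => w _ /=; rewrite ger0_norm// sqr_ge0.
- by move=> i; have := h1 i; rewrite unlock /Rintegral => ->.
- move=> i; rewrite unlock.
  have ifi := square_integrable_integrable (mf i) (h1 i).
  rewrite -[LHS]fineK; last exact: integrable_fin_num.
  by rewrite -[fine _]/(\int[P]_w f w i 0) h2.
- rewrite unlock.
  have /integrableP[_] := integrable_enorm_sqr mf h1.
  by apply: le_lt_trans; apply: ge0_le_integral => //=;
    [move=> w _; rewrite lee_fin sqr_ge0|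
     apply/measurable_EFinP; apply: measurable_funX; exact: measurable_enorm|
     apply/measurable_EFinP; apply: measurableT_comp => //; apply: measurable_funX; exact: measurable_enorm|
     move=> w _; rewrite lee_fin ler_norm].
Qed.

End centered_square_integrable_theory.

Section weighted_influence.
Context d (Om : measurableType d) (R : realType) (P : probability Om R).
Context d' (D : measurableType d') (W0 : Om -> D * bool) (m : nat).
Variables (p : R) (Qt : probability D R) (psi : D -> 'cV[R]_m).
Hypothesis mW : measurable_fun setT W0.
Hypothesis lawQt : forall A, measurable A ->
  fine (P (W0 @^-1` (A `*` [set true]))) = p * fine (Qt A).
Hypothesis p0 : 0 < p.
Hypothesis csi : centered_square_integrable Qt psi.

Definition weighted_influence (z : D * bool) : 'cV[R]_m := (z.2%:R / p) *: psi z.1.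
Local Notation phi := weighted_influence.

Let mbool : measurable_fun [set: bool] (fun b : bool => b%:R : R).
Proof. by []. Qed.

Lemma vmeasurable_weighted_influence : vmeasurable phi.
Proof.
have [mpsi _ _] := csi.
apply: vmeasurableZ; last by move=> i; exact: measurableT_comp (mpsi i) _.
by apply: measurable_funM => //; exact: (measurableT_comp mbool).
Qed.

Let prodE z i j : phi z i 0 * phi z j 0 =
  z.2%:R * (p ^- 2 * (psi z.1 i 0 * psi z.1 j 0)).
Proof.
rewrite /phi !mxE; case: z => x [] /=; last by rewrite !mul0r.
by rewrite !mul1r; field; rewrite gt_eqF.
Qed.

Let mprod i j : measurable_fun setT (fun x => p ^- 2 * (psi x i 0 * psi x j 0)).
Proof.
have [mpsi _ _] := csi.
by apply: measurable_funM => //; apply: measurable_funM; exact: mpsi.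
Qed.

Let ipsi_mul i j : Qt.-integrable setT (EFin \o (fun x => psi x i 0 * psi x j 0)).
Proof.
have /centered_square_integrableP[mpsi ipsi _] := csi.
exact: (integrable_mul_sqr (mpsi i) (mpsi j) (ipsi i) (ipsi j)).
Qed.

Let iprod i j : Qt.-integrable setT (EFin \o (fun x => p ^- 2 * (psi x i 0 * psi x j 0))).
Proof. exact: (integrableZl measurableT _ (ipsi_mul i j)). Qed.

Lemma integrable_weighted_influence_sqr i :
  P.-integrable setT (EFin \o (fun w => phi (W0 w) i 0 ^+ 2)).
Proof.
under eq_fun do rewrite expr2 prodE.
exact: (integrable_case mW lawQt p0 (mprod i i) (iprod i i)).
Qed.

Lemma Rintegral_weighted_influence i : \int[P]_w phi (W0 w) i 0 = 0.
Proof.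
have /centered_square_integrableP[mpsi ipsi Epsi] := csi.
have ipsi1 := square_integrable_integrable (mpsi i) (ipsi i).
have e w : phi (W0 w) i 0 = (W0 w).2%:R * (p^-1 * psi (W0 w).1 i 0).
  by rewrite /phi mxE mulrA.
under eq_Rintegral do rewrite e.
have mg : measurable_fun setT (fun x => p^-1 * psi x i 0).
  by apply: measurable_funM => //; exact: mpsi.
rewrite (Rintegral_case mW lawQt p0 mg); last exact: (integrableZl measurableT _ ipsi1).
by rewrite RintegralZl// Epsi !mulr0.
Qed.

Lemma centered_weighted_influence : centered_square_integrable P (fun w => phi (W0 w)).
Proof.
apply/centered_square_integrableP; split.
- by move=> i; exact: measurableT_comp (vmeasurable_weighted_influence i) mW.
- exact: integrable_weighted_influence_sqr.
- exact: Rintegral_weighted_influence.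
Qed.

Lemma second_moment_weighted_influence (W : nat -> Om -> D * bool) : W 0%N = W0 ->
  second_moment_mx P W phi = p^-1 *: dispersion Qt psi.
Proof.
move=> WW0; apply/matrixP => i j; rewrite !mxE WW0.
under eq_Rintegral do rewrite prodE.
rewrite (Rintegral_case mW lawQt p0 (mprod i j) (iprod i j)) RintegralZl// mulrA.
rewrite (_ : p * p ^- 2 = p^-1); last by field; rewrite gt_eqF.
rewrite unlock /Rintegral; congr (_ * fine _); apply: eq_integral => x _.
by rewrite mxE big_ord1 !mxE.
Qed.

End weighted_influence.

Section complete_case_linear_expansion.
Context d (Om : measurableType d) (R : realType) (P : probability Om R).
Context d' (D : measurableType d').
Variables (W : nat -> Om -> D * bool) (x0 : D) (p : R) (Qt : probability D R).
Hypothesis mW : forall j, measurable_fun setT (W j).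
Hypothesis indepW : independent_seq P W.
Hypothesis lawW : forall j A, measurable A -> P (W j @^-1` A) = P (W 0%N @^-1` A).
Hypothesis lawQt : forall A, measurable A ->
  fine (P (W 0%N @^-1` (A `*` [set true]))) = p * fine (Qt A).
Hypothesis p0 : 0 < p.
Variables (m : nat) (psi : D -> 'cV[R]_m) (t : forall k, k.-tuple D -> 'cV[R]_m).
Arguments t {k}.
Variables (theta c : 'cV[R]_m).
Hypothesis csi : centered_square_integrable Qt psi.
Hypothesis mt : forall k, (0 < k)%N -> vmeasurable (@t k).
Hypothesis lin : linear_expansion P
  (fun k w => t [tuple kth_case W x0 i w | i < k]) theta
  (fun j w => psi (kth_case W x0 j w)).

Local Notation pr B := (fine (P B)).
Local Notation N n w := (size (cases W n w)).
Local Notation Z := (kth_case W x0).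
Local Notation phi := (weighted_influence p psi).

Definition case_statistic n w : 'cV[R]_m :=
  if N n w == 0%N then c else t (in_tuple (cases W n w)).

Definition case_remainder n w : 'cV[R]_m :=
  case_statistic n w - (theta + n%:R^-1 *: \sum_(j < n) phi (W j w)).

Let rem k (s : k.-tuple D) : 'cV[R]_m :=
  t s - (theta + k%:R^-1 *: \sum_(i < k) psi (tnth s i)).

Let mphi : vmeasurable phi.
Proof. exact: vmeasurable_weighted_influence csi. Qed.

Lemma vmeasurable_case_statistic n : vmeasurable (case_statistic n).
Proof.
move=> i _ A mA; rewrite setTI.
pose B k := [set w | N n w = k] `&`
  (if k == 0%N then (if c i 0 \in A then setT else set0)
   else (fun w => [tuple Z i w | i < k]) @^-1` ((fun s : k.-tuple D => t s i 0) @^-1` A)).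
rewrite (_ : _ @^-1` A = \bigcup_k B k).
  apply: bigcup_measurable => k _; apply: measurableI.
    exact: measurable_size_cases.
  case: eqP => [_|/eqP k0]; first by case: ifP.
  apply: measurable_preimageT; first by apply: measurable_tuple_of => j; exact: measurable_kth_case.
  by apply: measurable_preimageT => //; apply: mt; rewrite lt0n.
apply/seteqP; split=> w.
  rewrite /= /case_statistic => Aw; exists (N n w) => //; split => //.
  case: eqP Aw => [_|_] Aw; first by rewrite mem_set.
  by rewrite /= -(in_tuple_eq (@t) (cases_tuple x0 (erefl (N n w)))).
move=> [k _ [/= sk]]; have e0 : (N n w == 0%N) = (k == 0%N) by rewrite sk.
rewrite /case_statistic e0.
case: eqP => [_|_]; first by case: ifPn => //; rewrite inE.
by rewrite /= (in_tuple_eq (@t) (cases_tuple x0 sk)).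
Qed.

Lemma vmeasurable_case_remainder n : vmeasurable (case_remainder n).
Proof.
apply: vmeasurableB; first exact: vmeasurable_case_statistic.
apply: vmeasurableD; first exact: vmeasurable_cst.
apply: vmeasurableZ; first exact: measurable_cst.
apply: (@vmeasurable_sum _ _ _ _ n (fun j w => phi (W j w))) => j i.
exact: measurableT_comp (mphi i) (mW j).
Qed.

Let sum_psi_cases n w :
  \sum_(i < N n w) psi (tnth (in_tuple (cases W n w)) i) =
  p *: \sum_(j < n) phi (W j w).
Proof.
rewrite -(big_tnth _ _ (cases W n w) xpredT psi) /cases big_map big_filter.
rewrite -(big_mkord xpredT (fun j => phi (W j w))) /index_iota subn0 big_mkcond scaler_sumr.
apply: eq_bigr => j _; rewrite /phi scalerA.
by case: (W j w).2; rewrite ?mul0r ?mulr0 ?scale0r// mul1r divff ?scale1r// gt_eqF.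
Qed.

Let case_remainderE n w : (0 < N n w)%N ->
  case_remainder n w = rem (in_tuple (cases W n w)) +
    ((p / (N n w)%:R - n%:R^-1) * Num.sqrt n%:R) *: normalized_sum W phi n w.
Proof.
move=> N0; rewrite /case_remainder /case_statistic /rem gtn_eqF//= sum_psi_cases.
have n0 : (0 < n)%N by exact: leq_trans N0 (size_cases_le W n w).
rewrite /normalized_sum !scalerA mulfK ?gt_eqF ?sqrtr_gt0 ?ltr0n//.
rewrite scalerBl (mulrC p) addrA -!addrA; congr (_ + _).
by rewrite !opprD !addrA -!addrA; congr (_ + _); rewrite addrA addNr add0r.
Qed.

Let enorm_case_remainder n w (e1 eta L : R) : (0 < n)%N ->
  0 <= e1 -> 0 <= eta -> eta <= p / 2 ->
  `|(N n w)%:R - n%:R * p| <= eta * n%:R ->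
  enorm (rem (in_tuple (cases W n w))) <= e1 * (Num.sqrt (N n w)%:R)^-1 ->
  enorm (normalized_sum W phi n w) <= L ->
  (0 < N n w)%N /\
  enorm (case_remainder n w) <=
    m%:R * (e1 * (Num.sqrt (p / 2))^-1 + 2 * eta / p * L) * (Num.sqrt n%:R)^-1.
Proof.
move=> n0 e10 eta0 etap dev hrem hL.
have nn0 : 0 < n%:R :> R by rewrite ltr0n.
have sn0 : 0 < Num.sqrt n%:R :> R by rewrite sqrtr_gt0.
have Nlow : p / 2 * n%:R <= (N n w)%:R.
  have : eta * n%:R <= p / 2 * n%:R by rewrite ler_wpM2r// ltW.
  by move: dev; rewrite ler_norml => /andP[]; lra.
have NN0 : 0 < (N n w)%:R :> R by apply: lt_le_trans Nlow; rewrite mulr_gt0// divr_gt0.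
have N0 : (0 < N n w)%N by rewrite -(ltr0n R).
split => //; rewrite case_remainderE// (le_trans (enormD_le _ _))// -mulrA.
rewrite ler_wpM2l// [leRHS]mulrDl lerD//.
  apply: le_trans hrem _; rewrite -mulrA ler_wpM2l// -invfM -sqrtrM ?divr_ge0 ?(ltW p0)//.
  by rewrite lef_pV2 ?posrE ?sqrtr_gt0 ?mulr_gt0 ?divr_gt0// ler_wsqrtr.
rewrite enormZ mulrAC; apply: ler_pM; rewrite ?enorm_ge0//.
rewrite normrM (ger0_norm (ltW sn0)) -ler_pdivlMr//.
rewrite (_ : _ / _ / _ = 2 * eta / p / n%:R); last by rewrite -sqr_inv_sqrtn expr2 mulrA.
have -> : p / (N n w)%:R - n%:R^-1 = - ((N n w)%:R - n%:R * p) / ((N n w)%:R * n%:R).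
  by field; rewrite !gt_eqF.
rewrite normrM normrN normfV (ger0_norm (mulr_ge0 (ltW NN0) (ltW nn0))).
rewrite ler_pdivrMr ?mulr_gt0// (le_trans dev)//.
have -> : 2 * eta / p / n%:R * ((N n w)%:R * n%:R) = eta * ((N n w)%:R / (p / 2)).
  by field; rewrite !gt_eqF.
by rewrite ler_wpM2l// ler_pdivlMr ?divr_gt0// mulrC.
Qed.

Let bad (e1 : R) k (s : k.-tuple D) : Prop :=
  e1 * (Num.sqrt k%:R)^-1 < enorm (rem s).

Let mbad e1 k : (0 < k)%N -> measurable [set s : k.-tuple D | bad e1 s].
Proof.
move=> k0; apply: measurable_enorm_gt; apply: vmeasurableB; first exact: mt.
apply: vmeasurableD; first exact: vmeasurable_cst.
apply: vmeasurableZ; first exact: measurable_cst.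
have [mpsi _ _] := csi.
move=> i; under eq_fun do rewrite summxE.
by apply: measurable_sum => j; exact: measurableT_comp (mpsi i) (measurable_tnth j).
Qed.

Lemma case_remainder_cvg (e : R) : 0 < e ->
  pr [set w | e * (Num.sqrt n%:R)^-1 < enorm (case_remainder n w)] @[n --> \oo] --> (0 : R).
Proof.
move=> e0; apply/cvgrPdist_le => r r0.
have r30 : 0 < r / 3 by rewrite divr_gt0.
have ipsi := integrable_weighted_influence_sqr (mW 0%N) lawQt p0 csi.
have Epsi := Rintegral_weighted_influence (mW 0%N) lawQt p0 csi.
have [L L0 hL] := tight_normalized_sum mW indepW lawW mphi ipsi Epsi r30.
pose c1 : R := (Num.sqrt (p / 2))^-1.
have c10 : 0 < c1 by rewrite invr_gt0 sqrtr_gt0 divr_gt0.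
have m0 : 0 < m.+1%:R :> R by rewrite ltr0n.
pose e1 := e / (2 * m.+1%:R * c1).
have e10 : 0 < e1 by rewrite divr_gt0// !mulr_gt0.
pose eta := Num.min (p / 2) (e * p / (4 * m.+1%:R * L)).
have eta0 : 0 < eta by rewrite lt_min !divr_gt0// !mulr_gt0.
have etap : eta <= p / 2 by rewrite ge_min lexx.
have etaL : eta <= e * p / (4 * m.+1%:R * L) by rewrite ge_min lexx orbT.
have bound : m%:R * (e1 * c1 + 2 * eta / p * L) <= e.
  have h1 : e1 * c1 = e / (2 * m.+1%:R) by rewrite /e1; field; rewrite !gt_eqF.
  have h2 : 2 * eta / p * L <= e / (2 * m.+1%:R).
    have -> : e / (2 * m.+1%:R) = 2 * (e * p / (4 * m.+1%:R * L)) / p * L.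
      by field; rewrite !gt_eqF.
    by rewrite ler_pM2r// ler_pM2r ?invr_gt0// ler_pM2l.
  have h3 : m%:R * (e / m.+1%:R) <= e.
    by rewrite mulrCA ler_piMr ?(ltW e0)// ler_pdivrMr// mul1r ler_nat.
  apply: le_trans h3; rewrite ler_wpM2l// h1.
  have -> : e / m.+1%:R = e / (2 * m.+1%:R) + e / (2 * m.+1%:R).
    by field; rewrite gt_eqF.
  by rewrite lerD2l.
have cbad : pr ((fun w => [tuple Z i w | i < k]) @^-1` [set s | bad e1 s]) @[k --> \oo] --> (0 : R).
  have := oP_fine lin e10; apply: cvg_trans; apply: near_eq_cvg; apply: nearW => k.
  have remE w : rem [tuple Z i w | i < k] = t [tuple Z i w | i < k] -
      (theta + k%:R^-1 *: \sum_(i < k) psi (Z i w)).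
    by rewrite /rem; under eq_bigr do rewrite tnth_mktuple.
  by congr (pr _); apply/seteqP; split=> w /=; rewrite /bad remE.
pose A1 n := [set w | eta * n%:R < `|(N n w)%:R - n%:R * p|].
pose A2 n := bad_cases W (bad e1) n.
pose A3 n := [set w | L < enorm (normalized_sum W phi n w)].
have /cvgrPdist_le/(_ _ r30) hbad :=
  bad_cases_cvg mW indepW lawW lawQt p0 (mbad e1) cbad.
have /cvgrPdist_le/(_ _ r30) hdev := weak_law_cases mW indepW lawW lawQt eta0.
near=> n.
have n0 : (0 < n)%N by near: n; exact: nbhs_infty_gt.
have nn0 : 0 < Num.sqrt n%:R :> R by rewrite sqrtr_gt0 ltr0n.
have mA1 : measurable (A1 n) by exact: measurable_size_dev_gt.
have mA2 : measurable (A2 n) by exact: (measurable_bad_cases x0 mW (mbad e1)).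
have mA3 : measurable (A3 n).
  by apply: measurable_enorm_gt; exact: vmeasurable_normalized_sum.
have p1 : `|0 - pr (A1 n)| <= r / 3 by near: n.
have p2 : `|0 - pr (A2 n)| <= r / 3 by near: n.
have p3 : pr (A3 n) <= r / 3 by near: n.
rewrite sub0r normrN ger0_norm ?fine_prob_ge0// in p1.
rewrite sub0r normrN ger0_norm ?fine_prob_ge0// in p2.
rewrite sub0r normrN ger0_norm ?fine_prob_ge0//.
apply: le_trans (_ : pr ((A1 n) `|` (A2 n) `|` (A3 n)) <= _); last first.
  have := fine_probU_le P (measurableU _ _ mA1 mA2) mA3.
  by have := fine_probU_le P mA1 mA2; lra.
apply: fine_prob_le.
- by apply: measurable_enorm_gt; exact: vmeasurable_case_remainder.
- by apply: measurableU => //; exact: measurableU.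
move=> w /= big.
have [|d1] := ltP (eta * n%:R) `|(N n w)%:R - n%:R * p|; first by left; left.
have [|d3] := ltP L (enorm (normalized_sum W phi n w)); first by right.
left; right.
have [d2|d2] := ltP (e1 * (Num.sqrt (N n w)%:R)^-1) (enorm (rem (in_tuple (cases W n w)))).
  split => //; rewrite lt0n; apply/eqP => N0; move: d1; rewrite N0 sub0r normrN.
  rewrite ger0_norm ?mulr_ge0 ?(ltW p0)// mulrC ler_pM2r ?ltr0n//.
  by move: etap p0; lra.
have [_] := enorm_case_remainder n0 (ltW e10) (ltW eta0) etap d1 d2 d3.
rewrite -/c1 => hh; exfalso; move: big; rewrite ltNge => /negP; apply.
by apply: le_trans hh _; rewrite ler_wpM2r// invr_ge0 ltW.
Unshelve. all: end_near. Qed.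

Lemma case_statistic_linear : linear_expansion P case_statistic theta
  (fun j w => phi (W j w)).
Proof.
apply: fine_oP; first exact: vmeasurable_case_remainder.
exact: case_remainder_cvg.
Qed.

Lemma case_statistic_asymptotically_normal :
  asymptotically_normal P (fun n w => Num.sqrt n%:R *: (case_statistic n w - theta))
    0 (p^-1 *: dispersion Qt psi).
Proof.
have ipsi := integrable_weighted_influence_sqr (mW 0%N) lawQt p0 csi.
have Epsi := Rintegral_weighted_influence (mW 0%N) lawQt p0 csi.
rewrite -(second_moment_weighted_influence (mW 0%N) lawQt p0 csi (erefl (W 0%N))).
have [d2 [Om2 [P2 [G gG]]]] := gaussian_vector_exists (psd_second_moment_mx mW mphi ipsi).
exists d2, Om2, P2, G; split => //.
have mZ := vmeasurable_normalized_sum mW mphi.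
have mT n : vmeasurable (fun w => Num.sqrt n%:R *: (case_statistic n w - theta)).
  apply: vmeasurableZ => //; apply: vmeasurableB; first exact: vmeasurable_case_statistic.
  exact: vmeasurable_cst.
have close (e : R) : 0 < e ->
    pr [set w | e < enorm (Num.sqrt n%:R *: (case_statistic n w - theta) -
      normalized_sum W phi n w)] @[n --> \oo] --> (0 : R).
  move=> e0; have := case_remainder_cvg e0; apply: cvg_trans; apply: near_eq_cvg.
  near=> n; have n0 : (0 < n)%N by near: n; exact: nbhs_infty_gt.
  have sn0 : 0 < Num.sqrt n%:R :> R by rewrite sqrtr_gt0 ltr0n.
  have e2 w : Num.sqrt n%:R *: (case_statistic n w - theta) - normalized_sum W phi n w =
      Num.sqrt n%:R *: case_remainder n w.
    rewrite /case_remainder opprD addrA [RHS]scalerBr; congr (_ - _).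
    rewrite scalerA; congr (_ *: _).
    rewrite -sqr_inv_sqrtn.
    by field; rewrite gt_eqF.
  congr (pr _); apply/seteqP; split=> w /=;
    by rewrite e2 enormZ (ger0_norm (ltW sn0)) (mulrC (Num.sqrt n%:R)) ltr_pdivrMr.
have [mG _] := gG.
apply: cvg_in_law_trigpoly => //.
  apply: (tight_slutsky mZ mT close).
  have tn := tight_normalized_sum mW indepW lawW mphi ipsi Epsi. exact: tn.
move=> h th; apply: (trigpoly_slutsky mZ mT close th).
by have := trigpoly_clt mW indepW lawW mphi ipsi Epsi gG th.
Unshelve. all: end_near. Qed.

End complete_case_linear_expansion.

Lemma measurable_true_event d (Om : measurableType d) (b : {mfun Om >-> bool}) :
  measurable [set w | b w].
Proof.
exact: (measurable_preimageT (measurable_funPT b) (I : measurable [set true])).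
Qed.

Lemma prob_true_event d (Om : measurableType d) (R : realType) (P : probability Om R)
    (delta : {RV P >-> bool}) (p : R) :
  ('E_P[(fun w => (delta w)%:R)%R] = p%:E)%E -> P [set w | delta w] = p%:E.
Proof.
move=> <-; rewrite unlock; have md := measurable_true_event delta.
rewrite -[in LHS](setIT [set w | delta w]) -integral_indic//; apply: eq_integral => w _ /=.
by rewrite indicE; case E : (delta w); [rewrite mem_set|rewrite memNset//= E].
Qed.

Theorem mainTheorem1 (R : realType) (dX : measure_display)
    (TX : measurableType dX) (m : nat)
    (QQ : set (probability (TX * R)%type R))
    (T : probability (TX * R)%type R -> 'cV[R]_m)
    (t : forall k : nat, k.-tuple (TX * R)%type -> 'cV[R]_m)
    (ht : forall k : nat, (0 < k)%N -> vmeasurable (t k))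
    (psi : probability (TX * R)%type R -> TX * R -> 'cV[R]_m)
    (hlin : asymptotically_linear t T QQ psi)
    (* the model: (X, Y, delta) with (X, Y) ~ Q and E[delta] > 0 *)
    (d0 : measure_display) (Om0 : measurableType d0) (P0 : probability Om0 R)
    (X : {RV P0 >-> TX}) (Y : {RV P0 >-> R}) (delta : {RV P0 >-> bool})
    (Q : probability (TX * R)%type R) (hQ : QQ Q)
    (hXY : has_law P0 (fun w => (X w, Y w)) Q)
    (p : R) (hp : ('E_P0[(fun w => (delta w)%:R)%R] = p%:E)%E) (hp0 : 0 < p)
    (* the data: independent copies of (X, delta Y, delta) *)
    (d1 : measure_display) (Om : measurableType d1) (P : probability Om R)
    (Xs : nat -> {RV P >-> TX}) (Ys : nat -> {RV P >-> R})
    (deltas : nat -> {RV P >-> bool})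
    (hiid : iid P
      (fun j w => (Xs j w, (deltas j w)%:R * Ys j w, deltas j w))
      (pushforward P0 (fun w => (X w, (delta w)%:R * Y w, delta w))))
    (Qt : probability (TX * R)%type R)
    (hQt : is_cond_law P0 (fun w => (X w, Y w)) delta Qt)
    (hQtQQ : QQ Qt) (hT : T Qt = T Q)
    (c : 'cV[R]_m) :
  let Tc := complete_case_stat Xs Ys deltas t c in
  [/\ linear_expansion P Tc (T Q)
        (fun j w => ((deltas j w)%:R / p) *: psi Qt (Xs j w, Ys j w)),
      (* the influence function psi_tilde in the missing data model *)
      [/\ vmeasurable (psi_tilde p (psi Qt)),
          centered_square_integrable P0
            (fun w => psi_tilde p (psi Qt) (X w, (delta w)%:R * Y w, delta w)) &
          linear_expansion P Tc (T Q)
            (fun j w => psi_tilde p (psi Qt)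
               (Xs j w, (deltas j w)%:R * Ys j w, deltas j w))] &
      asymptotically_normal P
        (fun n w => Num.sqrt n%:R *: (Tc n w - T Q))
        0 (p^-1 *: dispersion Qt (psi Qt))].
Proof.
move=> Tc; have [indepW lawP] := hiid; have [csi lin] := hlin Qt hQtQQ.
pose W j w := (Xs j w, (deltas j w)%:R * Ys j w, deltas j w).
pose W0 w := (X w, (delta w)%:R * Y w, delta w).
have mbool : measurable_fun [set: bool] (fun b : bool => b%:R : R) by [].
have mtriple d2 (Om2 : measurableType d2) (x : {mfun Om2 >-> TX}) (y : {mfun Om2 >-> R})
    (b : {mfun Om2 >-> bool}) : measurable_fun setT (fun w => (x w, (b w)%:R * y w, b w)).
  apply: measurable_fun_pair => //; apply: measurable_fun_pair => //.
  by apply: measurable_funM => //; exact: (measurableT_comp mbool).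
have mW j : measurable_fun setT (W j) by exact: mtriple.
have mW0 : measurable_fun setT W0 by exact: mtriple.
have lawE j A : measurable A -> P (W j @^-1` A) = P0 (W0 @^-1` A) by exact: lawP.
have lawW j A : measurable A -> P (W j @^-1` A) = P (W 0%N @^-1` A).
  by move=> mA; rewrite !lawE.
have lawQ0 A : measurable A -> fine (P0 (W0 @^-1` (A `*` [set true]))) = p * fine (Qt A).
  move=> mA; rewrite hQt// (prob_true_event hp) inver gt_eqF//=.
  have -> : W0 @^-1` (A `*` [set true]) = (fun w => (X w, Y w)) @^-1` A `&` [set w | delta w].
    by apply/seteqP; split=> w /=; [move=> [h e]; move: h; rewrite e mul1r|move=> [h ->]; rewrite mul1r].
  set B := _ `&` _; have mB : measurable B.
    apply: measurableI; last exact: measurable_true_event.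
    by apply: measurable_preimageT => //; exact/measurable_fun_pair.
  rewrite -[P0 B]fineK ?fin_num_measure// -EFinM/= mulrCA divff ?mulr1// gt_eqF//.
have lawQt A : measurable A -> fine (P (W 0%N @^-1` (A `*` [set true]))) = p * fine (Qt A).
  by move=> mA; rewrite lawE ?lawQ0//; exact: measurableX.
have [w0] : exists w : Om, True.
  apply: contrapT => noOm; have := probability_setT P.
  rewrite (_ : setT = set0) ?measure0; last by apply/seteqP; split=> w //; case: noOm; exists w.
  by move/eqP; rewrite eq_sym onee_eq0.
move=> _; pose x0 := (Xs 0%N w0, Ys 0%N w0).
pose Z k := mfun_of (measurable_kth_case x0 mW k).
have linZ : linear_expansion P (fun k w => t k [tuple kth_case W x0 i w | i < k]) (T Q)
    (fun j w => psi Qt (kth_case W x0 j w)).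
  rewrite -hT; apply: (lin _ _ P Z).
  exact: (kth_case_iid x0 mW indepW lawW lawQt hp0).
have TcE : Tc = case_statistic W t c.
  apply/funext => n; apply/funext => w; rewrite /Tc /complete_case_stat /case_statistic.
  suff -> : complete_cases Xs Ys deltas n w = cases W n w by [].
  apply/eq_in_map => j; rewrite mem_filter => /andP[dj _].
  by rewrite /= dj mul1r.
have expansion := case_statistic_linear mW indepW lawW lawQt hp0 c csi ht linZ.
split.
- rewrite TcE (_ : (fun j w => _) = fun j w => weighted_influence p (psi Qt) (W j w))//.
  apply/funext => j; apply/funext => w; rewrite /weighted_influence /W /=.
  by case: (deltas j w); rewrite ?mul1r// !mul0r !scale0r.
- split.
  + exact: (vmeasurable_weighted_influence p csi).
  + exact: (centered_weighted_influence mW0 lawQ0 hp0 csi).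
  + by rewrite TcE.
- rewrite TcE.
  exact: (case_statistic_asymptotically_normal mW indepW lawW lawQt hp0 c csi ht linZ).
Qed.
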